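(* Let $r\geq 8$ be an integer and let $G$ be a finite simple planar graph with $\Delta(G)\leq r$. Then $G$ has an equitable $r$-coloring.
   Context: $\Delta(G)$ denotes the maximum degree of $G$. An equitable $k$-coloring of a graph is a proper vertex coloring with $k$ colors (some color classes may be empty) such that any two color classes $V_i,V_j$ satisfy $||V_i|-|V_j||\leq 1$. *)

(* Defs.v *)
From mathcomp Require Import all_boot all_order all_algebra.
From mathcomp Require Import all_classical all_reals all_analysis.

Set Implicit Arguments.
Unset Strict Implicit.
Unset Printing Implicit Defensive.

Import Order.TTheory GRing.Theory Num.Theory.
Import numFieldNormedType.Exports.

Local Open Scope ring_scope.

(* A finite simple graph is a symmetric irreflexive relation [e] on a finite
   type [T]; both properties are hypotheses of the statements using [e]. *)
Section Graph.
Variables (T : finType) (e : rel T).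

Definition neighbors (v : T) : {set T} := [set w | e v w]%SET.

Definition max_degree : nat := (\max_(v : T) #|neighbors v|)%N.

Definition edges : {set {set T}} :=
  [set E : {set T} | [exists u, exists v, e u v && (E == [set u; v])]]%SET.

Definition proper_coloring k (c : T -> 'I_k) : Prop :=
  forall u v, e u v -> c u != c v.

Definition color_class k (c : T -> 'I_k) (i : 'I_k) : {set T} :=
  [set v | c v == i]%SET.

Definition equitable_coloring k (c : T -> 'I_k) : Prop :=
  proper_coloring c /\
  forall i j : 'I_k,
    `| #|color_class c i|%:Z - #|color_class c j|%:Z | <= 1.

End Graph.

Section Planar.
Variables (R : realType) (T : finType) (e : rel T).
Local Open Scope classical_set_scope.

Definition arc_between (a b : R * R) (A : set (R * R)) : Prop :=
  exists gamma : R -> R * R,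
    [/\ {within `[0, 1], continuous gamma},
        {in `[0, 1] &, injective gamma},
        gamma 0 = a, gamma 1 = b & A = gamma @` `[0, 1]].

Definition edge_interior (p : T -> R * R) (A : {set T} -> set (R * R))
    (E : {set T}) : set (R * R) :=
  A E `\` (p @` [set` E]).

(* [p] places the vertices in the plane and [A E] is the (image of the) curve
   representing the edge [E]. *)
Definition plane_drawing (p : T -> R * R) (A : {set T} -> set (R * R)) : Prop :=
  [/\ injective p,
      forall u v, e u v -> arc_between (p u) (p v) (A [set u; v]%SET),
      forall E, E \in edges e -> edge_interior p A E `&` range p = set0
    & forall E F, E \in edges e -> F \in edges e -> E != F ->
        edge_interior p A E `&` A F = set0].

Definition planar : Prop := exists p A, plane_drawing p A.

End Planar.

(* Main.v *)
(* Planarity enters only through the two bounds of Euler's formula: at most 3n-6 edges between n >= 3 vertices,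
   and at most 2n-4 between the two sides of a bipartite subgraph. They are obtained by replacing the two
   halves of each edge curve by walks in a fine square grid. The walks from u, suitably cut, form a connected
   branch set, so that the graph becomes a minor of the grid. Over F_2, a cycle of the grid is the boundary of a
   set of squares; hence the cycle space of the graph is spanned by the boundaries of the faces (classes of
   squares joined through unused grid edges), and comparing dimensions bounds the number of faces from below,
   while each face has at least three edges (four in the bipartite case).

   A graph with these bounds and with maximum degree at most r >= 8 is then colored in the manner of
   Kierstead and Kostochka. If r divides n, insert the edges at a vertex x of degree at most 5 into an equitably
   colored graph. A class is accessible if x can move into it by a chain of moves; take a coloring with the
   largest number a of accessible classes. If no coloring works, x has a neighbor in each of them, so a <= 5, and
   a vertex y outside has a neighbor w in every accessible class; w is often its only one there, and y is then a
   solo neighbor of w. Edges between accessible and other classes are so many that a is 1 or 2, or r = 8 and a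
   is 3 or 5. A vertex w with two nonadjacent solos y, y' can be exchanged with y, making the class of y'
   accessible, unless w has further neighbors; this bounds the number of solos of each w. Counting edges between
   the strongly connected components of the classes under moves gives a contradiction in each case. If n = rs-p
   with 0 < p < r, add a disjoint K_p if p <= 4, and otherwise remove a vertex of degree at most 5 and put it
   back into one of p+1 >= 6 small classes. *)

(* The constant 8 and the exceptional values of [a] come from one inequality. If no vertex of a
   class can move into another class, each of its [s] vertices has a neighbor there. So if [m]
   classes have no moves in both directions with any of the remaining ones, at least [m(r-m)s] edges
   join the two sides, and the bipartite bound gives [m(r-m) < 2r]. For [r >= 9] this leaves only
   [m <= 2] or [m >= r-2]; for [r = 8] it excludes just [m = 4], which is why most of the work
   concerns [r = 8]. It is applied to the accessible classes, to strong components and to their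
   unions. The surviving configurations miss a contradiction by very little, and the counts there
   must exploit that [x] is isolated until its edges are inserted, that some vertex of a nonroot
   class can move, or the additive constants in Euler's bounds. No form of the Jordan curve theorem
   is used: compactness gives disjoint curves a positive distance, and in the grid the squares
   bounded by a cycle are found by an explicit sum. *)
Require Import Defs.
From mathcomp Require Import all_classical all_reals all_analysis.
From mathcomp Require Import all_boot all_order all_algebra.
From mathcomp Require Import zify ring lra.

Set Implicit Arguments.
Unset Strict Implicit.
Unset Printing Implicit Defensive.

(** * Rotations of colorings *)

Section Rotation.
Variables (T : finType) (r : nat) (e : rel T).
Hypotheses (e_sym : symmetric e) (e_irr : irreflexive e).
Implicit Types (c : {ffun T -> 'I_r}) (p : seq T).

Definition is_proper c := [forall u, forall v, e u v ==> (c u != c v)].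
Definition balanced s c := [forall i : 'I_r, #|[set v | c v == i]| == s].

(** [v] can enter the class of [v'] once [v'] leaves it; [v'] itself may or may not be adjacent to
    [v]. *)
Definition only_neighbor c v v' := [forall u, e v u && (c u == c v') ==> (u == v')].

(** Composing with the permutation [next p] leaves all class sizes unchanged. *)
Definition rot c p : {ffun T -> 'I_r} := [ffun v => c (next p v)].

Lemma is_properP c : reflect (forall u v, e u v -> c u != c v) (is_proper c).
Proof.
apply: (iffP forallP) => [H u v euv|H u]; last by apply/forallP => v; apply/implyP/H.
by move/forallP: (H u) => /(_ v)/implyP/(_ euv).
Qed.

Lemma only_neighborP c v v' :
  reflect (forall u, e v u -> c u = c v' -> u = v') (only_neighbor c v v').
Proof.
apply: (iffP forallP) => [H u evu cu|H u].
  by apply/eqP; move: (H u); rewrite evu cu eqxx.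
by apply/implyP => /andP[evu /eqP cu]; apply/eqP/H.
Qed.

Lemma next_id p v : v \notin p -> next p v = v.
Proof. by move=> pv; rewrite next_nth (negPf pv). Qed.

Lemma balanced_rot s c p : uniq p -> balanced s c -> balanced s (rot c p).
Proof.
move=> up /forallP bc; apply/forallP => i; rewrite -(eqP (bc i)); apply/eqP.
rewrite -(card_preimset [set v | c v == i] (can_inj (prev_next up))).
by apply: eq_card => v; rewrite !inE ffunE.
Qed.

Lemma uniq_map_inj (U : eqType) (f : T -> U) p :
  uniq (map f p) -> {in p &, injective f}.
Proof.
move=> ufp u v up vp fuv; have uqp := map_uniq ufp.
apply/eqP; rewrite -[u](nth_index u up) -[v](nth_index u vp).
rewrite nth_uniq ?index_mem // -(nth_uniq (f u) _ _ ufp) ?size_map ?index_mem //.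
by rewrite !(nth_map u) ?index_mem // !nth_index // fuv.
Qed.

Lemma next_last p y : uniq (rcons p y) -> next (rcons p y) y = head y p.
Proof.
case: p => [|v p] up; first by rewrite /= eqxx.
have := @next_nth T (rcons (v :: p) y) y; rewrite mem_rcons inE eqxx /= => ->.
rewrite /= rcons_uniq mem_rcons inE in up.
case/andP: up; rewrite negb_or => /andP[/negPf vx _] /andP[xp _]; rewrite vx.
by rewrite -cats1 index_cat (negPf xp) /= eqxx addn0 nth_default // size_cat addn1.
Qed.

(** Each vertex of [p] enters the class of its successor, where that successor is its only possible
    neighbor and leaves. As [p] meets every class at most once, no two vertices enter the same
    class. *)
Lemma proper_rot c p :
  uniq (map c p) -> cycle (only_neighbor c) p -> is_proper c -> is_proper (rot c p).
Proof.
move=> ucp cyc /is_properP pc; have up := map_uniq ucp.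
have injc := uniq_map_inj ucp.
have key u v : u \in p -> e u v -> c (next p u) <> c (next p v).
  move=> pu euv cuv; case pv : (v \in p); last first.
    move: cuv; rewrite [next p v](next_id (negbT pv)) => cuv.
    have := only_neighborP _ _ _ (next_cycle cyc pu) v euv (esym cuv).
    by move=> vE; move: pv; rewrite vE mem_next pu.
  have nuv : next p u = next p v by apply: injc; rewrite ?mem_next.
  by move: euv; rewrite (can_inj (prev_next up) nuv) e_irr.
apply/is_properP => u v euv; rewrite !ffunE; apply/eqP => cuv.
case pu : (u \in p); first exact: (key u v).
case pv : (v \in p); first by apply: (key v u pv) => //; rewrite e_sym.
by move: (pc _ _ euv); rewrite !next_id ?pu ?pv // in cuv; rewrite cuv eqxx.
Qed.

End Rotation.

(** * Accessible classes *)

Section Accessibility.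
Variables (T : finType) (r s : nat) (e : rel T) (x : T).
Hypotheses (e_sym : symmetric e) (e_irr : irreflexive e).
Implicit Types (c : {ffun T -> 'I_r}) (p : seq T) (i j : 'I_r).

(** The graph before the edges at [x] are inserted; [x] may then sit in any class. *)
Definition isolate : rel T := [rel u v | [&& e u v, u != x & v != x]].
Local Notation e' := isolate.

Lemma isolate_sym : symmetric e'.
Proof. by move=> u v; rewrite /isolate /= e_sym [(u != x) && _]andbC. Qed.

Lemma isolate_irr : irreflexive e'.
Proof. by move=> u; rewrite /isolate /= e_irr. Qed.

Lemma isolateW u v : e' u v -> e u v.
Proof. by case/and3P. Qed.

Lemma isolatex u : e' x u = false.
Proof. by rewrite /isolate /= eqxx andbF. Qed.

Lemma isolatex' u : e' u x = false.
Proof. by rewrite isolate_sym isolatex. Qed.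

Definition good c := is_proper e' c && balanced s c.

Definition movable c v j := [forall u, e' v u ==> (c u != j)].

(* For [y = x], which is isolated, this is plain movability between classes; any other [y] is about to
   leave its class. *)
Definition arc c y i j :=
  [exists v, (c v == i) && [forall u, e' v u && (c u == j) ==> (u == y)]].

(** Arcs follow the moves: shifting one vertex along each arc of a path from [i] to the class of [x]
    frees a place in [i], which [x] can take. *)
Definition acc c := [set i | connect (arc c x) i (c x)].

Lemma movableP c v j : reflect (forall u, e' v u -> c u <> j) (movable c v j).
Proof.
apply: (iffP forallP) => [H u evu|H u].
  by apply/eqP; move: (H u); rewrite evu.
by apply/implyP => /H/eqP.
Qed.

Lemma arcxP c i j : reflect (exists2 v, c v = i & movable c v j) (arc c x i j).
Proof.
apply: (iffP existsP) => [[v /andP[/eqP cv H]]|[v cv /movableP H]].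
  exists v => //; apply/movableP => u evu cu.
  move/forallP: H => /(_ u); rewrite evu cu eqxx => /eqP ux.
  by rewrite ux isolatex' in evu.
exists v; rewrite cv eqxx; apply/forallP => u; apply/implyP => /andP[evu /eqP].
by move/H: evu.
Qed.

Lemma arcW c y i j : arc c x i j -> arc c y i j.
Proof.
move/arcxP => [v cv /movableP H]; apply/existsP; exists v; rewrite cv eqxx.
by apply/forallP => u; apply/implyP => /andP[/H + /eqP].
Qed.

Lemma connectW c y i j : connect (arc c x) i j -> connect (arc c y) i j.
Proof. by apply: connect_sub => a b /arcW H; apply: connect1. Qed.

Lemma acc_root c : c x \in acc c.
Proof. by rewrite inE connect0. Qed.

Lemma acc_step c i j : arc c x i j -> j \in acc c -> i \in acc c.
Proof. by rewrite !inE => a; apply/connect_trans/connect1. Qed.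

Lemma acc_connect c i j : connect (arc c x) i j -> j \in acc c -> i \in acc c.
Proof. by rewrite !inE; apply: connect_trans. Qed.

(** Picks a vertex realizing each arc. The exception that [arc] grants to [y] can matter only at the
    last step, because the classes on the path are distinct. *)
Lemma flow_path c y i q : path (arc c y) i q -> uniq (i :: q) -> last i q = c y ->
  exists p, map c (rcons p y) = i :: q /\ sorted (only_neighbor e' c) (rcons p y).
Proof.
elim: q i => [|j q IH] i; first by move=> _ _ /= ->; exists [::].
rewrite [path _ _ _]/= => /andP[aij pq] /andP[iq uq] lq.
have [p [Ep sp]] := IH j pq uq lq.
have [v /andP[/eqP cv /forallP H]] := existsP aij.
exists (v :: p); split; first by rewrite /= Ep cv.
case: p Ep sp => [|v' p] /= Ep sp; rewrite ?andbT ?sp ?andbT;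
  apply/only_neighborP => u evu; case: Ep => -> Eq cu; move: (H u); rewrite evu cu eqxx => /eqP uy //.
by case/andP: uq; rewrite -Eq map_rcons mem_rcons -uy cu inE eqxx.
Qed.

Lemma flow c y i : connect (arc c y) i (c y) ->
  exists p, [/\ sorted (only_neighbor e' c) (rcons p y), uniq (map c (rcons p y)),
     c (head y p) = i & forall v, v \in p -> connect (arc c y) i (c v) /\ connect (arc c y) (c v) (c y)].
Proof.
case/connectP => q0 /shortenP[q pq uq _] lq.
have [p [Ep sp]] := flow_path pq uq (esym lq).
exists p; split => //; first by rewrite Ep.
  by case: p Ep {sp} => [|v p] /= [].
move=> v vp; have : c v \in i :: q by rewrite -Ep map_f // mem_rcons inE vp orbT.
rewrite inE => cvq; split.
  by case/predU1P: cvq => [->|cvq]; rewrite ?connect0 // (path_connect pq) // inE cvq orbT.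
case/predU1P: cvq => [->|/splitPr cvq]; first by rewrite lq; apply/connectP; exists q.
case: cvq pq lq {uq Ep} => q1 q2; rewrite cat_path /= => /and3P[_ _ p2] lq.
by apply/connectP; exists q2; rewrite // lq last_cat.
Qed.

End Accessibility.

(** * Moves between colorings *)

Section Moves.
Variables (T : finType) (r s : nat) (e : rel T) (x : T).
Hypotheses (e_sym : symmetric e) (e_irr : irreflexive e).
Hypothesis stuck : forall c : {ffun T -> 'I_r}, good s e x c -> exists2 u, e x u & c u = c x.
Implicit Types (c : {ffun T -> 'I_r}) (p : seq T) (i j : 'I_r).
Local Notation e' := (isolate e x).
Local Notation good := (good s e x).
Local Notation acc := (acc e x).
Local Notation arc := (arc e x).
Local Notation movable := (movable e x).
Local Notation only c := (only_neighbor e' c).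
Let s' := isolate_sym x e_sym.
Let i' := isolate_irr x e_irr.

Lemma good_rot c p : uniq (map c p) -> cycle (only c) p -> good c -> good (rot c p).
Proof.
move=> up cp /andP[pc bc]; rewrite /good proper_rot //=.
by apply: balanced_rot => //; apply: map_uniq up.
Qed.

Lemma only_root c v : only c x v.
Proof. by apply/only_neighborP => u; rewrite isolatex. Qed.

(** Shifting along a path from [i] puts [x] into class [i], where [stuck] provides a neighbor. It
    was in [i] all along, since only [x] has entered that class. *)
Lemma acc_neighbor c i : good c -> i \in acc c -> exists2 u, e x u & c u = i.
Proof.
move=> gc; rewrite inE => /flow[p [sp up hp _]].
have cp : cycle (only c) (rcons p x).
  case: p sp {up hp} => [|v p] /=; first by rewrite only_root.
  by move=> sp; rewrite rcons_path sp last_rcons only_root.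
have [u exu] := stuck (good_rot up cp gc).
have ux := map_uniq up.
have nx := next_last ux.
rewrite !ffunE nx hp => cu.
case pu : (u \in rcons p x); last by exists u; rewrite // -cu next_id // pu.
have px : x \in rcons p x by rewrite mem_rcons inE eqxx.
have : next (rcons p x) u = next (rcons p x) x.
  by apply: (uniq_map_inj up); rewrite ?mem_next // nx cu hp.
by move/(can_inj (prev_next ux)) => uE; rewrite uE e_irr in exu.
Qed.

(** A spanning tree of the accessible classes directed towards the class of [x]. Fixing one witness
    per class makes it possible to check that an exchange destroys no accessibility. *)
Record arc_tree c := ArcTree {
  parent : 'I_r -> 'I_r;
  witness : 'I_r -> T;
  rank : 'I_r -> nat;
  arc_treeP : forall i, i \in acc c -> i != c x ->
    [/\ c (witness i) = i, parent i \in acc c, movable c (witness i) (parent i)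
      & rank (parent i) < rank i] }.

Lemma ex_arc_tree c : inhabited (arc_tree c).
Proof.
pose reach n := iter n (fun S : {set 'I_r} => S :|: [set i | [exists j in S, arc c x i j]]) [set c x].
have reachP i : i \in acc c -> exists n, i \in reach n.
  rewrite inE => /connectP[q]; elim: q i => [|j q IH] i /=.
    by move=> _ <-; exists 0; rewrite inE.
  case/andP=> aij pq lq; have [n jn] := IH j pq lq.
  exists n.+1; rewrite !inE; apply/orP; right.
  by apply/existsP; exists j; rewrite jn.
have acc_reach i n : i \in reach n -> i \in acc c.
  elim: n i => [|n IH] i; first by rewrite !inE => /eqP->; rewrite connect0.
  rewrite /= !inE => /orP[/IH|]; rewrite ?inE // => /existsP[j /andP[/IH]].
  by move=> ja aij; have := acc_step aij ja; rewrite inE.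
have rkP i : {n : nat | i \in acc c -> i \in reach n /\ forall m, i \in reach m -> n <= m}.
  case: (boolP (i \in acc c)) => [ia|_]; last by exists 0.
  have ex := reachP i ia; case: (ex_minnP ex) => n In minn; by exists n.
(* The rank is the distance to the class of [x]. *)
pose rk i := sval (rkP i).
have step i : {jw : 'I_r * T | i \in acc c -> i != c x -> 
   [/\ c jw.2 = i, jw.1 \in acc c, movable c jw.2 jw.1 & rk jw.1 < rk i]}.
  pose P (jw : 'I_r * T) := [&& c jw.2 == i, jw.1 \in acc c, movable c jw.2 jw.1 & rk jw.1 < rk i].
  case: (pickP P) => [jw /and4P[/eqP]|H]; first by exists jw.
  exists (c x, x) => ia ix; exfalso.
  have [In mn] := svalP (rkP i) ia; move: In mn; rewrite -/(rk i).
  case rki : (rk i) => [|n]; first by rewrite inE (negPf ix).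
  rewrite [reach _]/= in_setU => /orP[/[swap]/[apply]|]; first by rewrite ltnn.
  rewrite inE => /existsP[j /andP[jn /(arcxP x e_sym)[v cv mv]]] _.
  have ja := acc_reach _ _ jn.
  have [_ mj] := svalP (rkP j) ja.
  by have := H (j, v); rewrite /P /= cv eqxx ja mv /= rki ltnS mj.
exists; exists (fun i => (sval (step i)).1) (fun i => (sval (step i)).2) rk => i.
exact: (svalP (step i)).
Qed.

Lemma tree_path c (t : arc_tree c) i : i \in acc c ->
  exists p, [/\ sorted (fun v v' => only c v v' && (c v' == parent t (c v))) (rcons p x),
    uniq (map c (rcons p x)), c (head x p) = i &
    forall v, v \in p -> [/\ c v \in acc c, c v != c x, v = witness t (c v) & rank t (c v) <= rank t i]].
Proof.
have [n] := ubnP (rank t i); elim: n i => // n IH i; rewrite ltnS => rn ia.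
have [->|ix] := eqVneq i (c x); first by exists [::].
have [wi pa mv rk] := arc_treeP t ia ix.
have [p [sp up hp Hp]] := IH _ (leq_trans rk rn) pa.
exists (witness t i :: p); split=> //=.
- have -> : forall R, path R (witness t i) (rcons p x) =
     R (witness t i) (head x p) && sorted R (rcons p x) by move=> R; case: p {sp up hp Hp}.
  rewrite sp hp wi eqxx !andbT; apply/only_neighborP => u + cu.
  by move/movableP: mv => /[apply]; rewrite cu hp.
- rewrite up andbT map_rcons mem_rcons inE wi (negPf ix) /=.
  by apply/mapP => -[v /Hp[_ _ _ +] iE]; rewrite -iE leqNgt rk.
- move=> v; rewrite inE => /predU1P[->|/Hp[va vx vw vr]]; rewrite ?wi //.
  by split=> //; apply: leq_trans vr (ltnW rk).
Qed.

(** Shifts the witnesses along the tree path from [i] to the root. [P] is the set of shifted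
    witnesses; the bound on their ranks shows later that none of them enters class [i]. *)
Lemma reroot c (t : arc_tree c) i : good c -> i \in acc c ->
  exists P : {set T}, 
    (forall v, v \in P -> [/\ c v \in acc c, c v != c x, v = witness t (c v) & rank t (c v) <= rank t i]) /\
    exists2 c1, good c1 &
      forall v, c1 v = if v == x then i else if v \in P then parent t (c v) else c v.
Proof.
move=> gc ia; have [p [sp up hp Hp]] := tree_path t ia.
exists [set v in p]; split=> [v|]; first by rewrite inE => /Hp.
have ux := map_uniq up.
have sp1 : sorted (only c) (rcons p x).
  by apply: sub_sorted sp => u v /andP[].
have cp : cycle (only c) (rcons p x).
  case: p sp1 {up hp Hp sp ux} => [|v p] /=; first by rewrite only_root.
  by move=> sp; rewrite rcons_path sp last_rcons only_root.
have cR : cycle (fun v v' => (v != x) ==> (c v' == parent t (c v))) (rcons p x).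
  have : sorted (fun v v' => (v != x) ==> (c v' == parent t (c v))) (rcons p x).
    by apply: sub_sorted sp => u v /andP[_ ->]; rewrite implybT.
  case: p {up hp Hp sp ux sp1 cp} => [|v p] /=; first by rewrite eqxx.
  by move=> sp; rewrite rcons_path sp last_rcons eqxx.
exists (rot c (rcons p x)); first exact: good_rot.
move=> v; rewrite ffunE; case: eqP => [->|/eqP vx]; first by rewrite next_last.
rewrite inE; case: ifP => vp; last by rewrite next_id // mem_rcons inE (negPf vx) vp.
have := next_cycle cR (_ : v \in rcons p x).
by rewrite mem_rcons inE vp orbT vx => /(_ isT)/eqP.
Qed.

(* The vertices of the classes of [acc c], without [x] but with [y], can be rearranged to fill these classes,
   so that [x] takes the place of [y]. *)
Definition hole c y := exists2 c2, good c2 &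
  [/\ c2 x = c y, forall v, v != x -> (c2 v \notin acc c) = (c v \notin acc c) && (v != y)
    & forall v, v != x -> c2 v \notin acc c -> c2 v = c v].

Definition solo c w y := isolate e x w y && only c y w.

(** After rerooting [x] into [i], rotate: [w] replaces [x], [y] replaces [w], and [x] replaces [y].
    The condition on ranks keeps [w] off the shifted path, and the last condition keeps the
    witnesses shifted into the class of [w] from being neighbors of [y]. *)
Lemma hole_movable_aux c (t : arc_tree c) w y i : good c ->
  c w \in acc c -> w != x -> c y \notin acc c -> solo c w y ->
  i \in acc c -> i != c w -> movable c w i ->
  ~~ [&& c w != c x, w == witness t (c w) & rank t (c w) <= rank t i] ->
  (forall j, j \in acc c -> j != c x -> rank t j <= rank t i -> parent t j = c w -> ~~ e' y (witness t j)) ->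
  hole c y.
Proof.
move=> gc wa wx ya /andP[ewy /only_neighborP oy] ia iw /movableP mv wP clean.
have [P [HP [c1 gc1 c1E]]] := reroot t gc ia.
have wP' : w \notin P by apply/negP => /HP[_ wcx wE rk]; rewrite wcx -wE eqxx rk in wP.
have yx : y != x by apply: contraNneq ya => ->; apply: acc_root.
have yP : y \notin P by apply/negP => /HP[ya']; rewrite ya' in ya.
have c1w : c1 w = c w by rewrite c1E (negPf wx) (negPf wP').
have c1y : c1 y = c y by rewrite c1E (negPf yx) (negPf yP).
have c1x : c1 x = i by rewrite c1E eqxx.
have uc1 : uniq (map c1 [:: w; x; y]).
  rewrite /= c1w c1y c1x !inE negb_or eq_sym iw /= andbT.
  by rewrite !(contraNneq _ ya) //= => [<-|<-].
have cyc : cycle (only c1) [:: w; x; y].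
  rewrite /= andbT; apply/and3P; split.
  - apply/only_neighborP => u ewu; rewrite c1x c1E.
    case: eqP => // /eqP ux; case: ifP => uP; last by move/mv: ewu.
    have [ua ucx uw rk] := HP _ uP => pu.
    by have [_ _ _] := arc_treeP t ua ucx; rewrite pu ltnNge rk.
  - exact: only_root.
  - apply/only_neighborP => u eyu; rewrite c1w c1E.
    case: eqP => [ux|/eqP ux]; first by rewrite ux isolatex' in eyu.
    case: ifP => uP cu; last exact: oy.
    have [ua ucx uw rk] := HP _ uP.
    by have := clean _ ua ucx rk cu; rewrite -uw eyu.
have gc2 := good_rot uc1 cyc gc1.
have xw : x != w by rewrite eq_sym.
have yw : y != w by apply: contraNneq ya => ->.
exists (rot c1 [:: w; x; y]) => //.
have c2E v : rot c1 [:: w; x; y] v = if v == w then i else if v == x then c y else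
   if v == y then c w else c1 v.
  rewrite ffunE /=.
  have [vw|vw] := eqVneq v w; first by rewrite c1x.
  have [vx|vx] := eqVneq v x; first by rewrite c1y.
  by have [vy|vy] := eqVneq v y; rewrite ?c1w.
have c1B v : v != x -> (c1 v \notin acc c) = (c v \notin acc c).
  move=> vx; rewrite c1E (negPf vx); case: ifP => // /HP[va vcx _ _].
  by have [_ -> _ _] := arc_treeP t va vcx; rewrite va.
split.
- by rewrite c2E (negPf xw) eqxx.
- move=> v vx; rewrite c2E (negPf vx); have [->|vw] := eqVneq v w; first by rewrite wa ia.
  have [vy|vy] := eqVneq v y; first by rewrite wa andbF.
  by rewrite andbT c1B.
- move=> v vx; rewrite c2E (negPf vx); have [->|vw] := eqVneq v w; first by rewrite ia.
  have [vy|vy] := eqVneq v y; first by rewrite wa.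
  rewrite c1E (negPf vx); case: ifP => // /HP[va vcx _ _].
  by have [_ -> _ _] := arc_treeP t va vcx.
Qed.

(* Moving a clean [y] into the class [j] preserves the tree arcs into [j]. *)
Definition clean c (t : arc_tree c) j y :=
  [forall i in acc c, (i != c x) && (parent t i == j) ==> ~~ isolate e x y (witness t i)].

(** With [i] the parent of [j], only witnesses of rank below that of [j] are shifted, and none of
    them enters [j]; so [y] need not be clean. *)
Lemma hole_witness c (t : arc_tree c) j y : good c ->
  j \in acc c -> j != c x -> c y \notin acc c -> solo c (witness t j) y -> hole c y.
Proof.
move=> gc ja jx ya sy; have [wj pa mv rk] := arc_treeP t ja jx.
have wx : witness t j != x by apply: contraNneq jx => <-; rewrite wj.
apply: (hole_movable_aux (t := t) gc _ wx ya sy pa _ mv); rewrite ?wj //.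
- by apply: contraTneq rk => ->; rewrite ltnn.
- by rewrite leqNgt rk !andbF.
- move=> k ka kx rk1 pk; have [_ _ _] := arc_treeP t ka kx.
  by rewrite pk ltnNge (leq_trans rk1 (ltnW rk)).
Qed.

(** If [w] lies on the path that would be shifted, it is the witness of its class and [hole_witness]
    applies. *)
Lemma hole_movable c (t : arc_tree c) w y i : good c ->
  c w \in acc c -> w != x -> c y \notin acc c -> solo c w y -> clean t (c w) y ->
  i \in acc c -> i != c w -> movable c w i -> hole c y.
Proof.
move=> gc wa wx ya sy /forall_inP cl ia iw mv.
have [/and3P[wcx /eqP wE _]|wP] := boolP [&& c w != c x, w == witness t (c w) & rank t (c w) <= rank t i].
  by apply: (hole_witness (t := t) gc wa wcx ya); rewrite -wE.
apply: (hole_movable_aux gc wa wx ya sy ia iw mv wP) => j ja jx _ pj.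
by have /implyP := cl j ja; rewrite jx pj eqxx => /(_ isT).
Qed.

(** * Colorings with the largest number of accessible classes *)

Section Extremal.
Variable c : {ffun T -> 'I_r}.
Hypotheses (gc : good c) (cmax : forall c', good c' -> #|acc c'| <= #|acc c|).
Variable t : arc_tree c.

Definition reaches j := [set i | (i \notin acc c) && connect (arc c x) i j].

Lemma reach_notin i j : connect (arc c x) i j -> i \notin acc c -> j \notin acc c.
Proof. by move=> cij; apply: contraNN; apply: acc_connect. Qed.

(** In the coloring given by the hole, [x] lies in the class of [y], and the inaccessible classes
    have lost [y] and gained no other vertex than [x]. Arcs leaving the other inaccessible classes
    survive, so all classes reaching that of [y] become accessible. *)
Lemma hole_reaches y : c y \notin acc c -> hole c y ->
  #|reaches (c y)| <= #|acc c| /\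
  forall i, i \in reaches (c y) -> exists2 u, e x u & c u = i.
Proof.
move=> ya [c2 gc2 [c2x c2a c2E]].
have sub : reaches (c y) \subset acc c2.
  apply/subsetP => i; rewrite inE => /andP[ia /connectP[q]].
  elim: q i ia => [|j q IH] i ia /=; first by move=> _ <-; rewrite -c2x acc_root.
  case/andP=> aij pq lq.
  have ja : j \notin acc c by apply: reach_notin ia; apply: connect1.
  have [->|iy] := eqVneq i (c y); first by rewrite -c2x acc_root.
  apply: acc_step (IH j ja pq lq); have [v cv /movableP mv] := arcxP x e_sym _ _ _ aij.
  have vx : v != x by apply: contraNneq ia => vx; rewrite -cv vx acc_root.
  have vy : v != y by apply: contraNneq iy => <-; rewrite cv.
  apply/(arcxP x e_sym); exists v.
    by rewrite c2E // c2a // cv ia.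
  apply/movableP => u evu c2u.
  have ux : u != x by apply: contraTneq evu => ->; rewrite isolatex'.
  by apply: (mv u evu); rewrite -c2E // c2u.
split; first exact: leq_trans (subset_leq_card sub) (cmax gc2).
move=> i ir; have := subsetP sub i ir => /(acc_neighbor gc2)[u exu c2u].
move: ir; rewrite inE => /andP[ia _]; exists u => //; rewrite -c2u c2E ?c2u //.
by apply: contraTneq exu => ->; rewrite e_irr.
Qed.

(** Disregarding [y] as a neighbor creates new arcs only into the class of [y]. *)
Lemma reach_relaxed_notin y i j :
  connect (arc c y) i j -> c y \notin acc c -> i \notin acc c -> j \notin acc c.
Proof.
move=> /connectP[q pq ->] ya; elim: q i pq => [|k q IH] i //= /andP[aik pq] ia.
apply: IH pq _; have [-> //|ky] := eqVneq k (c y).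
apply: contraNN ia; apply: acc_step; apply/(arcxP x e_sym).
have [v /andP[/eqP cv /forallP H]] := existsP aik; exists v => //.
apply/movableP => u evu cu; move: (H u); rewrite evu cu eqxx => /eqP uy.
by move: ky; rewrite -cu uy eqxx.
Qed.

(* Exchanging [w] with its solo neighbor [y1] makes the class of [y2] accessible. *)
Lemma exchange w y1 y2 i :
  c w \in acc c -> ((c w != c x) ==> (w != witness t (c w))) ->
  c y1 \notin acc c -> solo c w y1 -> clean t (c w) y1 ->
  c y2 \notin acc c -> solo c w y2 -> y2 != y1 -> ~~ isolate e x y1 y2 ->
  i \notin acc c -> connect (arc c y1) i (c y1) ->
  (forall u, isolate e x w u -> c u = i -> u = y1) -> False.
Proof.
move=> wa /implyP wt y1a /andP[ewy1 oy1] /forall_inP cl y2a /andP[ewy2 oy2] y21 ey12 ia ciy Hw.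
have [p [sp up hp Hp]] := flow ciy.
have pa v : v \in rcons p y1 -> c v \notin acc c.
  rewrite mem_rcons inE => /predU1P[-> //|/Hp[civ _]].
  exact: reach_relaxed_notin civ y1a ia.
pose q := w :: rcons p y1.
have uq : uniq (map c q).
  rewrite /= up andbT; apply/mapP => -[v /pa va cv]; by rewrite -cv wa in va.
have hq : cycle (only c) q.
  have hpath : only c w (head y1 p).
    apply/only_neighborP => u ewu; rewrite hp => cu; have uy := Hw u ewu cu.
    case: p {sp Hp pa q uq} up hp => [|v p] //= /andP[+ _] cv.
    by rewrite map_rcons mem_rcons inE cv -cu uy eqxx.
  rewrite /= rcons_path last_rcons oy1 andbT.
  by case: p sp hpath {up hp Hp pa q uq} => [|v p] /= sp ->.
have uniq_q := map_uniq uq.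
have nextw : next q w \in rcons p y1.
  have : next q w \in q by rewrite mem_next inE eqxx.
  rewrite inE => /predU1P[nw|//].
  have : next q y1 = next q w by rewrite nw /q -rcons_cons next_last.
  move/(can_inj (prev_next uniq_q)) => yw.
  by rewrite yw wa in y1a.
have nexty : next q y1 = w.
  by rewrite /q -rcons_cons next_last // rcons_cons.
pose c' := rot c q.
have gc' : good c' by apply: good_rot.
have c'p v : v \in q -> v != y1 -> c' v \notin acc c.
  move=> vq vy; rewrite ffunE; apply: pa.
  have : next q v \in q by rewrite mem_next.
  rewrite inE => /predU1P[nv|//].
  by move: vy; rewrite (can_inj (prev_next uniq_q) (etrans nv (esym nexty))) eqxx.
have c'y : c' y1 = c w by rewrite ffunE nexty.
have c'E v : c' v \in acc c -> v = y1 \/ [/\ c' v = c v & v != w].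
  move=> va; have [->|vy] := eqVneq v y1; first by left.
  have vq : v \notin q by apply: contraTN va => /c'p; apply.
  right; split; first by rewrite ffunE next_id.
  by apply: contraNneq vq => ->; rewrite inE eqxx.
have c'A v : c v \in acc c -> v != w -> c' v = c v.
  move=> va vw; rewrite ffunE next_id // inE (negPf vw) /=.
  by apply: contraTN va => /pa.
have wx : w != x by apply: contraTneq ewy1 => ->; rewrite isolatex.
have c'x : c' x = c x by rewrite c'A ?acc_root // eq_sym.
(* The tree arcs survive: [w] is not the witness of its class, and a clean [y1] blocks no witness
   moving into that class. *)
have sub : acc c \subset acc c'.
  apply/subsetP => j; have [n] := ubnP (rank t j); elim: n j => // n IH j; rewrite ltnS => rn ja.
  have [->|jx] := eqVneq j (c x); first by rewrite -c'x acc_root.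
  have [wj pja /movableP mv rk] := arc_treeP t ja jx.
  apply: acc_step (IH _ (leq_trans rk rn) pja); apply/(arcxP x e_sym).
  have wjw : witness t j != w.
    apply/eqP => wE; have cwj : c w = j by rewrite -wE.
    by have := wt; rewrite cwj wE eqxx jx => /(_ isT).
  exists (witness t j); first by rewrite c'A // wj.
  apply/movableP => u eu cu; have : c' u \in acc c by rewrite cu.
  case/c'E=> [uy|[cuE uw]]; last by apply: (mv u eu); rewrite -cuE.
  have /implyP := cl j ja; rewrite jx -cu uy c'y eqxx => /(_ isT).
  by rewrite isolate_sym // -uy eu.
have y2w : y2 != w by apply: contraNneq y2a => ->.
have y2n : c' y2 \notin acc c.
  case y2q : (y2 \in q); first exact: c'p.
  by rewrite ffunE next_id ?y2q.
(* [w] was the only neighbor of [y2] in its class, and its replacement [y1] is not adjacent to [y2].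
   The class meant is the new one of [y2], which may itself lie on the rotated path. *)
have y2n' : c' y2 \in acc c'.
  apply: acc_step (subsetP sub _ wa); apply/(arcxP x e_sym); exists y2 => //.
  apply/movableP => u eu cu; have : c' u \in acc c by rewrite cu.
  case/c'E=> [uy|[cuE uw]]; first by rewrite isolate_sym // -uy eu in ey12.
  by move: uw; rewrite (only_neighborP _ _ _ _ oy2 u eu) ?eqxx // -cuE.
have : acc c \proper acc c' by apply/properP; split=> //; exists (c' y2).
by move/proper_card; rewrite ltnNge cmax.
Qed.

End Extremal.
End Moves.

(** * Sparse graphs *)

Section Sparse.
Variables (T : finType).
Implicit Types (e : rel T) (X Y : {set T}).

Definition edge_count e X Y := \sum_(u in X) #|[set v in Y | e u v]|.

(** [edge_count e X X] counts every edge twice, so the first bound says at most [3n - 6] edges;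
    between disjoint sides each edge counts once. *)
Definition sparse e :=
  (forall X, 3 <= #|X| -> edge_count e X X + 12 <= 6 * #|X|) /\
  (forall X Y, [disjoint X & Y] -> 3 <= #|X| + #|Y| ->
     edge_count e X Y + 4 <= 2 * (#|X| + #|Y|)).

Lemma edge_count_sub e1 e2 X Y : subrel e1 e2 -> edge_count e1 X Y <= edge_count e2 X Y.
Proof.
move=> sub; apply: leq_sum => u _; apply: subset_leq_card.
by apply/subsetP => v; rewrite !inE => /andP[-> /sub].
Qed.

Lemma card_sum_sep (X : {set T}) (P : pred T) : #|[set v in X | P v]| = \sum_(v in X) P v.
Proof.
rewrite -sum1dep_card big_mkcondr /=.
by apply: eq_bigr => v _; case: (P v).
Qed.

Lemma edge_count_sum e X Y : edge_count e X Y = \sum_(u in X) \sum_(v in Y) e u v.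
Proof.
by apply: eq_bigr => u _; rewrite card_sum_sep.
Qed.

Lemma edge_count_sym e X Y : symmetric e -> edge_count e X Y = edge_count e Y X.
Proof.
move=> e_sym; rewrite !edge_count_sum exchange_big.
by apply: eq_bigr => u _; apply: eq_bigr => v _; rewrite e_sym.
Qed.

Lemma edge_count_full e X Y : (forall u v, u \in X -> v \in Y -> e u v) ->
  edge_count e X Y = #|X| * #|Y|.
Proof.
move=> H; rewrite edge_count_sum -sum_nat_const; apply: eq_bigr => u uX.
by rewrite -sum1_card; apply: eq_bigr => v vY; rewrite H.
Qed.

Lemma sparse_sub e1 e2 : subrel e1 e2 -> sparse e2 -> sparse e1.
Proof.
move=> sub [H1 H2]; split=> [X hX|X Y dXY hXY].
  by apply: leq_trans (H1 X hX); rewrite leq_add2r edge_count_sub.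
by apply: leq_trans (H2 X Y dXY hXY); rewrite leq_add2r edge_count_sub.
Qed.

Lemma sparse_no_K5 e X : sparse e -> irreflexive e -> 5 <= #|X| ->
  ~ {in X &, forall u v, u != v -> e u v}.
Proof.
move=> [H1 _] e_irr X5 H; have := H1 X (leq_trans _ X5) => /(_ isT).
suff -> : edge_count e X X = #|X| * #|X|.-1 by nia.
rewrite edge_count_sum -sum_nat_const; apply: eq_bigr => u uX.
rewrite (bigD1 u) //= e_irr add0n (cardsD1 u X) uX add1n /=.
rewrite -sum1_card; apply: eq_big => [v|v /andP[vX vu]]; first by rewrite !inE andbC.
by rewrite H // eq_sym.
Qed.

Lemma sparse_no_K33 e X Y : sparse e -> [disjoint X & Y] -> 3 <= #|X| -> 3 <= #|Y| ->
  ~ {in X & Y, forall u v, e u v}.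
Proof.
move=> [_ H2] dXY X3 Y3 H; have := H2 X Y dXY (leq_trans X3 (leq_addr _ _)).
by rewrite edge_count_full //; nia.
Qed.

End Sparse.

Section Degrees.
Variables (T : finType) (r s : nat) (e : rel T) (x : T).
Hypotheses (e_sym : symmetric e) (e_irr : irreflexive e) (e_sparse : sparse e).
Hypothesis e_deg : forall v, #|[set u | e v u]| <= r.
Variable c : {ffun T -> 'I_r}.
Hypothesis gc : good s e x c.
Implicit Types (I J : {set 'I_r}) (i j : 'I_r).
Local Notation e' := (isolate e x).

Definition deg v j := #|[set u | e' v u & c u == j]|.
Definition degs v J := \sum_(j in J) deg v j.
Definition links I J := \sum_(v | c v \in I) degs v J.

Lemma deg_eq0 v j : (deg v j == 0) = movable e x c v j.
Proof.
rewrite cards_eq0; apply/eqP/movableP => [H u evu cu|H].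
  have : u \in set0 by rewrite -H inE evu cu eqxx.
  by rewrite inE.
by apply/setP => u; rewrite !inE; apply/andP => -[/H + /eqP].
Qed.

Lemma degsE v J : degs v J = #|[set u | e' v u & c u \in J]|.
Proof.
rewrite -sum1dep_card (partition_big c (mem J)) /=; last by move=> u /andP[].
apply: eq_bigr => j jJ; rewrite /deg -sum1dep_card; apply: eq_bigl => u.
by case: eqP => [->|]; rewrite ?jJ ?andbT // !andbF.
Qed.

Lemma degsU v I J : [disjoint I & J] -> degs v (I :|: J) = degs v I + degs v J.
Proof. by move=> d; rewrite /degs -bigU //; apply: eq_bigl => j; rewrite !inE. Qed.

Lemma degs1 v j : degs v [set j] = deg v j.
Proof. by rewrite /degs big_set1. Qed.

Lemma degs_le v J : degs v J <= r.
Proof.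
rewrite degsE; apply: leq_trans (e_deg v); apply: subset_leq_card.
by apply/subsetP => u; rewrite !inE => /andP[/and3P[]].
Qed.

Lemma degsS v I J : I \subset J -> degs v I <= degs v J.
Proof.
move=> sIJ; rewrite !degsE; apply: subset_leq_card.
by apply/subsetP => u; rewrite !inE => /andP[-> /(subsetP sIJ)].
Qed.

Lemma degs_root J : degs x J = 0.
Proof.
by rewrite degsE; apply: eq_card0 => u; rewrite !inE (negPf (negbT (isolatex _ _ _))).
Qed.

Lemma class_card i : #|[set v | c v == i]| = s.
Proof. by case/andP: gc => _ /forallP/(_ i)/eqP. Qed.

Lemma classes_card J : #|[set v | c v \in J]| = #|J| * s.
Proof.
rewrite -sum1dep_card (partition_big c (mem J)) //= -sum_nat_const.
apply: eq_bigr => j jJ; rewrite -(class_card j) -sum1dep_card; apply: eq_bigl => u.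
by case: eqP => [->|]; rewrite ?jJ ?andbF.
Qed.

Lemma linksE I J : links I J = edge_count e' [set v | c v \in I] [set v | c v \in J].
Proof.
rewrite /edge_count; apply: eq_big => [v|v _]; rewrite ?inE // degsE.
by apply: eq_card => u; rewrite !inE andbC.
Qed.

Lemma links_sym I J : links I J = links J I.
Proof. by rewrite !linksE edge_count_sym //; apply: isolate_sym. Qed.

Lemma links_sum I J : links I J = \sum_(i in I) links [set i] J.
Proof.
rewrite /links (partition_big c (mem I)) //=; apply: eq_bigr => i iI.
by apply: eq_bigl => v; rewrite inE; case: eqP => [->|]; rewrite ?iI ?andbF.
Qed.

Lemma links_sum2 I J : links I J = \sum_(i in I) \sum_(j in J) links [set i] [set j].
Proof.
rewrite links_sum; apply: eq_bigr => i iI.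
rewrite links_sym links_sum; apply: eq_bigr => j jJ; exact: links_sym.
Qed.

Lemma linksU I J1 J2 : [disjoint J1 & J2] -> links I (J1 :|: J2) = links I J1 + links I J2.
Proof. by move=> d; rewrite /links -big_split; apply: eq_bigr => v _; rewrite degsU. Qed.

Lemma isolate_sparse : sparse e'.
Proof. by apply: sparse_sub e_sparse => u v; apply: isolateW. Qed.

Lemma links_disjoint I J : [disjoint I & J] -> 3 <= (#|I| + #|J|) * s ->
  links I J + 4 <= 2 * ((#|I| + #|J|) * s).
Proof.
move=> dIJ h; rewrite linksE mulnDl -!classes_card.
apply: isolate_sparse.2; last by rewrite !classes_card -mulnDl.
rewrite -setI_eq0; apply/eqP/setP => u; rewrite !inE; apply/andP => -[uI uJ].
by move: dIJ => /disjointFr/(_ uI); rewrite uJ.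
Qed.

Lemma links_all : 3 <= r * s -> links setT setT + 12 <= 6 * (r * s).
Proof.
move=> h; have := classes_card setT; rewrite cardsT card_ord => cT.
by rewrite linksE -cT; apply: isolate_sparse.1; rewrite cT.
Qed.

Lemma links_full i J : (forall j, j \in J -> ~~ arc e x c x i j) -> #|J| * s <= links [set i] J.
Proof.
move=> H; rewrite /links -(class_card i) mulnC -sum1dep_card big_distrl /=.
rewrite [leqRHS](eq_bigl (fun v => c v == i)) => [|v]; last by rewrite inE.
apply: leq_sum => v /eqP cv; rewrite mul1n -sum1_card; apply: leq_sum => j jJ.
rewrite lt0n deg_eq0; apply: contra (H j jJ) => mv.
by apply/(arcxP x e_sym); exists v.
Qed.

(** A missing arc in either direction forces [s] edges between two classes, as every vertex of one
    has a neighbor in the other. *)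
Lemma links_ge I J :
  (forall i j, i \in I -> j \in J -> ~~ arc e x c x i j || ~~ arc e x c x j i) ->
  #|I| * #|J| * s <= links I J.
Proof.
move=> H; rewrite links_sum2 -mulnA -sum_nat_const; apply: leq_sum => i iI.
rewrite -sum_nat_const; apply: leq_sum => j jJ.
have one k l : ~~ arc e x c x k l -> s <= links [set k] [set l].
  move=> nkl; have := @links_full k [set l]; rewrite cards1 mul1n; apply.
  by move=> l'; rewrite inE => /eqP->.
by case/orP: (H i j iI jJ) => /one //; rewrite links_sym.
Qed.

End Degrees.

Lemma card_disjointU (U : finType) (C D : {set U}) : [disjoint C & D] -> #|C :|: D| = #|C| + #|D|.
Proof. by move=> d; have [_ /esym] := leq_card_setU C D; rewrite d => /esym/eqP. Qed.

Section Stuck.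
Variables (T : finType) (r s : nat) (e : rel T) (x : T).
Hypotheses (e_sym : symmetric e) (e_irr : irreflexive e) (e_sparse : sparse e).
Hypothesis e_deg : forall v, #|[set u | e v u]| <= r.
Hypothesis x_deg : #|[set u | e x u]| <= 5.
Hypothesis stuck : forall c : {ffun T -> 'I_r}, good s e x c -> exists2 u, e x u & c u = c x.
Variable c : {ffun T -> 'I_r}.
Hypotheses (gc : good s e x c)
  (cmax : forall c' : {ffun T -> 'I_r}, good s e x c' -> #|acc e x c'| <= #|acc e x c|).
Variable t : arc_tree e x c.
Hypotheses (r8 : 8 <= r) (s0 : 0 < s).
Implicit Types (I J : {set 'I_r}) (i j : 'I_r) (w y u : T).
Local Notation e' := (isolate e x).
Local Notation A := (acc e x c).
Local Notation B := (~: acc e x c).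
Local Notation a := #|acc e x c|.
Local Notation b := #|~: acc e x c|.
Local Notation deg := (deg e x c).
Local Notation degs := (degs e x c).
Local Notation links := (links e x c).
Local Notation arc := (arc e x c).
Local Notation movable := (movable e x c).
Local Notation solo := (solo e x c).
Local Notation hole := (hole s e x c).
Local Notation reaches := (reaches e x c).
Local Notation clean := (clean t).
Let e'_sym := isolate_sym x e_sym.
Let e'_irr := isolate_irr x e_irr.

Lemma card_AB : a + b = r.
Proof. by rewrite cardsC card_ord. Qed.

Lemma a_gt0 : 0 < a.
Proof. by apply/card_gt0P; exists (c x); apply: acc_root. Qed.

Lemma only_deg w y : e' w y -> only_neighbor e' c y w = (deg y (c w) == 1).
Proof.
move=> ewy; apply/only_neighborP/cards1P => [H|[z Hz] u eyu cu].
  exists w; apply/setP => u; rewrite !inE; apply/andP/eqP => [[eyu /eqP]|->].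
    exact: H.
  by rewrite e'_sym ewy eqxx.
have : w \in [set z] by rewrite -Hz inE e'_sym ewy eqxx.
have : u \in [set z] by rewrite -Hz inE eyu cu eqxx.
by rewrite !inE => /eqP-> /eqP->.
Qed.

Lemma soloE w y : solo w y = e' w y && (deg y (c w) == 1).
Proof. by rewrite /solo; case: (boolP (e' w y)) => // /only_deg->. Qed.

Lemma acc_root_neighbors : A \subset c @: [set u | e x u].
Proof.
apply/subsetP => i /(acc_neighbor e_sym e_irr stuck gc)[u exu <-].
by rewrite imset_f // inE.
Qed.

Lemma acc_le5 : a <= 5.
Proof.
apply: leq_trans (subset_leq_card acc_root_neighbors) _.
exact: leq_trans (leq_imset_card _ _) x_deg.
Qed.

(** The accessible classes and those reaching the hole are disjoint, and each contains one of the at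
    most five neighbors of [x]. *)
Lemma hole_bound y : c y \in B -> hole y ->
  #|reaches (c y)| <= a /\ a + #|reaches (c y)| <= 5.
Proof.
rewrite in_setC => yB hy; have [h1 h2] := hole_reaches e_sym e_irr stuck cmax yB hy; split=> //.
rewrite -cardsUI (_ : _ :&: _ = set0) ?cards0 ?addn0; last first.
  by apply/setP => i; rewrite !inE; case: connect.
apply: leq_trans (leq_trans (leq_imset_card c [set u | e x u]) x_deg).
apply: subset_leq_card; apply/subsetP => i; rewrite in_setU => /orP[/(subsetP acc_root_neighbors)//|].
by case/h2=> u exu <-; rewrite imset_f // inE.
Qed.

Lemma B_A_noarc i j : i \in B -> j \in A -> ~~ arc x i j.
Proof. by rewrite in_setC => iB jA; apply: contra iB => aij; apply: acc_step aij jA. Qed.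

Lemma B_deg v j : c v \in B -> j \in A -> 0 < deg v j.
Proof.
move=> vB jA; rewrite lt0n deg_eq0; apply: contra (B_A_noarc vB jA) => mv.
by apply/(arcxP x e_sym); exists v.
Qed.

Lemma linksAB_ge : a * b * s <= links A B.
Proof. by apply: links_ge => // i j iA jB; rewrite (B_A_noarc jB iA) orbT. Qed.

(** Together with [a <= 5] this excludes [a = 4] always, and [a = 3] and [a = 5] for [r >= 9]. *)
Lemma a_bound : a * (r - a) < 2 * r \/ b = 0.
Proof.
have ab := card_AB; have [->|b0] := posnP b; [by right | left].
have rs : 3 <= r * s by nia.
have := @links_disjoint _ _ _ _ x e_sparse c gc A B; rewrite ab => /(_ _ rs).
have -> : [disjoint A & B] by rewrite -setI_eq0 setICr.
move=> /(_ isT); have := linksAB_ge; have -> : r - a = b by lia.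
by nia.
Qed.

(** * Clean solo neighbors *)

Definition solos w := [set y | [&& c y \in B, solo w y & clean (c w) y]].
(** The solos without a nonadjacent partner, to which [exchange] does not apply. *)
Definition universal w := [set y in solos w | [forall y' in solos w, (y' != y) ==> e' y y']].
Definition missed w := [set j in B | deg w j == 0].

Lemma solosP w y : reflect [/\ c y \notin A, solo w y & clean (c w) y] (y \in solos w).
Proof. by rewrite [y \in solos w]in_set in_setC; apply: and3P. Qed.

Lemma universal_sub w : universal w \subset solos w.
Proof. by apply/subsetP => y; rewrite inE => /andP[]. Qed.

Lemma solos_neighbors w : solos w \subset [set y | e' w y & c y \in B].
Proof. by apply/subsetP => y /solosP[yB /andP[ewy _] _]; rewrite inE in_setC ewy. Qed.

Lemma card_solos_le w : #|solos w| <= degs w B.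
Proof. by rewrite degsE; apply: subset_leq_card (solos_neighbors w). Qed.

Lemma nonuniversal w y : y \in solos w :\: universal w ->
  y \in solos w /\ exists y', [/\ y' \in solos w, y' != y & ~~ e' y y'].
Proof.
rewrite in_setD => /andP[+ yK]; rewrite inE yK /= => /forall_inPn[y' y'K].
by rewrite negb_imply => /andP[y'y ey]; split=> //; exists y'.
Qed.

(* Otherwise [w] is needed to keep its own class accessible. *)
Definition mobile_root w := (c w != c x) ==> (w != witness t (c w)).

Lemma exchange_solos w y i : c w \in A -> mobile_root w ->
  y \in solos w :\: universal w -> i \in B -> connect (arc y) i (c y) ->
  (forall u, e' w u -> c u = i -> u = y) -> False.
Proof.
move=> wA mw /nonuniversal[/solosP[yB sy cly] [y' [/solosP[y'B sy' _] y'y ny]]].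
rewrite in_setC => iB ciy Hw.
exact: (exchange e_sym e_irr gc cmax wA mw yB sy cly y'B sy' y'y ny iB ciy Hw).
Qed.

(** Otherwise [w] could take the place of [y] directly: [exchange] with a path of length 0. *)
Lemma two_neighbors w y : c w \in A -> mobile_root w -> y \in solos w :\: universal w -> 1 < deg w (c y).
Proof.
move=> wA mw yK; rewrite ltnNge; apply/negP => d1.
have [/solosP[yB /andP[ewy _] _] _] := nonuniversal yK.
apply: (exchange_solos wA mw yK (i := c y)); rewrite ?in_setC ?connect0 // => u ewu cu.
apply/eqP; apply: contraTT d1 => uy; rewrite -ltnNge.
have <- : #|[set u; y]| = 2 by rewrite cards2 uy.
by apply: subset_leq_card; apply/subsetP => v; rewrite !inE => /orP[]/eqP->;
  rewrite ?ewu ?ewy ?cu eqxx.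
Qed.

(** If the missed class reached that of [y], [w] could enter it, and shifting along the path would
    let [y] leave for the class of [w]. *)
Lemma missed_noreach w y j : c w \in A -> mobile_root w -> y \in solos w :\: universal w ->
  j \in missed w -> ~~ connect (arc y) j (c y).
Proof.
move=> wA mw yK; rewrite inE => /andP[jB]; rewrite deg_eq0 => /movableP mj.
by apply/negP => cjy; apply: (exchange_solos wA mw yK jB cjy) => u /mj.
Qed.

Lemma missed_noreach_x w y j : c w \in A -> mobile_root w -> y \in solos w :\: universal w ->
  j \in missed w -> ~~ connect (arc x) j (c y).
Proof.
move=> wA mw yK jZ; apply: contra (missed_noreach wA mw yK jZ); exact: connectW.
Qed.

(** If [y] were the only neighbor of [u] in its class, the arc between these classes relaxed at [y]
    would connect [j] to the class of [y]. This is what relaxed arcs are for. *)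
Lemma missed_deg w y u j : c w \in A -> mobile_root w -> y \in solos w :\: universal w ->
  j \in missed w -> connect (arc x) j (c u) -> e' u y -> 1 < deg u (c y).
Proof.
move=> wA mw yK jZ cju euy; rewrite ltnNge; apply: contra (missed_noreach wA mw yK jZ) => d1.
apply: connect_trans (connectW e_sym y cju) _; apply: connect1.
apply/existsP; exists u; rewrite eqxx; apply/forallP => v; apply/implyP => /andP[euv /eqP cv].
apply: contraTT d1 => vy; rewrite -ltnNge.
have <- : #|[set v; y]| = 2 by rewrite cards2 vy.
by apply: subset_leq_card; apply/subsetP => z; rewrite !inE => /orP[]/eqP->;
  rewrite ?euv ?euy ?cv eqxx.
Qed.

Lemma solos_adj w y : y \in solos w -> e' w y.
Proof. by rewrite inE => /and3P[_ /andP[]]. Qed.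

Definition nsolos w (J : {set 'I_r}) := #|[set y in solos w | c y \in J]|.

Lemma nsolosB w : nsolos w B = #|solos w|.
Proof. by apply: eq_card => y; rewrite in_set; case: solosP => // -[yB _ _]; rewrite in_setC yB. Qed.

(* A class with a single neighbor of [w] accounts for a neighbor that is not a solo, or for a universal solo
   (by [two_neighbors]). *)
Lemma class_count_in w (J : {set 'I_r}) : J \subset B -> c w \in A -> mobile_root w ->
  2 * #|J| <= nsolos w J + 2 * (degs w J - nsolos w J) + #|[set y in universal w | c y \in J]| + 2 * #|missed w :&: J|.
Proof.
move=> JB wA mw; pose KJ := [set y in solos w | c y \in J]; pose UJ := [set y in universal w | c y \in J].
have kd : nsolos w J <= degs w J.
  rewrite degsE; apply/subset_leq_card/subsetP => y /setIdP[/solos_adj ewy yJ].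
  by apply/setIdP.
pose O := [set j in J | deg w j == 1].
have UK : UJ \subset KJ.
  by apply/subsetP => y /setIdP[yU yJ]; apply/setIdP; rewrite (subsetP (universal_sub w)).
have KE : KJ \subset [set y | e' w y & c y \in J].
  by apply/subsetP => y /setIdP[/solos_adj ewy yJ]; apply/setIdP.
have cO : #|O| <= (degs w J - nsolos w J) + #|UJ|.
  pose X := [set y | e' w y & c y \in J] :\: (KJ :\: UJ).
  have -> : degs w J - nsolos w J + #|UJ| = #|X|.
    rewrite degsE cardsD (setIidPr _); last exact: subset_trans (subsetDl _ _) KE.
    rewrite cardsD (setIidPr UK).
    by rewrite addnBAC ?subnBA ?subset_leq_card ?UK ?KE.
  apply: leq_trans (leq_imset_card c X); apply: subset_leq_card.
  apply/subsetP => j /setIdP[jJ dj].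
  have [y Ey] := cards1P dj; have : y \in [set y] by rewrite inE.
  rewrite -Ey => /setIdP[ewy /eqP cy].
  rewrite -cy; apply: imset_f; rewrite in_setD [y \in [set _ | _]]in_set ewy cy jJ !andbT.
  apply/negP => /setDP[/setIdP[yK yJ] yU]; have yKU : y \in solos w :\: universal w.
    by rewrite in_setD yK andbT; apply: contra yU => yU; apply/setIdP.
  by have := two_neighbors wA mw yKU; rewrite cy (eqP dj).
have : \sum_(j in J) (2 - (deg w j == 1) - 2 * (deg w j == 0)) <= degs w J.
  by apply: leq_sum => j _; case: (deg w j) => [|[|n]].
have : \sum_(j in J) (2 - (deg w j == 1) - 2 * (deg w j == 0)) + #|O| + 2 * #|missed w :&: J| = 2 * #|J|.
  have -> : missed w :&: J = [set j in J | deg w j == 0].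
    by apply/setP => j; rewrite in_setI ![_ \in [set _ in _ | _]]in_set; case: (boolP (j \in J)) => [/(subsetP JB)->|]; rewrite ?andbT ?andbF.
  rewrite !card_sum_sep big_distrr mulnC -sum_nat_const -!big_split /=.
  by apply: eq_bigr => j _; case: (deg w j) => [|[|n]].
by move: kd cO; rewrite -/UJ; clear; lia.
Qed.

Lemma class_count w : c w \in A -> mobile_root w ->
  2 * b <= #|solos w| + 2 * (degs w B - #|solos w|) + #|universal w| + 2 * #|missed w|.
Proof.
move=> wA mw; apply: leq_trans (class_count_in (subxx B) wA mw) _; rewrite nsolosB.
apply: leq_add; last by rewrite leq_mul2l subset_leq_card // subsetIl.
by rewrite leq_add2l; apply/subset_leq_card/subsetP => y /setIdP[].
Qed.

Lemma universal_adj w y y' : y \in universal w -> y' \in solos w -> y' != y -> e' y y'.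
Proof. by rewrite inE => /andP[_ /forall_inP H] /H/implyP. Qed.

Lemma e'_sparse : sparse e'.
Proof. exact: isolate_sparse. Qed.

(** [w] and two universal solos, against three further solos, would form a K_{3,3}. *)
Lemma card_universal5 w : 5 <= #|solos w| -> #|universal w| <= 1.
Proof.
move=> k5; rewrite leqNgt; apply/negP => /card_gt1P[u1 [u2 [u1U u2U u12]]].
have u1K := subsetP (universal_sub w) _ u1U; have u2K := subsetP (universal_sub w) _ u2U.
have w1 : w != u1 by apply/eqP => wE; have := solos_adj u1K; rewrite -wE e'_irr.
have w2 : w != u2 by apply/eqP => wE; have := solos_adj u2K; rewrite -wE e'_irr.
have wK : w \notin solos w by apply/negP => /solos_adj; rewrite e'_irr.
apply: (sparse_no_K33 (X := w |: [set u1; u2]) (Y := solos w :\ u1 :\ u2) e'_sparse).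
- rewrite -setI_eq0 -subset0; apply/subsetP => v.
  case/setIP => /setU1P[->|/set2P[]->] /setD1P[v2 /setD1P[v1 vK]].
  + by rewrite vK in wK.
  + by rewrite eqxx in v1.
  + by rewrite eqxx in v2.
- by rewrite cardsU1 cards2 u12 in_set2 negb_or w1 w2.
- have u21 : u2 != u1 by rewrite eq_sym.
  by move: k5; rewrite (cardsD1 u1) u1K (cardsD1 u2 (solos w :\ u1)) in_setD1 u2K u21 !add1n.
- move=> u v uX /setD1P[v2 /setD1P[v1 vK]].
  by case/setU1P: uX => [->|/set2P[]->]; [apply: solos_adj | apply: (@universal_adj w) | apply: (@universal_adj w)].
Qed.

(** With three universal solos among four, all pairs of solos are adjacent, and [w] completes a
    K_5. *)
Lemma card_universal4 w : 4 <= #|solos w| -> #|universal w| <= 2.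
Proof.
move=> k4; have [k5|] := leqP 5 #|solos w|; first exact: leq_trans (card_universal5 k5) _.
rewrite ltnS leqNgt => k4'; apply/negP => u3.
have wK : w \notin solos w by apply/negP => /solos_adj; rewrite e'_irr.
have KU : #|solos w :\: universal w| <= 1.
  by rewrite cardsD (setIidPr (universal_sub w)); lia.
apply: (sparse_no_K5 (X := w |: solos w) e'_sparse e'_irr); first by rewrite cardsU1 wK; lia.
move=> u v /setU1P[->|uK] /setU1P[->|vK] uv; first by rewrite eqxx in uv.
- exact: solos_adj.
- by rewrite e'_sym solos_adj.
have [uU|uU] := boolP (u \in universal w); first by apply: (@universal_adj w); rewrite // eq_sym.
have [vU|vU] := boolP (v \in universal w); first by rewrite e'_sym; apply: (@universal_adj w).
have := card_le1_eqP KU u v; rewrite !in_setD uU vU uK vK => /(_ isT isT) uvE.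
by rewrite uvE eqxx in uv.
Qed.

(** * Counting solo neighbors of a class *)

Lemma sum_nsolos W (J : {set 'I_r}) : W \in A -> J \subset B ->
  \sum_(w | c w == W) nsolos w J = #|[set y | [&& c y \in J, deg y W == 1 & clean W y]]|.
Proof.
move=> WA /subsetP JB; pose X := [set y | [&& c y \in J, deg y W == 1 & clean W y]].
transitivity (\sum_(w | c w == W) \sum_(y in X) e' w y).
  apply: eq_bigr => w /eqP cw; rewrite -card_sum_sep; apply: eq_card => y.
  rewrite ![y \in _]in_set cw in_setC soloE cw.
  have [yJ|_] := boolP (c y \in J); rewrite /= ?andbF //.
  have := JB _ yJ; rewrite in_setC => ->.
  by case: (e' w y); case: (_ == 1); case: (clean _ _).
rewrite exchange_big /= -sum1_card; apply: eq_bigr => y; rewrite in_set => /and3P[_ /eqP <- _].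
rewrite /deg -sum1dep_card [RHS](eq_bigl (fun w => (c w == W) && e' y w)); last first.
  by move=> w; rewrite andbC.
by rewrite [RHS]big_mkcondr; apply: eq_bigr => w _; rewrite (e'_sym w y); case: (e' y w).
Qed.

(** Every vertex has two neighbors in [W], or else just one and is counted in the first term. *)
Lemma card_solos W (J : {set 'I_r}) : (forall y, c y \in J -> 0 < deg y W) ->
  2 * (#|J| * s) <= #|[set y | c y \in J & deg y W == 1]| + links J [set W].
Proof.
move=> H; rewrite -(classes_card gc) mulnC -sum_nat_const.
rewrite (eq_card (B := [set y in [set y | c y \in J] | deg y W == 1])); last first.
  by move=> y; rewrite !in_set.
rewrite card_sum_sep /links; rewrite [X in _ + X](eq_bigl (fun y => y \in [set y | c y \in J])) => [|y]; last by rewrite in_set.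
rewrite -big_split; apply: leq_sum => y; rewrite in_set => /H; rewrite degs1.
by case: (deg y W) => [|[|n]].
Qed.

Lemma card_nonsolos W (J : {set 'I_r}) : (forall y, c y \in J -> 0 < deg y W) ->
  #|[set y | c y \in J & 1 < deg y W]| + #|J| * s <= links J [set W].
Proof.
move=> H; rewrite -(classes_card gc) -[X in _ + X]sum1_card.
rewrite (eq_card (B := [set y in [set y | c y \in J] | 1 < deg y W])); last first.
  by move=> y; rewrite !in_set.
rewrite card_sum_sep /links; rewrite [X in _ <= X](eq_bigl (fun y => y \in [set y | c y \in J])) => [|y]; last by rewrite in_set.
rewrite -big_split; apply: leq_sum => y; rewrite in_set => /H; rewrite degs1.
by case: (deg y W) => [|[|n]].
Qed.

Definition leaf W := [forall i in A, (i != c x) ==> (parent t i != W)].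

Lemma leaf_clean W y : leaf W -> clean W y.
Proof.
move=> /forall_inP lW; apply/forall_inP => i iA; have := lW i iA.
by case: (i == c x) => //= /negPf->.
Qed.

Lemma sum_nsolos_leaf W (J : {set 'I_r}) : leaf W -> W \in A -> J \subset B ->
  2 * (#|J| * s) <= \sum_(w | c w == W) nsolos w J + links J [set W].
Proof.
move=> lW WA JB; rewrite sum_nsolos //.
rewrite (eq_card (B := [set y | c y \in J & deg y W == 1])).
  by apply: card_solos => y /(subsetP JB) yB; apply: B_deg.
by move=> y; rewrite ![y \in _]in_set (leaf_clean y lW) andbT.
Qed.

Lemma ex_leaf : 1 < a -> exists W, [/\ W \in A, W != c x & leaf W].
Proof.
move=> a1; have : 0 < #|A :\ c x| by move: a1; rewrite (cardsD1 (c x)) acc_root.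
case/card_gt0P => i0 i0A; case: (@arg_maxnP _ i0 (fun i => i \in A :\ c x) (rank t) i0A) => W WA Wmax.
have /setD1P[Wx WA'] := WA.
exists W; split=> //; apply/forall_inP => i iA; apply/implyP => ix.
have [_ pA _ rk] := arc_treeP t iA ix; apply: contraTneq rk => pW.
by rewrite -leqNgt pW; apply: Wmax; rewrite in_setD1 ix.
Qed.

Lemma leaf_root : a = 1 -> leaf (c x).
Proof.
move=> a1; apply/forall_inP => i iA; apply/implyP; move: a1.
by rewrite (cardsD1 (c x)) acc_root (cardsD1 i) in_setD1 iA => + ix; rewrite ix.
Qed.

(** A vertex [y] with one neighbor in [W] that is not clean for [W] is adjacent to the witness of a
    child [i] of [W]; by [hole_witness] it then has two neighbors in [i]. So the unclean pairs are
    at most as many as the pairs [(y, i)] with [1 < deg y i], which [card_nonsolos] bounds.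
    Subtracting this from [card_solos] turns 2 into 3 and doubles the links. *)
Lemma sum_nsolos_total (J : {set 'I_r}) : J \subset B -> (forall y, c y \in J -> ~ hole y) ->
  3 * (a * (#|J| * s)) <= \sum_(w | c w \in A) nsolos w J + 2 * links J A.
Proof.
move=> JB nohole.
have JA y i : c y \in J -> i \in A -> 0 < deg y i by move=> /(subsetP JB) yB; apply: B_deg.
pose unclean W := [set y | [&& c y \in J, deg y W == 1 & ~~ clean W y]].
have split W : W \in A -> \sum_(w | c w == W) nsolos w J + #|unclean W| = #|[set y | c y \in J & deg y W == 1]|.
  move=> WA; rewrite sum_nsolos // -cardsUI (_ : _ :&: _ = set0) ?cards0 ?addn0; last first.
    by apply/setP => y; rewrite in_setI !in_set; case: clean; rewrite !andbF.
  by apply: eq_card => y; rewrite in_setU !in_set; case: clean; rewrite /= !(andbT, andbF, orbF).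
have exc : \sum_(W in A) #|unclean W| <= \sum_(i in A) #|[set y | c y \in J & 1 < deg y i]|.
  have -> : \sum_(W in A) #|unclean W| = \sum_(W in A) \sum_(y | c y \in J) ((deg y W == 1) && ~~ clean W y).
    apply: eq_bigr => W _; rewrite -sum1dep_card big_mkcondr /=.
    by apply: eq_bigr => y _; case: andP.
  have step W : W \in A -> \sum_(y | c y \in J) ((deg y W == 1) && ~~ clean W y) <=
      \sum_(i in A | i != c x) \sum_(y | c y \in J) ((parent t i == W) && e' y (witness t i)).
    move=> WA; rewrite exchange_big /=; apply: leq_sum => y yJ.
    case: (boolP (clean W y)) => [_|]; first by rewrite andbF.
    case/forall_inPn => i iA; rewrite negb_imply negbK => /andP[/andP[ix pW] eyw].
    by rewrite (bigD1 i) ?iA //= pW eyw; case: (_ == 1).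
  apply: leq_trans (leq_sum _ _) _; first by move=> W WA; exact: step WA.
  rewrite exchange_big /= big_mkcondr /=; apply: leq_sum => i iA.
  case: eqP => // /eqP ix; rewrite exchange_big /=.
  have -> : #|[set y | c y \in J & 1 < deg y i]| = \sum_(y | c y \in J) (1 < deg y i).
    by rewrite -sum1dep_card big_mkcondr; apply: eq_bigr => y _; case: (1 < _).
  apply: leq_sum => y yJ; have [wi pA _ _] := arc_treeP t iA ix.
  rewrite (bigD1 (parent t i)) //= eqxx big1 ?addn0 => [|W /andP[_]]; last first.
    by rewrite eq_sym => /negPf->.
  case eyw : (e' y _) => //; rewrite lt0b ltn_neqAle (JA _ _ yJ iA) andbT eq_sym.
  apply/eqP => d1; apply: (nohole y yJ); apply: (hole_witness e_sym e_irr (t := t) gc iA ix).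
    by have := subsetP JB _ yJ; rewrite in_setC.
  by rewrite soloE wi d1 eqxx e'_sym eyw.
have nons : \sum_(i in A) #|[set y | c y \in J & 1 < deg y i]| + a * (#|J| * s) <= links J A.
  rewrite links_sym // links_sum -sum_nat_const -big_split /=; apply: leq_sum => i iA.
  by rewrite links_sym //; apply: card_nonsolos => y yJ; apply: JA.
have sol : 2 * (a * (#|J| * s)) <= \sum_(W in A) #|[set y | c y \in J & deg y W == 1]| + links J A.
  rewrite links_sym // links_sum mulnCA -sum_nat_const -big_split /=; apply: leq_sum => i iA.
  by rewrite links_sym //; apply: card_solos => y yJ; apply: JA.
have : \sum_(W in A) #|[set y | c y \in J & deg y W == 1]| =
   \sum_(w | c w \in A) nsolos w J + \sum_(W in A) #|unclean W|.
  rewrite (partition_big c (mem A)) //= -big_split /=; apply: eq_bigr => W WA.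
  rewrite -split //; congr (_ + _); apply: eq_bigl => w.
  by case: eqP => [->|]; rewrite ?WA ?andbF.
lia.
Qed.

(** * Vertices that cannot move inside the accessible classes *)

(* The solos of the other vertices are holes ([nonstiff_hole]). *)
Definition stiff w := [forall i in A, (i != c w) ==> ~~ movable w i].

Lemma stiff_mobile_root w : c w \in A -> stiff w -> mobile_root w.
Proof.
move=> wA /forall_inP sw; apply/implyP => wx; apply/eqP => wE.
have [_ pA mv rk] := arc_treeP t wA wx.
have pw : parent t (c w) != c w by apply: contraTneq rk => ->; rewrite ltnn.
by have /implyP/(_ pw)/negP[] := sw _ pA; rewrite {1}wE.
Qed.

Lemma stiff_degA w : c w \in A -> stiff w -> a.-1 <= degs w A.
Proof.
move=> wA /forall_inP sw; rewrite (cardsD1 (c w)) wA add1n /=.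
apply: leq_trans (degsS _ _ _ _ (subD1set A (c w))).
rewrite -sum1_card; apply: leq_sum => i /setD1P[iw iA].
by rewrite lt0n deg_eq0; apply: (implyP (sw i iA)).
Qed.

Lemma degsAB w : degs w A + degs w B <= r.
Proof. by rewrite -degsU ?degs_le // -setI_eq0 setICr. Qed.

Lemma nonstiff_hole w y : c w \in A -> ~~ stiff w -> y \in solos w -> hole y.
Proof.
move=> wA /forall_inPn[i iA]; rewrite negb_imply negbK => /andP[iw mv] /solosP[yB sy cy].
apply: (hole_movable e_sym e_irr gc wA _ yB sy cy iA iw mv).
by case/andP: sy => ewy _; apply: contraTneq ewy => ->; rewrite isolatex.
Qed.

Lemma missed_noreach_stiff w y j : c w \in A -> stiff w -> y \in solos w :\: universal w -> j \in missed w ->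
  ~~ connect (arc x) j (c y).
Proof. by move=> wA sw; apply: missed_noreach_x => //; apply: stiff_mobile_root. Qed.

Lemma nonuniversal_ex w : 4 <= #|solos w| -> exists y, y \in solos w :\: universal w.
Proof.
move=> k4; apply/set0Pn; rewrite -card_gt0 cardsD (setIidPr (universal_sub w)).
by have := card_universal4 k4; lia.
Qed.

(** * Strongly connected blocks of classes *)

(** Strong components of the arcs, except that all accessible classes form one block, even where
    they do not reach each other. *)
Definition same_block i j := ((i \in A) && (j \in A)) ||
  [&& i \in B, j \in B, connect (arc x) i j & connect (arc x) j i].

Definition block i := [set j | same_block i j].

Definition saturated (I : {set 'I_r}) := [forall i in I, block i \subset I].

Lemma same_block_sym i j : same_block i j = same_block j i.
Proof.
rewrite /same_block; congr (_ || _); first exact: andbC.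
by apply/idP/idP => /and4P[-> -> -> ->].
Qed.

Lemma same_block_trans i j k : same_block i j -> same_block j k -> same_block i k.
Proof.
rewrite /same_block !in_setC.
case/orP=> [/andP[iA jA]|/and4P[iB jB cij cji]]; case/orP=> [/andP[jA' kA]|/and4P[jB' kB cjk ckj]].
- by rewrite iA kA.
- by rewrite jA in jB'.
- by rewrite jA' in jB.
- by apply/orP; right; rewrite iB kB (connect_trans cij cjk) (connect_trans ckj cji).
Qed.

Lemma same_block_refl i : same_block i i.
Proof. by rewrite /same_block in_setC connect0; case: (i \in A). Qed.

Lemma in_block i j : (j \in block i) = same_block i j.
Proof. by rewrite [LHS]in_set. Qed.

Lemma block_refl i : i \in block i.
Proof. by rewrite in_block same_block_refl. Qed.

Lemma saturated_block i : saturated (block i).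
Proof.
apply/forall_inP => j; rewrite in_block => ij; apply/subsetP => k; rewrite !in_block.
exact: same_block_trans.
Qed.

Lemma saturatedU I J : saturated I -> saturated J -> saturated (I :|: J).
Proof.
move=> /forall_inP HI /forall_inP HJ; apply/forall_inP => i /setUP[/HI|/HJ] sub.
  exact: subset_trans sub (subsetUl _ _).
exact: subset_trans sub (subsetUr _ _).
Qed.

Lemma block_disjoint i j : j \notin block i -> [disjoint block i & block j].
Proof.
move=> ji; rewrite -setI_eq0 -subset0; apply/subsetP => k /setIP[].
rewrite !in_block => ik jk; case/negP: ji; rewrite in_block.
by apply: same_block_trans ik _; rewrite same_block_sym.
Qed.

Lemma block_root i : i \in A -> block i = A.
Proof.
move=> iA; apply/setP => j; rewrite in_block /same_block !in_setC iA /=.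
by rewrite orbF.
Qed.

Lemma block_B i : i \in B -> block i \subset B.
Proof.
move=> iB; apply/subsetP => j; rewrite in_block => /orP[/andP[iA _]|/and4P[]//].
by rewrite in_setC iA in iB.
Qed.

Lemma block_connect i j k : i \in B -> j \in block i -> k \in block i -> connect (arc x) j k.
Proof.
rewrite in_setC !in_block /same_block in_setC => iA; rewrite (negPf iA) /=.
by move=> /and3P[_ _ cji] /and3P[_ cik _]; apply: connect_trans cji cik.
Qed.

Lemma distinct_block_noarc i j : ~~ same_block i j -> ~~ arc x i j || ~~ arc x j i.
Proof.
rewrite -negb_and; apply: contraNN => /andP[aij aji].
rewrite /same_block !in_setC; case: (boolP (i \in A)) => iA; case: (boolP (j \in A)) => jA //=.
- by have := acc_step aji iA; rewrite (negPf jA).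
- by have := acc_step aij jA; rewrite (negPf iA).
- by rewrite !connect1.
Qed.

Lemma saturated_links I : saturated I -> #|I| * #|~: I| * s <= links I (~: I).
Proof.
move=> /forall_inP satI; apply: links_ge => // i j iI; rewrite in_setC => jI.
by apply: distinct_block_noarc; apply: contra jI => ij; apply: (subsetP (satI i iI)); rewrite in_block.
Qed.

Lemma links_compl I : links I (~: I) + 4 <= 2 * (r * s).
Proof.
have := @links_disjoint _ _ _ _ x e_sparse c gc I (~: I).
rewrite cardsC card_ord; apply; last by nia.
by rewrite -setI_eq0 setICr.
Qed.

Lemma saturated_bound I : saturated I -> #|I| * (r - #|I|) < 2 * r.
Proof.
move=> /saturated_links; have := links_compl I; have := cardsC I; rewrite card_ord.
move=> h; have -> : r - #|I| = #|~: I| by lia.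
by nia.
Qed.

(** * Vertices all of whose edges to given classes are doubled *)

(* If [w] misses a class that reaches all of [J2], its nonuniversal solos in [J1] are doubled ([doubledP]);
   double counting shows that doubled vertices are rare. *)
Definition doubled (J1 J2 : {set 'I_r}) :=
  [set y | (c y \in J1) && [forall u, (c u \in J2) && e' u y ==> (1 < deg u (c y))]].

(** Let [u] in [J2] have [d >= 1] neighbors in a class of [J1]. None of them is doubled if [d = 1],
    and otherwise there are at most [d <= 2d - 2] doubled ones. *)
Lemma doubled_degs J1 J2 : (forall u j, c u \in J2 -> j \in J1 -> 0 < deg u j) ->
  \sum_(y in doubled J1 J2) degs y J2 + 2 * (#|J1| * #|J2| * s) <= 2 * links J2 J1.
Proof.
move=> H; pose D := doubled J1 J2.
have -> : \sum_(y in D) degs y J2 = \sum_(u | c u \in J2) \sum_(j in J1) #|[set y in D | e' u y & c y == j]|.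
  transitivity (\sum_(y in D) \sum_(u | c u \in J2) e' u y).
    apply: eq_bigr => y _; rewrite degsE -sum1dep_card (eq_bigl (fun u => (c u \in J2) && e' y u)).
      by rewrite big_mkcondr; apply: eq_bigr => u _; rewrite (e'_sym u y); case: (e' y u).
    by move=> u; rewrite andbC.
  rewrite exchange_big; apply: eq_bigr => u uJ; rewrite -card_sum_sep -sum1_card.
  rewrite (partition_big c (mem J1)) /=; last by move=> y; rewrite !in_set => /andP[/andP[]].
  apply: eq_bigr => j jJ; rewrite -sum1_card; apply: eq_bigl => y.
  by rewrite !in_set -andbA.
have -> : links J2 J1 = \sum_(v | c v \in J2) degs v J1 by [].
rewrite big_distrr /=.
have -> : 2 * (#|J1| * #|J2| * s) = \sum_(u | c u \in J2) \sum_(j in J1) 2.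
  transitivity (\sum_(u in [set u | c u \in J2]) (#|J1| * 2)).
    by rewrite sum_nat_const (classes_card gc); lia.
  by apply: eq_big => u; rewrite ?in_set // => _; rewrite sum_nat_const.
rewrite -big_split /=; apply: leq_sum => u uJ; rewrite -big_split /degs big_distrr /=.
apply: leq_sum => j jJ.
have d0 := H u j uJ jJ; case: (ltnP 1 (deg u j)) => d1.
  suff : #|[set y in D | e' u y & c y == j]| <= deg u j by lia.
  by apply: subset_leq_card; apply/subsetP => y; rewrite !in_set => /andP[_ ->].
rewrite (_ : [set y in D | _ & _] = set0) ?cards0; first by lia.
apply/setP => y; rewrite in_set0 in_set; apply/negP => /and3P[yD euy /eqP cy].
by move: yD; rewrite in_set => /andP[_ /forallP/(_ u)]; rewrite uJ euy cy ltnNge d1.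
Qed.

Lemma doubled_card d J1 J2 : (forall u j, c u \in J2 -> j \in J1 -> 0 < deg u j) ->
  (forall y, c y \in J1 -> d <= degs y J2) ->
  d * #|doubled J1 J2| + 2 * (#|J1| * #|J2| * s) <= 2 * links J2 J1.
Proof.
move=> H1 H2; apply: leq_trans (doubled_degs H1); rewrite leq_add2r mulnC -sum_nat_const.
by apply: leq_sum => y; rewrite in_set => /andP[/H2].
Qed.

(** Vertices that are not doubled carry at most [d] edges each; the doubled ones must carry the
    rest, which [doubled_degs] bounds. *)
Lemma doubled_card_upper d J1 J2 : (forall u j, c u \in J2 -> j \in J1 -> 0 < deg u j) ->
  (forall y, c y \in J1 -> degs y J2 <= d) ->
  2 * (#|J1| * #|J2| * s) + d * #|doubled J1 J2| <= d * (#|J1| * s) + links J2 J1.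
Proof.
move=> H1 H2; have := doubled_degs H1; pose D := doubled J1 J2.
have : links J1 J2 <= \sum_(y in D) degs y J2 + d * (#|J1| * s - #|D|).
  have DJ : D \subset [set y | c y \in J1] by apply/subsetP => y; rewrite !in_set => /andP[].
  have -> : links J1 J2 = \sum_(y in [set y | c y \in J1]) degs y J2.
    by apply: eq_bigl => y; rewrite in_set.
  rewrite -(classes_card gc) -cardsDS // mulnC -sum_nat_const (big_setID D) /= (setIidPr DJ) leq_add2l.
  by apply: leq_sum => y; rewrite in_setD in_set => /andP[_ /H2].
have : #|D| <= #|J1| * s.
  rewrite -(classes_card gc); apply: subset_leq_card.
  by apply/subsetP => y; rewrite !in_set => /andP[].
rewrite links_sym // -/D; nia.
Qed.

(** A vertex is a solo of at most one vertex of a given class. *)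
Lemma sum_disjoint_solos W (D : {set T}) : \sum_(w | c w == W) #|D :&: solos w| <= #|D|.
Proof.
rewrite (eq_bigr (fun w => \sum_(y in D) (y \in solos w))); last first.
  by move=> w _; rewrite -card_sum_sep; apply: eq_card => y; rewrite !in_set.
rewrite exchange_big -sum1_card; apply: leq_sum => y _.
case: (pickP (fun w => (c w == W) && (y \in solos w))) => [w0 /andP[/eqP cw0 yK]|none]; last first.
  by rewrite big1 // => w cw; have := none w; rewrite cw /= => ->.
have /solosP[_ + _] := yK; rewrite soloE cw0 => /andP[_ /eqP d1].
rewrite -[leqRHS]d1 /deg -sum1dep_card [leqRHS](eq_bigl (fun w => (c w == W) && e' y w)); last first.
  by move=> w; rewrite andbC.
rewrite [leqRHS]big_mkcondr; apply: leq_sum => w _; case: (boolP (y \in solos w)) => // /solos_adj.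
by rewrite e'_sym => ->.
Qed.

Lemma doubledP w y j J1 J2 : c w \in A -> stiff w -> y \in solos w :\: universal w -> c y \in J1 ->
  j \in missed w -> (forall k, k \in J2 -> connect (arc x) j k) -> y \in doubled J1 J2.
Proof.
move=> wA sw yK yJ jZ cJ; rewrite in_set yJ /=; apply/forallP => u; apply/implyP => /andP[uJ euy].
by apply: (missed_deg wA (stiff_mobile_root wA sw) yK jZ (cJ _ uJ) euy).
Qed.

Lemma stiff_degs w : c w \in A -> stiff w -> degs w B <= b.+1.
Proof.
by move=> wA sw; have := stiff_degA wA sw; have := degsAB w; have := card_AB; have := a_gt0; lia.
Qed.

(** [class_count] with at most [b + 1] neighbors outside [A] and at most one universal solo. Thus
    five solos force a missed class. *)
Lemma stiff_solos w : c w \in A -> stiff w -> 5 <= #|solos w| -> #|solos w| <= 3 + 2 * #|missed w|.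
Proof.
move=> wA sw k5; have := class_count wA (stiff_mobile_root wA sw); have := stiff_degs wA sw.
by have := card_universal5 k5; have := card_solos_le w; lia.
Qed.

Lemma reaches_block j : j \in B -> block j \subset reaches j.
Proof.
move=> jB; apply/subsetP => i ij; have := subsetP (block_B jB) i ij.
rewrite [i \in reaches j]in_set in_setC => ->.
exact: block_connect jB ij (block_refl j).
Qed.

(** [m] counts the vertices of [W] that can move to another accessible class. They have no solos but
    possibly [r] neighbors; the witness of [W] is one of them. *)
Lemma leaf_count k W : W \in A -> leaf W -> W != c x ->
  (forall w, c w = W -> ~~ stiff w -> #|solos w| = 0) ->
  (forall w, c w = W -> stiff w -> #|solos w| <= k) ->
  exists m, 0 < m <= s /\ 2 * (b * s) <= (k + b.+1) * (s - m) + r * m.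
Proof.
move=> WA lW Wx H0 Hk; pose M := [set w | (c w == W) && ~~ stiff w].
have MW : M \subset [set w | c w == W] by apply/subsetP => w; rewrite !in_set => /andP[].
exists #|M|; split.
  rewrite -(class_card gc W) subset_leq_card // andbT; apply/card_gt0P.
  have [wW pA mv rk] := arc_treeP t WA Wx.
  exists (witness t W); rewrite in_set wW eqxx; apply/forall_inPn; exists (parent t W) => //.
  by rewrite negb_imply negbK wW mv andbT; apply: contraTneq rk => ->; rewrite ltnn.
have := sum_nsolos_leaf lW WA (subxx B); move/leq_trans; apply.
rewrite links_sym // /links [X in _ + X](eq_bigl (fun w => c w == W)); last by move=> w; rewrite in_set1.
rewrite -big_split /= (eq_bigl (fun w => w \in [set w | c w == W])); last by move=> w; rewrite in_set.
rewrite (big_setID M) /= (setIidPr MW) addnC -(class_card gc W) -cardsDS //.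
rewrite ![_ * #|_|]mulnC -!sum_nat_const; apply: leq_add; apply: leq_sum => w.
  rewrite in_setD !in_set negb_and negbK => /andP[+ cw]; rewrite cw /= => sw.
  by rewrite nsolosB leq_add ?Hk ?stiff_degs ?(eqP cw).
by rewrite in_set => /andP[/eqP cw sw]; rewrite nsolosB H0 // degs_le.
Qed.

Lemma block_bound i : i \in B ->
  #|block i| * (r - #|block i|) < 2 * r /\ (a + #|block i|) * (r - (a + #|block i|)) < 2 * r.
Proof.
move=> iB; split; first exact/saturated_bound/saturated_block.
have dA : [disjoint A & block i].
  by rewrite -setI_eq0 -subset0; apply/subsetP => j /setIP[jA /(subsetP (block_B iB))]; rewrite in_setC jA.
have := saturated_bound (saturatedU (saturated_block (c x)) (saturated_block i)).
by rewrite block_root ?acc_root // -cardsUI (_ : _ :&: _ = set0) ?cards0 ?addn0 //; apply/eqP; rewrite setI_eq0.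
Qed.

Lemma block_bound2 i j : i \in B -> j \in B -> j \notin block i ->
  (#|block i| + #|block j|) * (r - (#|block i| + #|block j|)) < 2 * r /\
  (a + #|block i| + #|block j|) * (r - (a + #|block i| + #|block j|)) < 2 * r.
Proof.
move=> iB jB jn.
have dij := block_disjoint jn.
have cij : #|block i :|: block j| = #|block i| + #|block j|.
  by rewrite -[RHS]cardsUI (_ : _ :&: _ = set0) ?cards0 ?addn0 //; apply/eqP; rewrite setI_eq0.
have dA : [disjoint A & block i :|: block j].
  rewrite -setI_eq0 -subset0; apply/subsetP => k /setIP[kA /setUP[]] /(subsetP (block_B _)).
    by rewrite in_setC kA => /(_ iB).
  by rewrite in_setC kA => /(_ jB).
have satij := saturatedU (saturated_block i) (saturated_block j).
split; first by rewrite -cij; apply: saturated_bound.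
have := saturated_bound (saturatedU (saturated_block (c x)) satij).
rewrite block_root ?acc_root // -addnA -cij -[#|A| + #|_ :|: block j|]cardsUI.
by rewrite (_ : _ :&: (_ :|: _) = set0) ?cards0 ?addn0 //; apply/eqP; rewrite setI_eq0.
Qed.

Lemma no_hole y : c y \in B -> a < #|reaches (c y)| \/ 5 < a + #|reaches (c y)| -> ~ hole y.
Proof. by move=> yB H /(hole_bound yB)[]; lia. Qed.

Lemma nohole_solos w : c w \in A -> (forall y, c y \in B -> ~ hole y) -> ~~ stiff w -> #|solos w| = 0.
Proof.
move=> wA H nsw; apply/eqP; rewrite cards_eq0 -subset0; apply/subsetP => y yK.
case: (H y); last exact: nonstiff_hole wA nsw yK.
by have /solosP[] := yK; rewrite in_setC.
Qed.

Lemma ex_nonuniversal w : c w \in A -> stiff w -> 5 <= #|solos w| ->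
  exists y j, [/\ y \in solos w :\: universal w, j \in missed w & 0 < #|missed w|].
Proof.
move=> wA sw k5; have [y yK] := nonuniversal_ex (ltnW k5).
have z0 : 0 < #|missed w| by have := stiff_solos wA sw k5; lia.
by exists y; have /card_gt0P[j jZ] := z0; exists j.
Qed.

(** * Two accessible classes *)

Lemma acc2_few_solos : a = 2 -> (forall y, c y \in B -> ~ hole y) ->
  (forall w, c w \in A -> stiff w -> #|solos w| <= 5) -> False.
Proof.
move=> a2 nh H; have [|W [WA Wx lW]] := ex_leaf; first by rewrite a2.
have [] := leaf_count (k := 5) WA lW Wx.
- by move=> w cw nsw; apply: nohole_solos; rewrite ?cw.
- by move=> w cw; apply: H; rewrite cw.
(* For [r = 8] the inequality reads [12s <= 12s - 4m], so only [m > 0] makes it fail. *)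
move=> m [/andP[m0 ms]]; have := card_AB; rewrite a2 => rE; have {}rE : b = r - 2 by lia.
rewrite rE; nia.
Qed.

Lemma missed_B w j : j \in missed w -> j \in B.
Proof. by rewrite in_set => /andP[]. Qed.

Lemma block_full i : i \in B -> #|block i| = b -> block i = B.
Proof. by move=> iB mb; apply/eqP; rewrite eqEcard block_B // mb leqnn. Qed.

(** Five solos would give a missed class and a nonuniversal solo whose class it must not reach. *)
Lemma full_solos4 w : (forall i j, i \in B -> j \in B -> connect (arc x) i j) ->
  c w \in A -> stiff w -> #|solos w| <= 4.
Proof.
move=> H wA sw; rewrite leqNgt; apply/negP => k5.
have [y [j [yK jZ _]]] := ex_nonuniversal wA sw k5.
have /negP := missed_noreach_stiff wA sw yK jZ; apply.
apply: H; first exact: missed_B jZ.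
by have [/solosP[+ _ _] _] := nonuniversal yK; rewrite in_setC.
Qed.

Lemma acc2_strong : a = 2 -> (forall i j, i \in B -> j \in B -> connect (arc x) i j) -> False.
Proof.
move=> a2 H; have rE := card_AB; rewrite a2 in rE; apply: (acc2_few_solos a2).
  move=> y yB; apply: no_hole => //; left.
  have -> : reaches (c y) = B; last by rewrite a2; lia.
  apply/setP => i; rewrite [i \in reaches _]in_set -in_setC; case: (boolP (i \in B)) => //= iB.
  exact: H.
by move=> w wA sw; have := full_solos4 H wA sw; lia.
Qed.

Definition loose W := [set w | (c w == W) && ~~ stiff w].

Lemma loose_le W : #|loose W| <= s.
Proof.
rewrite -(class_card gc W) subset_leq_card //.
by apply/subsetP => w; rewrite !in_set => /andP[].
Qed.

Lemma sum_class_split W (f : T -> nat) p q :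
  (forall w, c w = W -> stiff w -> f w <= p) -> (forall w, c w = W -> ~~ stiff w -> f w <= q) ->
  \sum_(w | c w == W) f w <= p * (s - #|loose W|) + q * #|loose W|.
Proof.
move=> Hp Hq; have MW : loose W \subset [set w | c w == W].
  by apply/subsetP => w; rewrite !in_set => /andP[].
rewrite (eq_bigl (fun w => w \in [set w | c w == W])); last by move=> w; rewrite in_set.
rewrite (big_setID (loose W)) /= (setIidPr MW) addnC -(class_card gc W) -cardsDS //.
rewrite ![_ * #|_|]mulnC -!sum_nat_const; apply: leq_add; apply: leq_sum => w.
  by rewrite in_setD !in_set negb_and negbK => /andP[+ cw]; rewrite cw /= => sw; apply/Hp/sw/eqP.
by rewrite in_set => /andP[/eqP cw sw]; apply: Hq.
Qed.

Lemma links1 W J : links [set W] J = \sum_(w | c w == W) degs w J.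
Proof. by apply: eq_bigl => w; rewrite in_set1. Qed.

Lemma leaf_links W : W \in A -> links B [set W] <= b.+1 * (s - #|loose W|) + r * #|loose W|.
Proof.
move=> WA; rewrite links_sym // links1; apply: sum_class_split => w cw sw.
  by apply: stiff_degs; rewrite ?cw.
exact: degs_le.
Qed.

(** Weighted count over a leaf class: [D] pays for the solos in excess of [q / p] per vertex. *)
Lemma leaf_sum p q (D : {set T}) W J : W \in A -> leaf W -> J \subset B ->
  (forall w, c w = W -> ~~ stiff w -> nsolos w J = 0) ->
  (forall w, c w = W -> stiff w -> p * nsolos w J <= q + #|D :&: solos w|) ->
  p * (2 * (#|J| * s)) <= q * (s - #|loose W|) + #|D| + p * links J [set W].
Proof.
move=> WA lW JB H0 Hp.
have : \sum_(w | c w == W) (p * nsolos w J) <= \sum_(w | c w == W) ((stiff w : nat) * q + #|D :&: solos w|).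
  apply: leq_sum => w /eqP cw; case: (boolP (stiff w)) => sw; first by rewrite mul1n Hp.
  by rewrite H0 // muln0.
rewrite -big_distrr big_split /= => h1; have h2 := sum_disjoint_solos W D.
have h3 : \sum_(w | c w == W) (stiff w * q) <= q * (s - #|loose W|) + 0 * #|loose W|.
  apply: sum_class_split => w cw; first by move->; rewrite mul1n.
  by move/negPf->.
apply: leq_trans (leq_mul (leqnn p) (sum_nsolos_leaf lW WA JB)) _; rewrite mulnDr; lia.
Qed.

Lemma reaches_sub i j : i \in B -> connect (arc x) i j -> block i \subset reaches j.
Proof.
move=> iB cij; apply/subsetP => k ki; have := subsetP (block_B iB) k ki.
rewrite [k \in reaches j]in_set in_setC => -> /=.
exact: connect_trans (block_connect iB ki (block_refl i)) cij.
Qed.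

Lemma nsolos_le w J : nsolos w J <= #|solos w|.
Proof. by apply: subset_leq_card; apply/subsetP => y; rewrite [y \in finset _]in_set => /andP[]. Qed.

Lemma nsolos_universal w J : (forall y, y \in solos w :\: universal w -> c y \notin J) -> nsolos w J <= #|universal w|.
Proof.
move=> H; apply: subset_leq_card; apply/subsetP => y.
rewrite [y \in finset _]in_set => /andP[yK yJ]; apply: contraLR yJ => yU.
by apply: H; rewrite in_setD yU.
Qed.

Lemma nonuniversal_B w y : y \in solos w :\: universal w -> c y \in B.
Proof. by case/nonuniversal => /solosP[+ _ _] _; rewrite in_setC. Qed.

Lemma sets_disjoint I J : (forall i, i \in I -> i \notin J) -> [disjoint I & J].
Proof.
by move=> H; rewrite -setI_eq0 -subset0; apply/subsetP => i /setIP[/H/negPf->].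
Qed.

Lemma nohole_nsolos w J : c w \in A -> J \subset B -> (forall y, c y \in J -> ~ hole y) -> ~~ stiff w ->
  nsolos w J = 0.
Proof.
move=> wA JB H nsw; apply/eqP; rewrite cards_eq0 -subset0; apply/subsetP => y.
rewrite [y \in finset _]in_set => /andP[yK yJ].
by case: (H y yJ); apply: nonstiff_hole wA nsw yK.
Qed.

Lemma linksC I J : links I J = links J I.
Proof. exact: links_sym. Qed.

Lemma A_links i J : i \in A -> J \subset B -> #|J| * s <= links [set i] J.
Proof.
move=> iA JB; have := @links_ge _ _ _ _ x e_sym c gc [set i] J; rewrite cards1 mul1n; apply.
by move=> k j /set1P-> /(subsetP JB) jB; rewrite (B_A_noarc jB iA) orbT.
Qed.

Lemma links_unionl I1 I2 J : [disjoint I1 & I2] -> links (I1 :|: I2) J = links I1 J + links I2 J.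
Proof. by move=> d; rewrite links_sym // linksU // ![links J _]links_sym. Qed.

Lemma links_A2 W J : a = 2 -> W \in A -> W != c x -> links A J = links [set c x] J + links [set W] J.
Proof.
move=> a2 WA Wx; rewrite -links_unionl; last by apply: sets_disjoint => i /set1P->; rewrite in_set1 eq_sym.
congr links; apply/eqP; rewrite eq_sym eqEcard subUset !sub1set acc_root WA /= a2.
by rewrite cards2 eq_sym Wx.
Qed.

(** If the block [J] reaches [j0], a vertex with a nonuniversal solo can miss [j0] only, and so has
    at most five solos. If [j0] reaches [J], a vertex with five solos has no nonuniversal one in
    [J]. If neither holds, doubled vertices pay for a fifth solo in [J]. *)
Lemma acc2_blocks51 i j0 : r = 8 -> a = 2 -> i \in B -> #|block i| = 5 -> j0 \in B -> j0 \notin block i ->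
  B = j0 |: block i -> False.
Proof.
move=> rE a2 iB m5 j0B j0i BE.
pose J := block i; have JB : J \subset B := block_B iB.
have inB k : k \in B -> k = j0 \/ k \in J by rewrite BE => /setU1P.
case cij0 : (connect (arc x) i j0).
  have ci k : k \in B -> connect (arc x) i k.
    by case/inB => [->//|kJ]; apply: block_connect iB (block_refl i) kJ.
  apply: (acc2_few_solos a2) => [y yB|w wA sw].
    by apply: no_hole => //; left; rewrite a2; have := subset_leq_card (reaches_sub iB (ci _ yB)); rewrite m5; apply: leq_trans.
  rewrite leqNgt; apply/negP => k6; have [y [_ [yK _ _]]] := ex_nonuniversal wA sw (ltnW k6).
  have : missed w \subset [set j0].
    apply/subsetP => j jZ; rewrite in_set1; case: (inB _ (missed_B jZ)) => [->//|jJ].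
    case/negP: (missed_noreach_stiff wA sw yK jZ).
    by apply: connect_trans (block_connect iB jJ (block_refl i)) _; apply/ci/nonuniversal_B/yK.
  by move/subset_leq_card; rewrite cards1; have := stiff_solos wA sw (ltnW k6); move: k6; clear; lia.
have [|W [WA Wx lW]] := ex_leaf; first by rewrite a2.
have nh y : c y \in J -> ~ hole y.
  move=> yJ; have yB := subsetP JB _ yJ; apply: no_hole => //; left; rewrite a2.
  by have := subset_leq_card (reaches_sub iB (block_connect iB (block_refl i) yJ)); rewrite m5; apply: leq_trans.
have lAJ : links A J + links [set j0] J + 4 <= 16 * s.
  have dA : [disjoint A & [set j0]].
    by apply: sets_disjoint => k kA; apply: contraTN kA => /set1P->; rewrite -in_setC.
  have rs : r * s = 8 * s by rewrite rE.
  have := links_compl (A :|: [set j0]); rewrite rs.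
  rewrite (_ : ~: (A :|: [set j0]) = J) ?links_unionl; [by clear; lia | exact: dA |].
  rewrite setCU BE; apply/setP => k; rewrite !(in_setI, in_setC, in_setU, in_set1).
  by case: eqP => [->|_] /=; rewrite ?andbF ?andbT ?(negPf j0i).
have lx := A_links (acc_root e x c) JB; have lW' := A_links WA JB.
have nosame k : k \in J -> ~~ same_block j0 k.
  move=> kJ; rewrite same_block_sym; apply: contra j0i => kj.
  by rewrite in_block; apply: same_block_trans kj; rewrite -in_block.
have lj0 : 5 * s <= links [set j0] J.
  have := @links_ge _ _ _ _ x e_sym c gc [set j0] J; rewrite cards1 mul1n m5; apply.
  by move=> k j /set1P-> jJ; apply: distinct_block_noarc; apply: nosame.
rewrite (links_A2 _ a2 WA Wx) m5 in lAJ lx lW'.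
have loose0 w : c w = W -> ~~ stiff w -> nsolos w J = 0.
  by move=> cw; apply: nohole_nsolos => //; rewrite cw.
have ZJ w y j : c w = W -> stiff w -> y \in solos w :\: universal w -> c y \in J -> j \in missed w -> j = j0.
  move=> cw sw yK yJ jZ; case: (inB _ (missed_B jZ)) => // jJ; have wA : c w \in A by rewrite cw.
  by case/negP: (missed_noreach_stiff wA sw yK jZ); apply: (block_connect iB jJ yJ).
case cj0i : (connect (arc x) j0 i).
  have small w : c w = W -> stiff w -> 1 * nsolos w J <= 4 + #|set0 :&: solos w|.
    move=> cw sw; rewrite mul1n set0I cards0 addn0.
    have [k5|k4] := leqP 5 #|solos w|; last exact: leq_trans (nsolos_le _ _) _.
    have wA : c w \in A by rewrite cw.
    apply: leq_trans (nsolos_universal _) (leq_trans (card_universal5 k5) _) => // y yK.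
    apply/negP => yJ; have [_ [j [_ jZ _]]] := ex_nonuniversal wA sw k5.
    have jE := ZJ w y j cw sw yK yJ jZ; case/negP: (missed_noreach_stiff wA sw yK jZ).
    by rewrite jE; apply: connect_trans cj0i (block_connect iB (block_refl i) yJ).
  have := leaf_sum WA lW JB loose0 small; rewrite m5 cards0 [links J _]linksC.
  by move: lAJ lx lj0; clear -s0; lia.
have nc k : k \in J -> ~~ arc x j0 k.
  move=> kJ; apply/negP => a0k; move/negP: cj0i; apply.
  by apply: connect_trans (connect1 a0k) (block_connect iB kJ (block_refl i)).
have nc' k : k \in J -> ~~ arc x k j0.
  move=> kJ; apply/negP => ak0; move/negP: cij0; apply.
  by apply: connect_trans (block_connect iB (block_refl i) kJ) (connect1 ak0).
have posdeg v k l : c v = k -> ~~ arc x k l -> 0 < deg v l.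
  move=> cv; rewrite lt0n deg_eq0; apply: contra => mv; apply/(arcxP x e_sym); by exists v.
have Dbound : 1 * #|doubled J [set j0]| + 2 * (#|J| * #|[set j0]| * s) <= 2 * links [set j0] J.
  apply: doubled_card => [u j /set1P cu /nc|y yJ]; first exact: posdeg.
  by rewrite degs1; apply: posdeg (nc' _ yJ).
(* Five solos in [J] with a nonuniversal one among them occur only if [w] misses [j0]; then at least
   four of them are doubled, which covers the excess of [4 * 5] over 16. *)
have big w : c w = W -> stiff w -> 4 * nsolos w J <= 16 + #|doubled J [set j0] :&: solos w|.
  move=> cw sw; have wA : c w \in A by rewrite cw.
  have [k5|k4] := leqP 5 #|solos w|; last by have := nsolos_le w J; move: k4; clear; lia.
  case: (pickP (fun y => (y \in solos w :\: universal w) && (c y \in J))) => [y /andP[yK yJ]|none]; last first.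
    have : nsolos w J <= #|universal w|.
      by apply: nsolos_universal => y yK; have := none y; rewrite yK /= => ->.
    by move/leq_trans/(_ (card_universal5 k5)); clear; lia.
  have Z1 : #|missed w| <= 1.
    by rewrite -(cards1 j0); apply/subset_leq_card/subsetP => j jZ; rewrite in_set1 (ZJ w y j).
  have k5' : #|solos w| <= 5 by apply: leq_trans (stiff_solos wA sw k5) _; move: Z1; clear; lia.
  have [_ [j [_ jZ _]]] := ex_nonuniversal wA sw k5.
  have jE := ZJ w y j cw sw yK yJ jZ; rewrite jE in jZ.
  have [k0|k5''] := leqP (nsolos w J) 4; first by move: k0; clear; lia.
  have KJ y' : y' \in solos w -> c y' \in J.
    have : [set y in solos w | c y \in J] = solos w.
      apply/eqP; rewrite eqEcard; apply/andP; split; last exact: leq_trans k5' _.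
      by apply/subsetP => z; rewrite [z \in finset _]in_set => /andP[].
    by move=> KE yK'; move: (yK'); rewrite -{1}KE in_set => /andP[].
  have sub : solos w :\: universal w \subset doubled J [set j0] :&: solos w.
    apply/subsetP => y' y'K; have y'K' : y' \in solos w by case/setDP: y'K.
    rewrite in_setI y'K' andbT; apply: (doubledP wA sw y'K (KJ _ y'K') jZ) => k /set1P->.
    exact: connect0.
  have := subset_leq_card sub; rewrite cardsD (setIidPr (universal_sub w)).
  by move: k5 k5' k5'' (card_universal5 k5) (nsolos_le w J); clear; lia.
have := leaf_sum WA lW JB loose0 big; rewrite m5 [links J _]linksC.
rewrite m5 cards1 in Dbound.
by move: lAJ lx lj0 lW' Dbound; clear -s0; lia.
Qed.

Lemma noarc_deg v l : ~~ arc x (c v) l -> 0 < deg v l.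
Proof. by rewrite lt0n deg_eq0; apply: contra => mv; apply/(arcxP x e_sym); exists v. Qed.

Lemma block_noarc i j k l : i \in B -> j \in B -> ~~ connect (arc x) i j ->
  k \in block i -> l \in block j -> ~~ arc x k l.
Proof.
move=> iB jB nc ki lj; apply: contra nc => akl.
apply: connect_trans (block_connect iB (block_refl i) ki) _.
exact: connect_trans (connect1 akl) (block_connect jB lj (block_refl j)).
Qed.

Lemma block_links i j : i \in B -> j \in B -> j \notin block i ->
  #|block i| * #|block j| * s <= links (block i) (block j).
Proof.
move=> iB jB ji; apply: links_ge => // k l ki lj; apply: distinct_block_noarc.
apply: contra ji => kl; rewrite in_block.
rewrite !in_block in ki lj; apply: same_block_trans ki (same_block_trans kl _).
by rewrite same_block_sym.
Qed.

(** A nonuniversal solo of a vertex with five solos lies in a block that the missed class does not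
    reach, so it is doubled with respect to the other block. [key] demands at least [2s] such
    vertices, more than the edges between the two blocks allow. *)
Lemma acc2_blocks33 i j : r = 8 -> a = 2 -> i \in B -> j \in B -> #|block i| = 3 -> #|block j| = 3 ->
  j \notin block i -> ~~ connect (arc x) j i -> False.
Proof.
move=> rE a2 iB jB mi mj ji ncji.
pose J1 := block i; pose J2 := block j.
have J1B : J1 \subset B := block_B iB; have J2B : J2 \subset B := block_B jB.
have b6 : b = 6 by move: card_AB a2 rE; clear; lia.
have dJ : [disjoint J1 & J2] := block_disjoint ji.
have BE : J1 :|: J2 = B.
  apply/eqP; rewrite eqEcard subUset J1B J2B -[#|_ :|: _|]addn0 -(@cards0 'I_r).
  by rewrite -(_ : J1 :&: J2 = set0) ?cardsUI ?mi ?mj ?b6 //; apply/eqP; rewrite setI_eq0.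
have inB k : k \in B -> k \in J1 \/ k \in J2 by rewrite -BE => /setUP.
have [|W [WA Wx lW]] := ex_leaf; first by rewrite a2.
have nh y : c y \in B -> ~ hole y.
  move=> yB; apply: no_hole => //; left; rewrite a2; case: (inB _ yB) => yJ.
    by have := subset_leq_card (reaches_sub iB (block_connect iB (block_refl i) yJ)); rewrite mi; apply: leq_trans.
  by have := subset_leq_card (reaches_sub jB (block_connect jB (block_refl j) yJ)); rewrite mj; apply: leq_trans.
have loose0 w : c w = W -> ~~ stiff w -> nsolos w B = 0.
  by move=> cw; apply: nohole_nsolos => //; rewrite cw.
have rs : r * s = 8 * s by rewrite rE.
have Adeg v : c v \in B -> degs v B <= 6.
  move=> vB; have : a <= degs v A.
    by rewrite -sum1_card; apply: leq_sum => k kA; apply: B_deg.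
  by move: (degsAB v) a2 rE; clear; lia.
have l12 : links J1 J2 + 4 <= 10 * s.
  have := links_compl J1; rewrite rs.
  have -> : ~: J1 = A :|: J2.
    apply/setP => k; rewrite !(in_setC, in_setU).
    case: (boolP (k \in A)) => [kA|kB] /=.
      by apply: contraTN kA => /(subsetP J1B); rewrite in_setC.
    have kB' : k \in B by rewrite in_setC.
    case: (inB k kB') => [kJ|kJ]; first by rewrite kJ (disjointFr dJ kJ).
    by rewrite kJ (disjointFl dJ kJ).
  rewrite linksU; last by apply: sets_disjoint => k kA; apply: contraTN kA => /(subsetP J2B); rewrite in_setC.
  have : 3 * 2 * s <= links J1 A.
    by rewrite -[X in X * _ * _]mi -[X in _ * X * _]a2; apply: links_ge => // k l kJ lA;
      rewrite (B_A_noarc (subsetP J1B _ kJ) lA).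
  by clear; lia.
have l12' := block_links iB jB ji; rewrite mi mj -/J1 -/J2 in l12'.
have nc21 k l : k \in J2 -> l \in J1 -> ~~ arc x k l := block_noarc jB iB ncji.
have pos21 u k : c u \in J2 -> k \in J1 -> 0 < deg u k by move=> uJ kJ; apply: noarc_deg; apply: nc21.
have lB : links B [set W] <= 7 * (s - #|loose W|) + 8 * #|loose W|.
  by have := leaf_links WA; rewrite b6 (_ : r * _ = 8 * #|loose W|) //; congr (_ * _).
have ls := loose_le W.
(* A stiff vertex has [k <= 7] solos, and if [k >= 5] all but one lie in [D]; hence
   [2k <= 8 + (k - 1)]. Summing over the leaf gives [2s <= #|D|]. *)
have key (D : {set T}) : (forall w y, c w = W -> stiff w -> 5 <= #|solos w| -> y \in solos w :\: universal w -> y \in D) ->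
    3 * #|D| < 6 * s -> False.
  move=> HD Dlt.
  have pt w : c w = W -> stiff w -> 2 * nsolos w B <= 8 + #|D :&: solos w|.
    move=> cw sw; have wA : c w \in A by rewrite cw.
    rewrite nsolosB; have [k5|k4] := leqP 5 #|solos w|; last by move: k4; clear; lia.
    have sub : solos w :\: universal w \subset D :&: solos w.
      by apply/subsetP => y yK; rewrite in_setI (HD w y) //; case/setDP: yK.
    have k7 : #|solos w| <= 7 by have := leq_trans (card_solos_le w) (stiff_degs wA sw); rewrite b6.
    have := subset_leq_card sub; rewrite cardsD (setIidPr (universal_sub w)).
    by move: k5 k7 (card_universal5 k5); clear; lia.
  have := leaf_sum WA lW (subxx B) loose0 pt; rewrite b6.
  by move: lB ls Dlt s0; clear; lia.
have type1 w y : c w = W -> stiff w -> 5 <= #|solos w| -> y \in solos w :\: universal w ->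
    (c y \in J1 -> y \in doubled J1 J2) /\ (c y \in J2 -> ~~ connect (arc x) i j /\ y \in doubled J2 J1).
  move=> cw sw k5 yK; have wA : c w \in A by rewrite cw.
  have [_ [k [_ kZ _]]] := ex_nonuniversal wA sw k5.
  have nk := missed_noreach_stiff wA sw yK kZ.
  split=> yJ; case: (inB k (missed_B kZ)) => kJ.
  - by case/negP: nk; apply: block_connect iB kJ yJ.
  - by apply: (doubledP wA sw yK yJ kZ) => l; apply: block_connect jB kJ.
  - split; last by apply: (doubledP wA sw yK yJ kZ) => l; apply: block_connect iB kJ.
    apply: contra nk => cij; apply: connect_trans (block_connect iB kJ (block_refl i)) _.
    exact: connect_trans cij (block_connect jB (block_refl j) yJ).
  - by case/negP: nk; apply: block_connect jB kJ yJ.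
case: (boolP (connect (arc x) i j)) => cij.
  apply: (key (doubled J1 J2)) => [w y cw sw k5 yK|].
    have [t1 t2] := type1 w y cw sw k5 yK; case: (inB _ (nonuniversal_B yK)) => // /t2[].
    by rewrite cij.
  have := doubled_card_upper (d := 6) pos21; rewrite mi mj [links J2 J1]linksC => H.
  have {H} := H (fun y yJ => leq_trans (degsS _ _ _ _ J2B) (Adeg y (subsetP J1B _ yJ))).
  by move: l12 s0; clear; lia.
have nc12 k l : k \in J1 -> l \in J2 -> ~~ arc x k l := block_noarc iB jB cij.
have pos12 u k : c u \in J1 -> k \in J2 -> 0 < deg u k by move=> uJ kJ; apply: noarc_deg; apply: nc12.
apply: (key (doubled J1 J2 :|: doubled J2 J1)) => [w y cw sw k5 yK|].
  have [t1 t2] := type1 w y cw sw k5 yK; rewrite in_setU; case: (inB _ (nonuniversal_B yK)) => [/t1->//|/t2[_ ->]].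
  by rewrite orbT.
have d3 (I J : {set 'I_r}) y : #|J| = 3 -> (forall k, k \in J -> 0 < deg y k) -> 3 <= degs y J.
  by move=> <- H; rewrite -sum1_card; apply: leq_sum.
have D1 := doubled_card (d := 3) pos21 (fun y yJ => d3 J1 J2 y mj (fun k => pos12 y k yJ)).
have D2 := doubled_card (d := 3) pos12 (fun y yJ => d3 J1 J1 y mi (fun k => pos21 y k yJ)).
rewrite mi mj [links J2 J1]linksC in D1; rewrite mi mj in D2.
by move: D1 D2 l12 s0 (leq_of_leqif (leq_card_setU (doubled J1 J2) (doubled J2 J1))); clear; lia.
Qed.

Lemma block_full_connect i : i \in B -> #|block i| = b ->
  forall j k, j \in B -> k \in B -> connect (arc x) j k.
Proof.
move=> iB mb j k jB kB; have BE := block_full iB mb.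
by apply: (block_connect iB); rewrite BE.
Qed.

Lemma block_gt0 i : 0 < #|block i|.
Proof. by apply/card_gt0P; exists i; apply: block_refl. Qed.

Lemma block_le i : i \in B -> #|block i| <= b.
Proof. by move/block_B/subset_leq_card. Qed.

Lemma block_other i : i \in B -> #|block i| < b -> exists2 j, j \in B & j \notin block i.
Proof.
move=> iB lt; have /properP[_ //] : block i \proper B.
by rewrite properEcard block_B.
Qed.

Lemma block_card2 i j : i \in B -> j \in B -> j \notin block i -> #|block i| + #|block j| <= b.
Proof.
move=> iB jB ji; rewrite -cardsUI (_ : _ :&: _ = set0) ?cards0 ?addn0.
  by apply: subset_leq_card; rewrite subUset !block_B.
by apply/eqP; rewrite setI_eq0 block_disjoint.
Qed.

Lemma ex_B : a < r -> exists i, i \in B.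
Proof. by move=> ar; apply/set0Pn; rewrite -card_gt0; move: card_AB ar; clear; lia. Qed.

(** Let [m] be the size of a block. For [r >= 9], the bounds for [m] and [m + 2] leave only the
    block of all classes outside [A]. For [r = 8], neither [m] nor [m + 2] is 4, and likewise for
    sums of two blocks; the partitions left are 6, 5 + 1 and 3 + 3. *)
Lemma acc_neq2 : a <> 2.
Proof.
move=> a2; have bE : b = r - 2 by move: card_AB a2; clear; lia.
have [|i iB] := ex_B; first by rewrite a2; apply: leq_trans r8.
have full j : j \in B -> #|block j| = b -> False.
  by move=> jB mb; apply: (acc2_strong a2); apply: block_full_connect mb.
have [r9|] := ltnP 8 r.
  have [h1 h2] := block_bound iB; apply: (full i iB); rewrite bE.
  have m1 := block_gt0 i; have m2 := block_le iB; rewrite a2 in h2; rewrite bE in m2.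
  move: m1 m2 h1 h2 r9; clear; move: #|block i| => m m1 m2 h1 h2 r9.
  apply/eqP; rewrite eqn_leq m2 leqNgt; apply/negP => lt.
  have [p rE] : exists p, r = m + 2 + p.+1 by exists (r - m - 3); lia.
  move: h1 h2; have -> : r - m = p.+3 by lia.
  have -> : r - (2 + m) = p.+1 by lia.
  rewrite rE in r9 *; case: p {rE} r9 => [|[|[|p]]] r9; nia.
move=> r8'; have rE : r = 8 by apply/eqP; rewrite eqn_leq r8'.
have b6 : b = 6 by move: bE rE; clear; lia.
have small j : j \in B -> #|block j| = 1 \/ #|block j| = 3 \/ #|block j| = 5 \/ #|block j| = 6.
  move=> jB; have [] := block_bound jB; have := block_le jB; have := block_gt0 j.
  rewrite b6 a2; move: #|block j| => m; rewrite rE; clear -c => m0 m6 h1 h2.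
  by case: m m0 m6 h1 h2 => [|[|[|[|[|[|[|m]]]]]]] //; clear; lia.
have step j k : j \in B -> k \in B -> k \notin block j -> 
    #|block j| + #|block k| <> 2 /\ #|block j| + #|block k| <> 4.
  move=> jB kB kj; have [] := block_bound2 jB kB kj; rewrite a2 -addnA.
  by move: (_ + _) => m; rewrite rE; clear; lia.
have [m1|[m3|[m5|m6]]] := small i iB; last by apply: (full i iB); rewrite b6.
- have [|j jB ji] := block_other iB; first by rewrite m1 b6.
  have [n2 n4] := step _ _ iB jB ji; have le6 := block_card2 iB jB ji.
  have mj : #|block j| = 5.
    by have := small j jB; move: n2 n4 le6; rewrite m1 b6; clear; lia.
  apply: (acc2_blocks51 rE a2 jB mj iB); first by apply: contra ji; rewrite !in_block same_block_sym.
  apply/eqP; rewrite eq_sym eqEcard subUset sub1set iB block_B //= b6 cardsU1 mj.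
  rewrite (_ : i \notin block j) //; apply: contra ji; rewrite !in_block same_block_sym //.
- have [|j jB ji] := block_other iB; first by rewrite m3 b6.
  have [n2 n4] := step _ _ iB jB ji; have le6 := block_card2 iB jB ji.
  have mj : #|block j| = 3.
    by have := small j jB; move: n2 n4 le6; rewrite m3 b6; clear; lia.
  case: (boolP (connect (arc x) j i)) => cji; last exact: (acc2_blocks33 rE a2 iB jB).
  apply: (acc2_blocks33 rE a2 jB iB mj m3); first by apply: contra ji; rewrite !in_block same_block_sym.
  by apply: contra ji => cij; rewrite in_block /same_block iB jB cij cji orbT.
- have [|j jB ji] := block_other iB; first by rewrite m5 b6.
  apply: (acc2_blocks51 rE a2 iB m5 jB ji).
  by apply/eqP; rewrite eq_sym eqEcard subUset sub1set jB block_B //= b6 cardsU1 m5 ji.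
Qed.

Lemma sum_disjoint_solosA (D : {set T}) : \sum_(w | c w \in A) #|D :&: solos w| <= a * #|D|.
Proof.
rewrite (partition_big c (mem A)) //= -sum_nat_const; apply: leq_sum => W WA.
rewrite (eq_bigl (fun w => c w == W)); first exact: sum_disjoint_solos.
by move=> w; case: eqP => [->|]; rewrite ?WA ?andbF.
Qed.

(** * Three accessible classes *)

Lemma acc3_strong : r = 8 -> a = 3 -> (forall i j, i \in B -> j \in B -> connect (arc x) i j) -> False.
Proof.
move=> rE a3 H; have bE : b = 5 by move: card_AB a3 rE; clear; lia.
have nh y : c y \in B -> ~ hole y.
  move=> yB; apply: no_hole => //; left.
  have -> : reaches (c y) = B; last by rewrite a3 bE.
  apply/setP => i; rewrite [i \in reaches _]in_set -in_setC; case: (boolP (i \in B)) => //= iB.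
  exact: H.
have [|W [WA Wx lW]] := ex_leaf; first by rewrite a3.
have [] := leaf_count (k := 4) WA lW Wx.
- by move=> w cw nsw; apply: nohole_solos; rewrite ?cw.
- by move=> w cw; apply: full_solos4; rewrite ?cw.
(* Again only [m > 0] helps: [10s <= 10(s - m) + 8m]. *)
move=> m [/andP[m0 ms]]; rewrite bE (_ : r * m = 8 * m); last by rewrite rE.
by move: m0 ms; clear; lia.
Qed.

(* A hole at [y0] lets [x] enter the class of [y'], once [u] has replaced [y0] and [y'] has replaced [u]. *)
Lemma hole_shift y0 u y' : hole y0 -> c y0 \in B -> c u \in B -> c y' \in B ->
  c u != c y0 -> c y' != c u -> c y' != c y0 -> movable u (c y0) ->
  e' u y' -> deg y' (c u) = 1 -> (forall v, e x v -> c v != c y') -> False.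
Proof.
rewrite !in_setC => -[c2 gc2 [c2x c2a c2E]] y0B uB y'B uy0 y'u y'y0 /movableP mv euy d1 nx.
have ux : u != x by apply: contraNneq uB => ->; apply: acc_root.
have yx : y' != x by apply: contraNneq y'B => ->; apply: acc_root.
have keep v : v != x -> c v \notin A -> v != y0 -> c2 v = c v.
  by move=> vx vB vy; apply: c2E => //; rewrite c2a // vB.
have back v i : v != x -> i \notin A -> c2 v = i -> c v = i.
  by move=> vx iB cv; rewrite -c2E // cv.
have c2u : c2 u = c u by apply: keep => //; apply: contraNneq uy0 => ->.
have c2y : c2 y' = c y' by apply: keep => //; apply: contraNneq y'y0 => ->.
have uc : uniq (map c2 [:: u; x; y']).
  by rewrite /= c2u c2x c2y !inE negb_or uy0 eq_sym y'u eq_sym y'y0.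
have cyc : cycle (only_neighbor e' c2) [:: u; x; y'].
  rewrite /= andbT; apply/and3P; split; last first.
  - apply/only_neighborP => v eyv; rewrite c2u => cv.
    have vx : v != x by apply: contraTneq eyv => ->; rewrite isolatex'.
    have/only_neighborP : only_neighbor e' c y' u by rewrite only_deg // d1.
    by apply=> //; apply: back cv.
  - exact: only_root.
  - apply/only_neighborP => v euv; rewrite c2x => cv; case: (mv v euv); apply: back cv => //.
    by apply: contraTneq euv => ->; rewrite isolatex'.
have gc3 := good_rot e_sym e_irr uc cyc gc2.
have [v exv] := stuck gc3.
have vx : v != x by apply: contraTneq exv => ->; rewrite e_irr.
have c3x : rot c2 [:: u; x; y'] x = c y'.
  by rewrite ffunE /= eq_sym [u == x](negPf ux) eqxx c2y.
have := nx v exv; rewrite c3x ffunE /=.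
have [->|vu] := eqVneq v u; first by rewrite c2x => _ cE; rewrite cE eqxx in y'y0.
rewrite (negPf vx).
have [->|vy] := eqVneq v y'; first by rewrite c2u => _ cE; rewrite cE eqxx in y'u.
by move=> cv /back cv'; rewrite cv' ?eqxx in cv.
Qed.

Lemma links_setT : links setT setT = links A A + 2 * links A B + links B B.
Proof.
have dAB : [disjoint A & B] by rewrite -setI_eq0 setICr.
rewrite -[X in links X _](setUCr A) links_unionl // -(setUCr A) !linksU // [links B A]linksC.
by rewrite mul2n -addnn !addnA.
Qed.

Lemma links_two I J : [disjoint I & J] -> I :|: J \subset B ->
  2 * links I J + links I I + links J J <= links B B.
Proof.
move=> d sub.
have -> : 2 * links I J + links I I + links J J = links (I :|: J) (I :|: J).
  by rewrite links_unionl // !linksU // [links J I]linksC; clear; lia.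
have mono I1 I2 J1 : I1 \subset I2 -> links I1 J1 <= links I2 J1.
  move=> s12; rewrite !links_sum [leqRHS](big_setID I1) /= (setIidPr s12); exact: leq_addr.
apply: leq_trans (mono _ _ _ sub) _; rewrite [X in X <= _]linksC; exact: mono.
Qed.

(** Without holes, [total] for all of [B] contradicts the edge bound. Otherwise a hole lies in the
    block of size 2, and all neighbors of [x] lie in [A] and this block. [hole_shift] would then
    place [x] in the block of size 3 unless the two classes of the small block have many edges
    between them; these edges refute [total] for the larger block. *)
Lemma acc3_blocks32 i j : r = 8 -> a = 3 -> i \in B -> j \in B -> #|block i| = 3 -> #|block j| = 2 ->
  j \notin block i -> False.
Proof.
move=> rE a3 iB jB mi mj ji.
pose J3 := block i; pose J2 := block j.
have J3B : J3 \subset B := block_B iB; have J2B : J2 \subset B := block_B jB.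
have b5 : b = 5 by move: card_AB a3 rE; clear; lia.
have dJ : [disjoint J3 & J2] := block_disjoint ji.
have BE : J3 :|: J2 = B.
  apply/eqP; rewrite eqEcard subUset J3B J2B -[#|_ :|: _|]addn0 -(@cards0 'I_r).
  by rewrite -(_ : J3 :&: J2 = set0) ?cardsUI ?mi ?mj ?b5 //; apply/eqP; rewrite setI_eq0.
have inB k : k \in B -> k \in J3 \/ k \in J2 by rewrite -BE => /setUP.
have rs : r * s = 8 * s by rewrite rE.
have lall : links A A + 2 * links A B + 2 * links J3 J2 + links J2 J2 + 12 <= 48 * s.
  have h3 : 3 <= 8 * s by move: s0; clear; lia.
  have := links_all e_sparse gc; rewrite rs => /(_ h3); rewrite links_setT.
  have := links_two dJ; rewrite BE => /(_ (subxx _)).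
  by clear; lia.
have l32 := block_links iB jB ji; rewrite mi mj -/J3 -/J2 in l32.
have lA J : J \subset B -> 3 * #|J| * s <= links A J.
  move=> JB; rewrite -a3; apply: links_ge => // k l kA lJ.
  by rewrite (B_A_noarc (subsetP JB _ lJ) kA) orbT.
have lAB : links A B = links A J3 + links A J2 by rewrite -linksU // BE.
have [lA3 lA2] := (lA _ J3B, lA _ J2B); rewrite mi in lA3; rewrite mj in lA2.
have degA2 w : c w \in A -> stiff w -> 2 <= degs w A by move=> wA /(stiff_degA wA); rewrite a3.
have k6 w : c w \in A -> stiff w -> #|solos w| <= 6.
  by move=> wA sw; have := leq_trans (card_solos_le w) (stiff_degs wA sw); rewrite b5.
have nc23 k l : ~~ connect (arc x) j i -> k \in J2 -> l \in J3 -> ~~ arc x k l := block_noarc jB iB.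
have nc32 k l : ~~ connect (arc x) i j -> k \in J3 -> l \in J2 -> ~~ arc x k l := block_noarc iB jB.
have pos23 : ~~ connect (arc x) j i -> forall u k, c u \in J2 -> k \in J3 -> 0 < deg u k.
  by move=> nc u k uJ kJ; apply: noarc_deg; apply: nc23.
have pos32 : ~~ connect (arc x) i j -> forall u k, c u \in J3 -> k \in J2 -> 0 < deg u k.
  by move=> nc u k uJ kJ; apply: noarc_deg; apply: nc32.
have not_both : ~~ connect (arc x) i j || ~~ connect (arc x) j i.
  rewrite -negb_and; apply: contra ji => /andP[cij cji].
  by rewrite in_block /same_block iB jB cij cji orbT.
have mutual_bound : ~~ connect (arc x) i j -> ~~ connect (arc x) j i ->
    #|doubled J3 J2| + 6 * s <= links J3 J2.
  move=> ncij ncji; have := doubled_card (d := 2) (pos23 ncji); rewrite mi mj [links J2 J3]linksC.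
  have dd y : c y \in J3 -> 2 <= degs y J2.
    by move=> yJ; rewrite -mj -sum1_card; apply: leq_sum => k kJ; apply: (pos32 ncij).
  by move/(_ dd); clear; lia.
have type w y : c w \in A -> stiff w -> 5 <= #|solos w| -> y \in solos w :\: universal w ->
    (c y \in J3 -> ~~ connect (arc x) j i /\ y \in doubled J3 J2) /\
    (c y \in J2 -> ~~ connect (arc x) i j).
  move=> wA sw k5 yK.
  have [_ [k [_ kZ _]]] := ex_nonuniversal wA sw k5.
  have nk := missed_noreach_stiff wA sw yK kZ.
  split=> yJ; case: (inB k (missed_B kZ)) => kJ.
  - by case/negP: nk; apply: block_connect iB kJ yJ.
  - split; last by apply: (doubledP wA sw yK yJ kZ) => l; apply: block_connect jB kJ.
    apply: contra nk => cji; apply: connect_trans (block_connect jB kJ (block_refl j)) _.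
    exact: connect_trans cji (block_connect iB (block_refl i) yJ).
  - apply: contra nk => cij; apply: connect_trans (block_connect iB kJ (block_refl i)) _.
    exact: connect_trans cij (block_connect jB (block_refl j) yJ).
  - by case/negP: nk; apply: block_connect jB kJ yJ.
have stiffP w J : c w \in A -> J \subset B -> (forall y, c y \in J -> ~ hole y) -> 0 < nsolos w J -> stiff w.
  by move=> wA JB nh; apply: contraTT => /(nohole_nsolos wA JB nh)->.
(* Per vertex, [5k <= 10 * 2 + 2 * #|D :&: solos w|]: clear for [k <= 4], and for [k <= 6] because
   [D] contains all solos in [J] but one. *)
have total (D : {set T}) J : J \subset B -> (forall y, c y \in J -> ~ hole y) ->
    (forall w, c w \in A -> stiff w -> 5 <= #|solos w| -> nsolos w J <= 1 + #|D :&: solos w|) ->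
    15 * (3 * (#|J| * s)) <= 10 * links A A + 6 * #|D| + 10 * links J A.
  move=> JB nh HD; have := sum_nsolos_total JB nh; rewrite a3.
  have : 5 * \sum_(w | c w \in A) nsolos w J <= 10 * links A A + 2 * \sum_(w | c w \in A) #|D :&: solos w|.
    rewrite /links !big_distrr -big_split /=; apply: leq_sum => w wA.
    have [->//|k0] := posnP (nsolos w J).
    have sw := stiffP w J wA JB nh k0.
    move: (degA2 w wA sw) (k6 w wA sw) (nsolos_le w J) (HD w wA sw); clear.
    by case: (leqP 5 #|solos w|) => [_ d kk k /(_ isT)|]; lia.
  have := sum_disjoint_solosA D; rewrite a3; clear; lia.
case: (pselect (forall y, c y \in B -> ~ hole y)) => [nh|].
  have [D [D1 D2]] : exists D : {set T}, #|D| + 4 * s <= links J3 J2 /\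
      forall w y, c w \in A -> stiff w -> 5 <= #|solos w| -> y \in solos w :\: universal w -> y \in D.
    case: (boolP (connect (arc x) i j)) => cij.
      exists (doubled J3 J2); split=> [|w y wA sw k5 yK].
        have ncji : ~~ connect (arc x) j i by move: not_both; rewrite cij.
        have := doubled_card_upper (d := 5) (pos23 ncji); rewrite mi mj [links J2 J3]linksC.
        have dd y : c y \in J3 -> degs y J2 <= 5.
          move=> yJ; have yB := subsetP J3B _ yJ.
          have : 3 <= degs y A by rewrite -a3 -sum1_card; apply: leq_sum => k kA; apply: B_deg.
          by move: (degsAB y) (degsS e x c y J2B) rE; clear; lia.
        by move/(_ dd); move: l32; clear; lia.
      have [t1 t2] := type w y wA sw k5 yK.
      by case: (inB _ (nonuniversal_B yK)) => [/t1[]//|/t2]; rewrite cij.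
    case: (boolP (connect (arc x) j i)) => cji.
      exists [set y | c y \in J2]; split=> [|w y wA sw k5 yK].
        by rewrite (classes_card gc) mj; move: l32; clear; lia.
      have [t1 t2] := type w y wA sw k5 yK; rewrite in_set.
      by case: (inB _ (nonuniversal_B yK)) => [/t1[]|//]; rewrite cji.
    exists (doubled J3 J2 :|: [set y | c y \in J2]); split=> [|w y wA sw k5 yK].
      apply: leq_trans (leq_add (leq_of_leqif (leq_card_setU _ _)) (leqnn _)) _.
      by rewrite (classes_card gc) mj; move: (mutual_bound cij cji); clear; lia.
    have [t1 t2] := type w y wA sw k5 yK; rewrite in_setU in_set.
    by case: (inB _ (nonuniversal_B yK)) => [/t1[_ ->]//|->]; rewrite orbT.
  have HD w : c w \in A -> stiff w -> 5 <= #|solos w| -> nsolos w B <= 1 + #|D :&: solos w|.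
    move=> wA sw k5; rewrite nsolosB -(cardsID (universal w)) (setIidPr (universal_sub w)).
    apply: leq_add; first exact: card_universal5.
    by apply/subset_leq_card/subsetP => y yK; rewrite in_setI (D2 w) //; case/setDP: yK.
  have := total D B (subxx B) nh HD; rewrite b5 [links B A]linksC.
  by move: lall lAB l32 lA3 lA2 D1 s0; clear; lia.
move=> /existsNP[y0 /not_implyP[y0B /contrapT hy0]].
have [Rle2 R5] := hole_bound y0B hy0; rewrite a3 in R5.
have R2 : #|reaches (c y0)| <= 2 by move: R5; clear; lia.
have y0J : c y0 \in J2.
  case: (inB _ y0B) => // y0J; have := subset_leq_card (reaches_sub iB (block_connect iB (block_refl i) y0J)).
  by rewrite mi; move: R2; clear; lia.
have RJ : reaches (c y0) = J2.
  apply/eqP; rewrite eq_sym eqEcard mj R2 andbT.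
  exact: reaches_sub jB (block_connect jB (block_refl j) y0J).
have ncij : ~~ connect (arc x) i j.
  apply/negP => cij; have cy : connect (arc x) i (c y0).
    exact: connect_trans cij (block_connect jB (block_refl j) y0J).
  by have := subset_leq_card (reaches_sub iB cy); rewrite mi; move: R2; clear; lia.
have nx3 v : e x v -> c v \notin J3.
  move=> exv; apply/negP => vJ.
  have y0n : c y0 \notin A by rewrite -in_setC.
  have [_ hr] := hole_reaches e_sym e_irr stuck cmax y0n hy0.
  have : #|c v |: (A :|: J2)| <= 5.
    apply: leq_trans (leq_trans (leq_imset_card c [set u | e x u]) x_deg).
    apply/subset_leq_card/subsetP => k; rewrite in_setU1 => /predU1P[->|].
      by apply: imset_f; rewrite inE.
    rewrite in_setU => /orP[/(subsetP acc_root_neighbors)//|]; rewrite -RJ => /hr[u exu <-].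
    by rewrite imset_f // inE.
  have dAJ : [disjoint A & J2].
    by apply: sets_disjoint => k kA; apply: contraTN kA => /(subsetP J2B); rewrite in_setC.
  rewrite cardsU1 card_disjointU // a3 mj.
  suff -> : c v \notin A :|: J2 by [].
  rewrite in_setU negb_or.
  by rewrite (disjointFr dJ vJ) andbT; have := subsetP J3B _ vJ; rewrite in_setC.
have nh3 y : c y \in J3 -> ~ hole y.
  move=> yJ; apply: no_hole; first exact: subsetP J3B _ yJ.
  right; have := subset_leq_card (reaches_sub iB (block_connect iB (block_refl i) yJ)).
  by rewrite mi a3; clear; lia.
have [l lJ ly] : exists2 l, l \in J2 & l != c y0.
  have : 0 < #|J2 :\ c y0| by move: mj; rewrite -/J2 (cardsD1 (c y0)) y0J; clear; lia.
  by case/card_gt0P => l /setD1P[]; exists l.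
have J2E : J2 = [set c y0; l].
  apply/eqP; rewrite eq_sym eqEcard mj cards2 eq_sym ly andbT subUset !sub1set y0J.
  exact: lJ.
have lsplit I : links I J2 = links I [set c y0] + links I [set l].
  by rewrite J2E linksU //; apply: sets_disjoint => k /set1P->; rewrite in_set1 eq_sym.
have lB := subsetP J2B _ lJ.
pose S := [set y | c y \in J3 & deg y l == 1].
(* A vertex [u] of class [l] adjacent to [S] has [d >= 1] neighbors in the class of [y0], by
   [hole_shift]. With three neighbors in [A], at most [5 - d <= 4d] remain for [J3]. *)
have S1 : #|S| <= 4 * links [set l] [set c y0].
  have -> : #|S| = \sum_(u | c u == l) #|[set y in S | e' u y]|.
    transitivity (\sum_(y in S) \sum_(u | c u == l) e' u y).
      rewrite -sum1_card; apply: eq_bigr => y; rewrite in_set => /andP[_ /eqP {1}<-].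
      rewrite /deg -sum1dep_card (eq_bigl (fun u => (c u == l) && e' y u)) => [|u]; last by rewrite andbC.
      by rewrite big_mkcondr; apply: eq_bigr => u _; rewrite (e'_sym u y); case: (e' y u).
    by rewrite exchange_big; apply: eq_bigr => u _; rewrite card_sum_sep.
  rewrite links1 big_distrr /=; apply: leq_sum => u /eqP cu; rewrite degs1.
  have [/eqP|] := boolP (#|[set y in S | e' u y]| == 0); first by move=> ->.
  rewrite -lt0n => /card_gt0P[y' /setIdP[]]; rewrite in_set => /andP[y'J /eqP d1] euy.
  have uB : c u \in B by rewrite cu.
  have d0 : 0 < deg u (c y0).
    rewrite lt0n deg_eq0; apply/negP => mv.
    apply: (hole_shift hy0 y0B uB (subsetP J3B _ y'J) _ _ _ mv euy); rewrite ?cu //.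
    - by apply: contraTneq lJ => <-; rewrite (disjointFr dJ y'J).
    - by apply: contraTneq y0J => <-; rewrite (disjointFr dJ y'J).
    - by move=> v /nx3; apply: contraNneq => ->.
  have : #|[set y in S | e' u y]| <= degs u J3.
    rewrite degsE; apply/subset_leq_card/subsetP => y; rewrite !in_set => /andP[/andP[yJ _] ->].
    by [].
  have : degs u A + (degs u J3 + deg u (c y0)) <= 8.
    have h1 : degs u J3 + deg u (c y0) <= degs u B.
      by rewrite -BE degsU // leq_add2l -degs1; apply: degsS; rewrite sub1set.
    by move: (degsAB u) h1 rE; clear; lia.
  have : 3 <= degs u A by rewrite -a3 -sum1_card; apply: leq_sum => k kA; apply: B_deg.
  by move: d0; clear; lia.
have S2 := @card_solos l J3 (fun y yJ => pos32 ncij y l yJ lJ); rewrite mi -/S in S2.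
have X1 : 3 * s <= links J3 [set c y0].
  rewrite linksC -mi; have := @links_ge _ _ _ _ x e_sym c gc [set c y0] J3; rewrite cards1 mul1n; apply.
  by move=> k m /set1P-> mJ; rewrite (nc32 m) ?orbT.
have Y12 : 2 * links [set l] [set c y0] <= links J2 J2.
  rewrite (lsplit J2) J2E links_unionl ?links_unionl; first by rewrite [links [set l] _]linksC; clear; lia.
  - by apply: sets_disjoint => k /set1P->; rewrite in_set1 eq_sym.
  - by apply: sets_disjoint => k /set1P->; rewrite in_set1 eq_sym.
have XE := lsplit J3.
have [D [D1 D2]] : exists D : {set T}, (#|D| + 6 * s <= links J3 J2 \/ #|D| = 0) /\
    forall w y, c w \in A -> stiff w -> 5 <= #|solos w| -> y \in solos w :\: universal w -> c y \in J3 -> y \in D.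
  case: (boolP (connect (arc x) j i)) => cji.
    exists set0; split=> [|w y wA sw k5 yK yJ]; first by right; rewrite cards0.
    by have [/(_ yJ)[]] := type w y wA sw k5 yK; rewrite cji.
  exists (doubled J3 J2); split=> [|w y wA sw k5 yK yJ]; first by left; apply: mutual_bound.
  by have [/(_ yJ)[]] := type w y wA sw k5 yK.
have HD w : c w \in A -> stiff w -> 5 <= #|solos w| -> nsolos w J3 <= 1 + #|D :&: solos w|.
  move=> wA sw k5; rewrite /nsolos -(cardsID (universal w)); apply: leq_add.
    by apply: leq_trans (card_universal5 k5); apply/subset_leq_card/subsetIr.
  apply/subset_leq_card/subsetP => y /setDP[/setIdP[yK yJ] yU].
  by rewrite in_setI yK (D2 w) // in_setD yU.
have := total D J3 J3B nh3 HD; rewrite mi [links J3 A]linksC.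
by case: D1 => D1; move: lall lAB l32 lA3 lA2 D1 s0 S1 S2 X1 Y12 XE; clear; lia.
Qed.

(** [a_bound] gives [r = 8]. Neither the size of a block nor 3 more is 4, nor is the sum of two
    block sizes; the partitions left are 5 and 3 + 2. *)
Lemma acc_neq3 : a <> 3.
Proof.
move=> a3; have bE : b = r - 3 by move: card_AB a3; clear; lia.
have rE : r = 8.
  apply/eqP; rewrite eqn_leq r8 andbT leqNgt; apply/negP => r9.
  by have := a_bound; rewrite bE a3; move: r9; clear; lia.
have b5 : b = 5 by rewrite bE rE.
have [|i iB] := ex_B; first by rewrite a3 rE.
have full j : j \in B -> #|block j| = b -> False.
  by move=> jB mb; apply: (acc3_strong rE a3); apply: block_full_connect mb.
have small j : j \in B -> #|block j| = 2 \/ #|block j| = 3 \/ #|block j| = 5.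
  move=> jB; have [] := block_bound jB; have := block_le jB; have := block_gt0 j.
  rewrite b5 a3; move: #|block j| => m; rewrite rE; clear -c => m0 m6 h1 h2.
  by case: m m0 m6 h1 h2 => [|[|[|[|[|[|[|m]]]]]]] //; clear; lia.
have step j k : j \in B -> k \in B -> k \notin block j -> #|block j| + #|block k| <> 4.
  move=> jB kB kj; have [] := block_bound2 jB kB kj; rewrite a3 -addnA.
  by move: (_ + _) => m; rewrite rE; clear; lia.
have two j k : j \in B -> k \in B -> k \notin block j -> #|block j| = 3 -> #|block k| = 2.
  move=> jB kB kj; have := small k kB; have := block_card2 jB kB kj; have := step j k jB kB kj.
  by rewrite b5; clear; lia.
have [m2|[m3|m5]] := small i iB; last by apply: (full i iB); rewrite b5.
- have [|j jB ji] := block_other iB; first by rewrite m2 b5.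
  have n4 := step _ _ iB jB ji; have le6 := block_card2 iB jB ji.
  have mj : #|block j| = 3.
    by have := small j jB; move: n4 le6; rewrite m2 b5; clear; lia.
  apply: (acc3_blocks32 rE a3 jB iB mj m2); apply: contra ji; rewrite !in_block same_block_sym //.
- have [|j jB ji] := block_other iB; first by rewrite m3 b5.
  exact: (acc3_blocks32 rE a3 iB jB m3 (two _ _ iB jB ji m3)).
Qed.

(** A Kempe change: [P] and [Q] form a union of components of the graph between two classes, with
    equally many vertices on either side. *)
Lemma good_swap (c1 : {ffun T -> 'I_r}) (P Q : {set T}) i j : good s e x c1 -> i != j -> #|P| = #|Q| ->
  (forall p, p \in P -> c1 p = i) -> (forall q, q \in Q -> c1 q = j) ->
  (forall p u, p \in P -> e' p u -> c1 u = j -> u \in Q) ->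
  (forall q u, q \in Q -> e' q u -> c1 u = i -> u \in P) ->
  good s e x [ffun v => if v \in P then j else if v \in Q then i else c1 v].
Proof.
move=> /andP[/is_properP pc /forallP bc] ij PQ Pi Qj HP HQ.
have QP v : v \in Q -> v \notin P by move/Qj=> cv; apply: contra ij => /Pi <-; rewrite cv.
set c2 := finfun _.
have c2E v : c2 v = if v \in P then j else if v \in Q then i else c1 v by rewrite ffunE.
have key u v : u \in P :|: Q -> e' u v -> c2 u <> c2 v.
  rewrite in_setU !c2E => uPQ euv; case/boolP: (u \in P) uPQ => /= [uP _|uP uQ].
    case: ifP => vP; first by move=> _; have := pc _ _ euv; rewrite (Pi _ uP) (Pi _ vP) eqxx.
    case: ifP => vQ; first by move=> ji; rewrite ji eqxx in ij.
    by move/esym/(HP _ _ uP euv); rewrite vQ.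
  rewrite uQ; case: ifP => vP; first by move=> ji; rewrite ji eqxx in ij.
  case: ifP => vQ; first by move=> _; have := pc _ _ euv; rewrite (Qj _ uQ) (Qj _ vQ) eqxx.
  by move/esym/(HQ _ _ uQ euv); rewrite vP.
apply/andP; split.
  apply/is_properP => u v euv; apply/eqP.
  have [uPQ|] := boolP (u \in P :|: Q); first exact: key.
  have [vPQ _ /esym|] := boolP (v \in P :|: Q); first by apply: key; rewrite // e'_sym.
  rewrite !in_setU !negb_or !c2E => /andP[/negPf-> /negPf->] /andP[/negPf-> /negPf->].
  exact/eqP/pc.
apply/forallP => k.
have swap (S1 S2 : {set T}) : #|S1| = #|S2| -> S1 \subset [set v | c1 v == k] ->
    [disjoint S2 & [set v | c1 v == k]] ->
    #|[set v | c1 v == k] :\: S1 :|: S2| = s.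
  move=> S12 sub dis; rewrite -(eqP (bc k)) cardsU.
  rewrite (_ : _ :&: S2 = set0) ?cards0; last first.
    apply/eqP; rewrite setI_eq0 disjoint_sym; apply: disjointWr dis; exact: subsetDl.
  by rewrite cardsDS // S12 subn0 subnK // -S12 subset_leq_card.
have [ki|ki] := eqVneq k i.
  rewrite -(swap P Q PQ); last 2 first.
  - by apply/subsetP => v vP; rewrite in_set ki Pi.
  - rewrite -setI_eq0 -subset0; apply/subsetP => v /setIP[/Qj cv]; rewrite in_set cv ki => /eqP ji.
    by rewrite ji eqxx in ij.
  apply/eqP/eq_card => v; rewrite in_setU in_setD !in_set c2E ki.
  case/boolP: (v \in P) => vP /=.
    by rewrite eq_sym (negPf ij); apply/esym; apply: contraTF vP => /QP.
  by case: (v \in Q); rewrite ?eqxx ?orbT ?orbF.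
have [kj|kj] := eqVneq k j.
  rewrite -(swap Q P (esym PQ)); last 2 first.
  - by apply/subsetP => v vP; rewrite in_set kj Qj.
  - rewrite -setI_eq0 -subset0; apply/subsetP => v /setIP[/Pi cv]; rewrite in_set cv kj => /eqP ji.
    by rewrite ji eqxx in ij.
  apply/eqP/eq_card => v; rewrite in_setU in_setD !in_set c2E kj.
  case/boolP: (v \in P) => vP /=; first by rewrite eqxx orbT.
  by case: (v \in Q); rewrite ?(negPf ij) ?orbF.
rewrite -(eqP (bc k)); apply/eqP/eq_card => v; rewrite !in_set c2E.
case/boolP: (v \in P) => [/Pi->|_]; first by rewrite ![_ == k]eq_sym (negPf ki) (negPf kj).
by case/boolP: (v \in Q) => [/Qj->|//]; rewrite ![_ == k]eq_sym (negPf ki) (negPf kj).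
Qed.

(** * Five accessible classes *)

Lemma saturated_root_neighbors v : a = 5 -> e x v -> c v \in A.
Proof.
move=> a5 exv; apply: contraT => cv.
have : #|c v |: A| <= 5.
  apply: leq_trans (leq_trans (leq_imset_card c [set u | e x u]) x_deg).
  apply/subset_leq_card/subsetP => k; rewrite in_setU1 => /predU1P[->|/(subsetP acc_root_neighbors)//].
  by apply: imset_f; rewrite inE.
by rewrite cardsU1 cv a5.
Qed.

Lemma root_neighbor_unique u v : a = 5 -> e x u -> e x v -> c u = c v -> u = v.
Proof.
move=> a5 exu exv; suff /imset_injP inj : #|c @: [set u | e x u]| == #|[set u | e x u]|.
  by apply: inj; rewrite inE.
rewrite eqn_leq leq_imset_card /=; apply: leq_trans x_deg _.
by rewrite -{1}a5; apply: subset_leq_card acc_root_neighbors.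
Qed.

(* [w] and its neighbors in [Y] form a star component between the classes of [w] and [Y]. *)
Definition star W Y := [set w | [&& c w == W, 1 < deg w Y, mobile_root w, ~~ e x w &
  [forall y, (c y == Y) && e' w y ==> (deg y W == 1)]]].

(* After rerooting the tree at [W], exchange the leaves of the star with [w], [x] and the vertices of [S]. *)
Lemma star_swap W Y w (S : {set T}) : a = 5 -> W \in A -> Y \in B -> w \in star W Y ->
  (forall v, v \in S -> [/\ c v = W, deg v Y = 0, v != x, mobile_root v & ~~ e x v]) ->
  #|S|.+2 = deg w Y -> False.
Proof.
move=> a5 WA YB; rewrite in_set => /and5P[/eqP cw d1 mw nxw /forallP soloY] HS cS.
have [P [HP [c1 gc1 c1E]]] := reroot e_sym e_irr t gc WA.
have wS : w \notin S by apply/negP => /HS[_ d0 _ _ _]; rewrite d0 in d1.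
have wx : w != x.
  by apply: contraTneq d1 => ->; rewrite -degs1 degs_root.
have keep v : c v = W -> v != x -> mobile_root v -> c1 v = W.
  move=> cv vx mv; rewrite c1E (negPf vx); case: ifP => // /HP[_ vcx vE _].
  by have := implyP mv vcx; rewrite {1}vE cv eqxx.
have c1B v k : k \in B -> c1 v = k -> c v = k.
  rewrite in_setC => kB; rewrite c1E; case: eqP => [_ Wk|/eqP vx]; first by rewrite -Wk WA in kB.
  case: ifP => // /HP[va vcx _ _] pk; have [_ pA _ _] := arc_treeP t va vcx.
  by rewrite -pk pA in kB.
have YA : Y \notin A by rewrite -in_setC.
have WY : W != Y by apply: contraTneq WA => ->.
pose P1 := w |: (x |: S); pose Q := [set u | e' w u & c u == Y].
have P1i p : p \in P1 -> c1 p = W.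
  rewrite in_setU1 => /predU1P[->|]; first exact: keep.
  rewrite in_setU1 => /predU1P[->|/HS[cv _ vx mv _]]; last exact: keep.
  by rewrite c1E eqxx.
have xS : x \notin S by apply/negP => /HS[_ _]; rewrite eqxx.
have := stuck (good_swap gc1 WY _ P1i (Q := Q) _ _ _).
case.
- rewrite !cardsU1 (_ : w \notin _) ?xS ?add1n; first by rewrite cS.
  by rewrite in_setU1 negb_or wx.
- move=> q; rewrite in_set => /andP[ewq /eqP cq]; rewrite c1E.
  have qx : q != x by apply: contraTneq ewq => ->; rewrite isolatex'.
  by rewrite (negPf qx); case: ifP => // /HP[]; rewrite cq (negPf YA).
- move=> p u; rewrite in_setU1 => /predU1P[->|].
    by move=> ewu /(c1B _ _ YB) cu; rewrite in_set ewu cu eqxx.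
  rewrite in_setU1 => /predU1P[->|/HS[_ d0 _ _ _] epu /(c1B _ _ YB) cu]; first by rewrite isolatex.
  have : deg p Y == 0 by rewrite d0.
  by rewrite deg_eq0 => /movableP/(_ u epu); rewrite cu.
- move=> q u; rewrite in_set => /andP[ewq /eqP cq] equ c1u.
  have ux : u != x by apply: contraTneq equ => ->; rewrite isolatex'.
  have cu : c u = W.
    move: c1u; rewrite c1E (negPf ux); case: ifP => // /HP[ua ucx _ rk] pu.
    by have [_ _ _] := arc_treeP t ua ucx; rewrite pu ltnNge rk.
  have /implyP := soloY q; rewrite cq ewq eqxx => /(_ isT); rewrite -cw -only_deg // => /only_neighborP.
  by move/(_ u equ); rewrite cu cw => /(_ erefl)->; rewrite setU11.
have xP : x \in P1 by rewrite !in_setU1 eqxx orbT.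
move=> u exu; rewrite !ffunE xP.
have ux : u != x by apply: contraTneq exu => ->; rewrite e_irr.
rewrite in_setU1 in_setU1 (negPf ux) /=.
case: eqP => [uw|_]; first by rewrite -uw exu in nxw.
case: ifP => [/HS[_ _ _ _]|uS] /=; first by rewrite exu.
case: ifP => _; first by move=> WE; rewrite WE eqxx in WY.
by move/(c1B _ _ YB) => cu; have := saturated_root_neighbors a5 exu; rewrite cu (negPf YA).
Qed.

Definition small_star W Y := [set w in star W Y | deg w Y <= 4].

(** By [star_swap], every star has [#|S0| + 2 < deg w Y]. If a small star exists, then [S0] has at
    most one vertex and [I] at most three, and small stars have degree at least 3 into [Y]. Now sum
    [1 + 2 [v in D] <= deg v Y + [v in I]] over the class. *)
Lemma star_bound W Y : a = 5 -> W \in A -> Y \in B ->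
  2 * #|small_star W Y| + s <= 3 + links [set W] [set Y].
Proof.
move=> a5 WA YB; set D := small_star _ _.
have lWY : s <= links [set W] [set Y].
  by have := @A_links W [set Y] WA; rewrite cards1 mul1n sub1set; apply.
have [->|[w0 w0D]] := set_0Vmem D; first by rewrite cards0 muln0 add0n; apply: leq_trans lWY (leq_addl _ _).
pose I := [set v | c v == W & deg v Y == 0].
pose S0 := [set v in I | [&& v != x, mobile_root v & ~~ e x v]].
(* The two exceptions are [x] or the witness of [W], and the single neighbor of [x] in [W]. *)
have cI : #|I| <= #|S0| + 2.
  pose z := if W == c x then x else witness t W.
  rewrite -(cardsID S0) (setIidPr _); last by apply/subsetP => v /setIdP[].
  rewrite leq_add2l -[2]addn1.
  have sub : I :\: S0 \subset [set z] :|: [set v | e x v & c v == W].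
    apply/subsetP => v /setDP[vI]; rewrite in_set vI /= !negb_and !negbK.
    move: vI; rewrite in_set => /andP[/eqP cv _]; rewrite in_setU in_set1 in_set cv eqxx andbT.
    case/or3P => [/eqP vx|nm|->]; last by rewrite orbT.
      by rewrite /z vx -cv vx !eqxx.
    move: nm; rewrite /mobile_root negb_imply negbK cv => /andP[/negPf Wx /eqP vE].
    by rewrite /z Wx vE eqxx.
  apply: leq_trans (subset_leq_card sub) _; apply: leq_trans (leq_of_leqif (leq_card_setU _ _)) _.
  rewrite cards1 addnC leq_add2r; apply/card_le1_eqP => u v /setIdP[exu /eqP cu] /setIdP[exv /eqP cv].
  by apply: root_neighbor_unique; rewrite // cu.
have key w : w \in D -> #|S0| + 2 < deg w Y.
  case/setIdP => wD _; rewrite ltnNge; apply/negP => le.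
  have d1 : 1 < deg w Y by move: wD; rewrite in_set => /and5P[].
  have /card_geqP[q [uq sq subq]] : deg w Y - 2 <= #|S0| by move: le; clear; lia.
  apply: (@star_swap W Y w [set v in q] a5 WA YB wD) => [v|]; last first.
    by rewrite cardsE (card_uniqP uq) sq; move: d1; clear; lia.
  by rewrite in_set => /subq /setIdP[]; rewrite in_set => /andP[/eqP-> /eqP->] /and3P[].
have I3 : #|I| <= 3.
  by have := key w0 w0D; case/setIdP: w0D => _; move: cI; clear; lia.
have : \sum_(v in [set v | c v == W]) (1 + 2 * (v \in D)) <= \sum_(v in [set v | c v == W]) (deg v Y + (v \in I)).
  apply: leq_sum => v; rewrite in_set => cv.
  have [/key|vD] := boolP (v \in D); first by move: (deg v Y) #|S0| (v \in I); clear => *; lia.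
  rewrite [v \in I]in_set cv; case: (deg v Y) => [|n] //=; clear; lia.
rewrite big_split [leqRHS]big_split /= sum1_card (class_card gc) -big_distrr /=.
have -> : \sum_(v in [set v | c v == W]) deg v Y = links [set W] [set Y].
  by rewrite links1; apply: eq_big => v; rewrite ?in_set // degs1.
have sub (C : {set T}) : C \subset [set v | c v == W] -> \sum_(v in [set v | c v == W]) (v \in C) = #|C|.
  by move=> sC; rewrite -card_sum_sep; apply: eq_card => v; rewrite in_set andb_idl // => /(subsetP sC).
rewrite (sub D) ?(sub I).
- by move: I3; clear; lia.
- by apply/subsetP => v; rewrite !in_set => /andP[].
- by apply/subsetP => v /setIdP[]; rewrite !in_set => /and5P[].
Qed.

(** Improves the bipartite bound by 5: put [x] on the side of [B], where its five edges to
    accessible classes join the two sides. [links] does not count these edges. *)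
Lemma links_AB_upper : a = 5 -> 3 <= r * s -> links A B + 9 <= 2 * (r * s).
Proof.
move=> a5 rs; pose X := [set v | (c v \in A) && (v != x)].
have cT : #|X| + #|~: X| = r * s.
  by rewrite cardsC; have := classes_card gc setT; rewrite cardsT card_ord => <-; apply: eq_card => v; rewrite !inE.
have := e_sparse.2 X (~: X); rewrite cT -setI_eq0 setICr eqxx => /(_ isT rs).
apply: leq_trans; rewrite (_ : 9 = 5 + 4) // addnA leq_add2r.
have Ex : 5 <= \sum_(u in X) e u x.
  rewrite -card_sum_sep -{1}a5; apply: leq_trans (leq_imset_card c _); apply: subset_leq_card.
  apply/subsetP => i iA; have /imsetP[u] := subsetP acc_root_neighbors i iA.
  rewrite inE => exu iE; apply/imsetP; exists u => //; rewrite in_set e_sym exu andbT in_set -iE iA /=.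
  by apply: contraTneq exu => ->; rewrite e_irr.
have -> : links A B = \sum_(u in X) degs u B.
  rewrite /links (bigD1 x) ?acc_root //= degs_root add0n; apply: eq_bigl => u; by rewrite [u \in X]in_set.
apply: leq_trans (leq_add (leqnn _) Ex) _; rewrite -big_split; apply: leq_sum => u uX /=.
rewrite degsE -[_ + _](_ : #|[set v | e' u v & c v \in B] :|: [set v | (v == x) && e u x]| = _).
  apply/subset_leq_card/subsetP => v /setUP[/setIdP[/isolateW euv vB]|/setIdP[/eqP-> eux]].
    apply/setIdP; split=> //; rewrite in_setC [v \in X]in_set negb_and.
    by move: vB; rewrite in_setC => ->.
  by apply/setIdP; split=> //; rewrite in_setC [x \in X]in_set eqxx andbF.
rewrite card_disjointU; last first.
  rewrite -setI_eq0 -subset0; apply/subsetP => v /setIP[/setIdP[euv _] /setIdP[/eqP vx _]].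
  by rewrite vx isolatex' in euv.
congr (_ + _); case: (e u x).
  by rewrite (eq_card (B := [set x])) ?cards1 // => v; rewrite !inE andbT.
by apply: eq_card0 => v; rewrite in_set andbF.
Qed.

(** With four solos, the four neighbors outside [A] are all solos. Four more in the other accessible
    classes exhaust the degree 8, so [w] is not adjacent to [x]. *)
Lemma ex_star w : r = 8 -> a = 5 -> c w \in A -> stiff w -> #|solos w| = 4 ->
  exists2 Y, Y \in B & w \in small_star (c w) Y.
Proof.
move=> rE a5 wA sw k4; have b3 : b = 3 by move: card_AB a5 rE; clear; lia.
have dB : degs w B <= 4 by have := stiff_degs wA sw; rewrite b3.
have [|y yK] := @nonuniversal_ex w; first by rewrite k4.
have yB := nonuniversal_B yK; have mw := stiff_mobile_root wA sw.
have dy : deg w (c y) <= degs w B by rewrite -degs1; apply: degsS; rewrite sub1set.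
have KE : solos w = [set u | e' w u & c u \in B].
  by apply/eqP; rewrite eqEcard solos_neighbors k4 -degsE.
exists (c y) => //; apply/setIdP; split; last exact: leq_trans dB.
rewrite in_set eqxx (two_neighbors wA mw yK) mw /=; apply/andP; split.
  apply/negP => exw; have : degs w setT < #|[set u | e w u]|.
    rewrite degsE; apply: proper_card; apply/properP; split.
      by apply/subsetP => u /setIdP[/isolateW ewu _]; rewrite inE.
    exists x; first by rewrite inE e_sym.
    by apply/negP => /setIdP[]; rewrite isolatex'.
  rewrite -(setUCr A) degsU; last by rewrite -setI_eq0 setICr.
  have := stiff_degA wA sw; have := card_solos_le w; have := e_deg w.
  by move: k4 a5 rE; clear; lia.
apply/forallP => u; apply/implyP => /andP[/eqP cu ewu].
have : u \in solos w by rewrite KE; apply/setIdP; rewrite cu.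
by case/solosP => _; rewrite soloE => /andP[].
Qed.

Lemma acc_neq5 : a <> 5.
Proof.
move=> a5; have bE : b = r - 5 by move: card_AB a5; clear; lia.
have rE : r = 8.
  apply/eqP; rewrite eqn_leq r8 andbT leqNgt; apply/negP => r9.
  by have := a_bound; rewrite bE a5; move: r9; clear; lia.
have b3 : b = 3 by rewrite bE rE.
have rs : r * s = 8 * s by rewrite rE.
have nh y : c y \in B -> ~ hole y.
  move=> yB; apply: no_hole => //; right; rewrite a5.
  have : 0 < #|reaches (c y)|; last by clear; lia.
  by apply/card_gt0P; exists (c y); apply: (subsetP (reaches_block yB)); apply: block_refl.
have tot := sum_nsolos_total (subxx B) nh; rewrite a5 b3 in tot.
have pt : 4 * \sum_(w | c w \in A) nsolos w B <= 3 * links A A + 4 * \sum_(W in A) \sum_(Y in B) #|small_star W Y|.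
  have -> : \sum_(W in A) \sum_(Y in B) #|small_star W Y| = \sum_(w | c w \in A) \sum_(Y in B) (w \in small_star (c w) Y).
    rewrite (partition_big c (mem A)) //=; apply: eq_bigr => W WA.
    rewrite exchange_big /=; apply: eq_bigr => Y YB.
    transitivity (\sum_(w | c w == W) (w \in small_star W Y)).
      rewrite -sum1_card big_mkcond [RHS]big_mkcond /=; apply: eq_bigr => w _.
      case: ifP => [|_]; last by case: ifP.
      by case/setIdP; rewrite in_set => /andP[-> _].
    apply: eq_big => [w|w /eqP->//]; by case: eqP => [->|]; rewrite ?WA ?andbF.
  rewrite /links !big_distrr -big_split; apply: leq_sum => w wA /=.
  rewrite nsolosB; have [->//|k0] := posnP #|solos w|.
  have sw : stiff w by apply: contraTT k0 => /(nohole_solos wA nh)->.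
  have dA := stiff_degA wA sw; have := leq_trans (card_solos_le w) (stiff_degs wA sw); rewrite b3.
  rewrite a5 in dA; rewrite leq_eqVlt => /predU1P[k4|]; last first.
    by move: dA; clear; lia.
  have [Y YB wD] := ex_star rE a5 wA sw k4.
  by rewrite (bigD1 Y) //= wD k4; move: dA; clear; lia.
have st : 2 * \sum_(W in A) \sum_(Y in B) #|small_star W Y| + 15 * s <= 45 + links A B.
  have cst (p : nat) : \sum_(W in A) \sum_(Y in B) p = 15 * p.
    rewrite (eq_bigr (fun=> 3 * p)) => [|W _]; last by rewrite sum_nat_const b3.
    by rewrite sum_nat_const a5; clear; lia.
  rewrite links_sum2 // -[45]/(15 * 3) -!cst big_distrr -!big_split /=; apply: leq_sum => W WA.
  rewrite big_distrr -!big_split /=; apply: leq_sum => Y YB; exact: star_bound.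
have h3 : 3 <= 8 * s by move: s0; clear; lia.
(* Nothing is to spare: [15s <= links A B <= 16s - 9] forces [s >= 9], the remaining inequalities
   force [s <= 9], and for [s = 9] twice the number of small stars is at most 45, hence at most 44,
   which decides. *)
have := links_AB_upper a5; rewrite rs => /(_ h3); have := links_all e_sparse gc; rewrite rs => /(_ h3).
rewrite links_setT; move: tot pt st s0 linksAB_ge; rewrite a5 b3 [links B A]linksC; clear; lia.
Qed.

(** * A single accessible class *)

Lemma root_sum (F G : T -> nat) p : F x = 0 -> (forall w, c w = c x -> w != x -> F w <= p + G w) ->
  \sum_(w | c w == c x) F w <= p * s.-1 + \sum_(w | c w == c x) G w.
Proof.
move=> F0 H; rewrite (bigD1 x) //= F0 add0n.
have -> : p * s.-1 = \sum_(w | (c w == c x) && (w != x)) p.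
  rewrite -(class_card gc (c x)) (cardsD1 x) [x \in _]in_set eqxx add1n /= mulnC -sum_nat_const.
  by apply: eq_bigl => w; rewrite in_setD1 in_set andbC.
rewrite [X in _ + X](bigD1 x) //= addnCA; apply: leq_trans (leq_addl _ _).
by rewrite -big_split; apply: leq_sum => w /andP[/eqP cw wx]; apply: H.
Qed.

Lemma nsolos_root J : nsolos x J = 0.
Proof.
apply/eqP; rewrite cards_eq0 -subset0; apply/subsetP => y /setIdP[/solos_adj].
by rewrite isolatex.
Qed.

Section OneAccessible.
Hypothesis a1 : a = 1.

Lemma acc_root_only i : i \in A -> i = c x.
Proof.
move=> iA; have /card_le1_eqP := eq_leq a1; apply=> //; exact: acc_root.
Qed.

Lemma stiff_root w : c w = c x -> stiff w.
Proof.
move=> cw; apply/forall_inP => i /acc_root_only->; by rewrite cw eqxx.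
Qed.

Lemma root_linksB : links [set c x] B <= r * s.-1.
Proof.
rewrite links1; apply: leq_trans (root_sum (F := fun w => degs w B) (G := fun=> 0) (p := r) _ _) _.
- by rewrite degs_root.
- by move=> w _ _; rewrite addn0 degs_le.
by rewrite big1 // addn0.
Qed.

Lemma b1 : b = r.-1.
Proof. by move: card_AB a1; clear; lia. Qed.

(** A vertex with six solos misses two classes, one of them in the block [M]; then it has no
    nonuniversal solo in [M]. So each vertex has at most five solos in [M], and only the [s - 1]
    vertices other than [x] have any. *)
Lemma acc1_big_block i : i \in B -> 6 <= #|block i| -> b <= #|block i|.+1 -> False.
Proof.
move=> iB m6 bm; pose M := block i; have MB : M \subset B := block_B iB.
have leafx := leaf_root a1.
have xA := acc_root e x c.
have small w : c w = c x -> w != x -> nsolos w M <= 5 + 0.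
  move=> cw _; rewrite addn0; have wA : c w \in A by rewrite cw.
  have sw := stiff_root cw.
  have [k6|] := leqP 6 #|solos w|; last by rewrite ltnS; apply: leq_trans (nsolos_le _ _).
  have z2 : 1 < #|missed w| by have := stiff_solos wA sw (ltnW k6); move: k6; clear; lia.
  have [j jZ jM] : exists2 j, j \in missed w & j \in M.
    apply/exists_inP; apply: contraTT z2; rewrite negb_exists_in => /forall_inP H.
    have : missed w \subset B :\: M.
      by apply/subsetP => j jZ; rewrite in_setD (H j jZ) (missed_B jZ).
    by move/subset_leq_card; rewrite cardsDS //; move: bm; rewrite -/M; clear; lia.
  apply: leq_trans (nsolos_universal _) (leq_trans (card_universal5 (ltnW k6)) _) => // y yK.
  apply/negP => yM; case/negP: (missed_noreach_stiff wA sw yK jZ).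
  exact: block_connect iB jM yM.
have := root_sum (F := nsolos^~ M) (G := fun=> 0) (nsolos_root M) small.
rewrite [X in _ + X]big1 // addn0; have := sum_nsolos_leaf leafx xA MB.
rewrite linksC; have := root_linksB.
have d : [disjoint M & B :\: M] by apply: sets_disjoint => j jM; rewrite in_setD jM.
have -> : links [set c x] B = links [set c x] M + links [set c x] (B :\: M).
  by rewrite -linksU // -{1}(setIidPr MB) setID.
have := A_links xA (subsetDl B M); rewrite cardsDS // b1.
have mr : #|M| <= b := block_le iB.
move: m6 bm mr s0 r8; rewrite b1 -/M; move: #|M| => m; clear=> m6 bm mr s0 r8 h h1 h2 h3.
case: s s0 h h1 h2 h3 => // s' _ h h1 h2 h3; rewrite /= in h1 h3.
 have [] : m = r.-1 \/ m = r.-1 - 1 by lia.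
  by move=> mE; rewrite mE in h h2 m6 ; nia.
by move=> mE; rewrite mE in h h2 m6; nia.
Qed.

(** Two classes [N] lie outside the block [M]. If one of them is unconnected to [M], or reaches [M],
    then [key] applies, in the former case with doubled vertices as exceptions. Otherwise [M]
    reaches all inaccessible classes, and a vertex with a nonuniversal solo misses only classes of
    [N]. *)
Lemma acc1_block5 i : r = 8 -> i \in B -> #|block i| = 5 -> False.
Proof.
move=> rE iB m5; pose M := block i; have MB : M \subset B := block_B iB.
pose N := B :\: M; have b7 : b = 7 by rewrite b1 rE.
have n2 : #|N| = 2 by rewrite cardsDS // b7 m5.
have NB : N \subset B := subsetDl _ _.
have leafx := leaf_root a1; have xA := acc_root e x c.
have rs : r * s = 8 * s by rewrite rE.
have dMN : [disjoint M & N] by apply: sets_disjoint => j jM; rewrite in_setD jM.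
have MN : M :|: N = B by rewrite -{1}(setIidPr MB) setID.
have inB j : j \in B -> j \in M \/ j \in N by rewrite -MN => /setUP.
have LB : links [set c x] B = links [set c x] M + links [set c x] N by rewrite -linksU ?MN.
have LBle : links [set c x] B <= 8 * s.-1 by have := root_linksB; rewrite (_ : r * _ = 8 * s.-1) ?rE.
have LMge : 5 * s <= links [set c x] M by rewrite -{1}m5; apply: A_links.
have SB := sum_nsolos_leaf leafx xA (subxx B); rewrite b7 linksC in SB.
have SM := sum_nsolos_leaf leafx xA MB; rewrite m5 linksC in SM.
have SN := sum_nsolos_leaf leafx xA NB; rewrite n2 linksC in SN.
have stiffw w : c w = c x -> [/\ c w \in A, stiff w & mobile_root w].
  move=> cw; have wA : c w \in A by rewrite cw.
  by split=> //; [apply: stiff_root | apply: stiff_mobile_root wA (stiff_root cw)].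
have sum_links J : \sum_(w | c w == c x) degs w J = links [set c x] J by rewrite links1.
have noZM w y j : c w = c x -> y \in solos w :\: universal w -> j \in missed w -> c y \in M -> j \in M -> False.
  move=> cw yK jZ yM jM; have [wA sw _] := stiffw w cw.
  by case/negP: (missed_noreach_stiff wA sw yK jZ); apply: block_connect iB jM yM.
have ZMN w : #|missed w| = #|missed w :&: M| + #|missed w :&: N|.
  rewrite -card_disjointU; last first.
    by apply: disjointWl (subsetIr _ _) (disjointWr (subsetIr _ _) dMN).
  rewrite -setIUr MN; congr #|pred_of_set _|; apply/esym/setIidPl/subsetP => j; exact: missed_B.
have dle w : degs w B <= 8 by rewrite -rE degs_le.
have dsplit w : degs w B = degs w M + degs w N by rewrite -degsU ?MN.
have ksplit w : #|solos w| = nsolos w M + nsolos w N.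
  rewrite -nsolosB -MN /nsolos -card_disjointU.
    by apply: eq_card => y; rewrite in_setU !in_set andb_orr.
  rewrite -setI_eq0 -subset0; apply/subsetP => y /setIP[/setIdP[_ yM] /setIdP[_]].
  by rewrite (disjointFr dMN yM).
have kle w J : nsolos w J <= degs w J.
  rewrite degsE; apply/subset_leq_card/subsetP => y /setIdP[/solos_adj ewy yJ].
  by apply/setIdP.
have UM w : #|[set y in universal w | c y \in M]| <= #|universal w| /\ #|[set y in universal w | c y \in M]| <= nsolos w M.
  split; apply/subset_leq_card/subsetP => y /setIdP[yU yM] //.
  by apply/setIdP; rewrite (subsetP (universal_sub w)).
have cB w : c w = c x -> 14 <= #|solos w| + 2 * (degs w B - #|solos w|) + #|universal w| + 2 * #|missed w|.
  by move=> cw; have [wA _ mw] := stiffw w cw; have := class_count wA mw; rewrite b7.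
have cM w : c w = c x -> missed w :&: M = set0 ->
    10 <= nsolos w M + 2 * (degs w M - nsolos w M) + #|[set y in universal w | c y \in M]|.
  move=> cw ZM; have [wA _ mw] := stiffw w cw; have := class_count_in MB wA mw.
  by rewrite m5 ZM cards0 addn0.
have comp : links [set c x] M + links N M + 4 <= 16 * s.
  have := links_compl M; rewrite rs linksC -links_unionl; last first.
    by apply: sets_disjoint => j /set1P->; rewrite in_setD in_setC xA andbF.
  have -> : ~: M = [set c x] :|: N; last by rewrite mulnA.
  apply/setP => j; rewrite in_setU in_set1 in_setD !in_setC; have [->|jx] := eqVneq j (c x).
    by apply: contraL xA => /(subsetP MB); rewrite in_setC.
  by case: (boolP (j \in M)) => //= _; apply/esym; apply: contraNN jx => /acc_root_only->.
have NMge j : j \in N -> 5 * s <= links [set j] M.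
  move=> /setDP[jB jM]; rewrite -[5]mul1n -{1}(cards1 j) -m5; apply: links_ge => // k l /set1P-> lM.
  by apply: distinct_block_noarc; apply: contra jM => jl; rewrite in_block; move: lM; rewrite in_block => /same_block_trans; apply; rewrite same_block_sym.
have sumD (F G : T -> nat) : \sum_(w | c w == c x) (F w + G w) =
    \sum_(w | c w == c x) F w + \sum_(w | c w == c x) G w by rewrite big_split.
(* Three times [SM] plus twice [SB], bounded by [pt], gives [12s + 17 <= 2 * links [set c x] M +
   #|D|]. *)
have key (D : {set T}) : (forall w y, c w = c x -> 5 <= #|solos w| -> y \in solos w :\: universal w -> c y \in M ->
    #|missed w| <= 1 \/ y \in D) -> #|D| + 2 * links [set c x] M + 8 <= 12 * s -> False.
  move=> HD bd.
  have pt w : c w = c x -> w != x ->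
      3 * nsolos w M + 2 * #|solos w| + 2 * degs w B <= 34 + (degs w M + 2 * #|D :&: solos w|).
    move=> cw _; have [wA sw _] := stiffw w cw.
    have kM := kle w M; have kK := card_solos_le w; have d8 := dle w; have cK := nsolos_le w M.
    have [k5|k4] := leqP 5 #|solos w|; last by move: kM kK d8 cK k4; clear; lia.
    have U1 := card_universal5 k5.
    case: (pickP (fun y => (y \in solos w :\: universal w) && (c y \in M))) => [y0 /andP[y0K y0M]|none]; last first.
      have : nsolos w M <= #|universal w| by apply: nsolos_universal => y yK; have := none y; rewrite yK /= => ->.
      by move: kM kK d8 cK U1; clear; lia.
    have ZM : missed w :&: M = set0.
      by apply/setP => j; rewrite in_set0; apply/setIP => -[jZ jM]; apply: (noZM w y0 j).
    have [z1|z2] := leqP #|missed w| 1.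
      move: (cB w cw) (cM w cw ZM) (UM w) kM kK d8 cK U1 z1 k5; clear; lia.
    have : nsolos w M <= #|universal w| + #|D :&: solos w|.
      rewrite /nsolos -(cardsID (universal w)); apply: leq_add; first exact/subset_leq_card/subsetIr.
      apply/subset_leq_card/subsetP => y /setDP[/setIdP[yK yM] yU].
      rewrite in_setI yK andbT; have yKU : y \in solos w :\: universal w by rewrite in_setD yU.
      by case: (HD w y cw k5 yKU yM) => //; rewrite leqNgt z2.
    by move: kM kK d8 cK U1; clear; lia.
  have := root_sum (F := fun w => 3 * nsolos w M + 2 * #|solos w| + 2 * degs w B)
    (G := fun w => degs w M + 2 * #|D :&: solos w|) (p := 34).
  rewrite nsolos_root degs_root -nsolosB nsolos_root => /(_ erefl pt).
  rewrite !sumD !big1_eq !sum_links.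
  have -> : \sum_(w | c w == c x) #|solos w| = \sum_(w | c w == c x) nsolos w B.
    by apply: eq_bigr => w _; rewrite nsolosB.
  move: SB SM (sum_disjoint_solos (c x) D) bd s0; clear; lia.
have [K1 [K2 [K12 NE]]] : exists K1 K2, K1 != K2 /\ N = [set K1; K2].
  by case/cards2P: (introT eqP n2) => K1 [K2 [K12 NE]]; exists K1, K2.
have LN : links N M = links [set K1] M + links [set K2] M.
  by rewrite NE links_unionl //; apply: sets_disjoint => k /set1P->; rewrite in_set1.
have K1N : K1 \in N by rewrite NE set21.
have K2N : K2 \in N by rewrite NE set22.
have noconn j k l : j \in N -> k \in M -> l \in j |: M -> ~~ connect (arc x) j i -> ~~ connect (arc x) i j ->
    ~~ arc x j k /\ ~~ arc x k j.
  move=> jN kM _ n1 n2'; split.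
    apply: contra n1 => a1'; apply: connect_trans (connect1 a1') _.
    exact: block_connect iB kM (block_refl i).
  apply: contra n2' => a1'; apply: connect_trans (connect1 a1').
  exact: block_connect iB (block_refl i) kM.
have full_Z w : c w = c x -> (exists y, y \in solos w :\: universal w /\ c y \in M) -> 1 < #|missed w| -> missed w = N.
  move=> cw [y [yK yM]] z2; apply/eqP; rewrite eqEcard n2 z2 andbT.
  apply/subsetP => j jZ; case: (inB j (missed_B jZ)) => // jM.
  by case: (noZM w y j).
case: (boolP [exists j in N, ~~ connect (arc x) j i && ~~ connect (arc x) i j]).
  case/exists_inP => j jN /andP[nji nij].
  have noarc k : k \in M -> ~~ arc x j k /\ ~~ arc x k j.
    by move=> kM; apply: (noconn j k j) => //; rewrite setU11.
  apply: (key (doubled M [set j])) => [w y cw k5 yK yM|].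
    have [z1|z2] := leqP #|missed w| 1; [by left | right].
    have [wA sw _] := stiffw w cw.
    have ZN : missed w = N by apply: full_Z => //; exists y.
    apply: (doubledP wA sw yK yM (j := j)); first by rewrite ZN.
    by move=> k /set1P->; apply: connect0.
  have := @doubled_card 1 M [set j]; rewrite m5 cards1 => dc.
  have posj u k : c u \in [set j] -> k \in M -> 0 < deg u k.
    by move=> /set1P cu kM; apply: noarc_deg; rewrite cu; case: (noarc k kM).
  have posM y : c y \in M -> 1 <= degs y [set j].
    by move=> yM; rewrite degs1; apply: noarc_deg; case: (noarc (c y) yM).
  have := dc posj posM; have := NMge K1 K1N; have := NMge K2 K2N; move: jN; rewrite NE => /set2P[]->;
    by move: comp; rewrite LN; clear; lia.
rewrite negb_exists_in => /forall_inP Hn.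
case: (boolP [exists j in N, connect (arc x) j i]).
  case/exists_inP => j jN cji; apply: (key set0) => [w y cw k5 yK yM|].
    left; rewrite leqNgt; apply/negP => z2; have [wA sw _] := stiffw w cw.
    have ZN : missed w = N by apply: full_Z => //; exists y.
    have jZ : j \in missed w by rewrite ZN.
    case/negP: (missed_noreach_stiff wA sw yK jZ).
    exact: connect_trans cji (block_connect iB (block_refl i) yM).
  rewrite cards0; have := NMge K1 K1N; have := NMge K2 K2N.
  by move: comp; rewrite LN; clear; lia.
rewrite negb_exists_in => /forall_inP Hn'.
have ciN j k : j \in M -> k \in B -> connect (arc x) j k.
  move=> jM; case/inB => [kM|kN]; first exact: block_connect iB jM kM.
  apply: connect_trans (block_connect iB jM (block_refl i)) _.
  by have := Hn k kN; rewrite (Hn' k kN) /= negbK.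
(* Added up, [SB] and [SN] give [18s <= 15(s - 1) + links [set c x] N], whereas these links number
   at most [8(s - 1) - 5s]. *)
have pt w : c w = c x -> w != x -> nsolos w N + #|solos w| + degs w B <= 15 + 0.
  move=> cw _; rewrite addn0; have [wA sw _] := stiffw w cw.
  have kK := card_solos_le w; have d8 := dle w; have kN := kle w N.
  have kM := kle w M; have ks := ksplit w; have ds := dsplit w.
  have [k4|k3] := leqP 4 #|solos w|; last by move: kK d8 ks k3; clear; lia.
  have ZM : missed w :&: M = set0.
    have [y yK] := nonuniversal_ex k4.
    apply/setP => j; rewrite in_set0; apply/setIP => -[jZ jM].
    by case/negP: (missed_noreach_stiff wA sw yK jZ); apply: ciN => //; apply: nonuniversal_B yK.
  have cMw := cM w cw ZM; have [u1 u2] := UM w; have cBw := cB w cw.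
  have := ZMN w; rewrite ZM cards0 add0n => ZE.
  have [k5|k5] := leqP 5 #|solos w|; last by move: kK d8 kN kM ks ds k4 k5 cMw u1 u2; clear; lia.
  have U1 := card_universal5 k5.
  have [z1|z2] := leqP #|missed w| 1.
    by move: kK d8 kN kM ks ds k5 cMw u1 u2 cBw U1 z1; clear; lia.
  have zle : #|missed w| <= 2 by rewrite ZE -n2 subset_leq_card // subsetIr.
  have ZN : missed w = N.
    apply/eqP; rewrite eqEcard n2 z2 andbT; apply/subsetP => j jZ.
    case: (inB j (missed_B jZ)) => // jM.
    have : j \in set0 by rewrite -ZM in_setI jZ.
    by rewrite in_set0.
  have kN0 : nsolos w N = 0.
    apply/eqP; rewrite -leqn0; apply: leq_trans kN _; rewrite leqn0 -ZN /degs.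
    by rewrite sum_nat_eq0; apply/forall_inP => j; rewrite [j \in missed w]in_set => /andP[].
  by move: kK d8 ks k5 cBw U1 zle; rewrite kN0; clear; lia.
have := root_sum (F := fun w => nsolos w N + #|solos w| + degs w B) (G := fun=> 0) (p := 15).
rewrite nsolos_root degs_root -nsolosB nsolos_root => /(_ erefl pt).
rewrite !sumD !big1_eq !sum_links.
have -> : \sum_(w | c w == c x) #|solos w| = \sum_(w | c w == c x) nsolos w B.
  by apply: eq_bigr => w _; rewrite nsolosB.
by move: SB SN LB LBle LMge s0; clear; lia.
Qed.

(** For [r >= 9] blocks of size 1 remain, and two of them with [A] make 3 classes, which the bound
    excludes. For [r = 8] the sizes 1 and 2 remain; pairs of blocks rule out 2, and [A] with three
    singletons makes the forbidden 4. *)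
Lemma acc_neq1 : False.
Proof.
have bE := b1.
have [|i iB] := ex_B; first by rewrite a1; apply: leq_trans r8.
have [r9|] := ltnP 8 r.
  have shape j : j \in B -> #|block j| = 1 \/ b <= #|block j|.+1.
    move=> jB; have [h1 h2] := block_bound jB; rewrite a1 in h2.
    have m0 := block_gt0 j; have mb := block_le jB; rewrite bE in mb *.
    move: m0 mb h1 h2 r9; clear; move: #|block j| => m m0 mb h1 h2 r9.
    have [m2|m1] := leqP 2 m; [right | by left; move: m0 m1; clear; lia].
    rewrite leqNgt; apply/negP => lt.
    have [p rE] : exists p, r = m + p + 3 by exists (r - m - 3); move: lt mb r9; clear; lia.
    move: h1 h2; have -> : r - m = p + 3 by rewrite rE; clear; lia.
    have -> : r - (1 + m) = p + 2 by rewrite rE; clear; lia.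
    rewrite rE in r9 *; case: p {rE} r9 => [|[|[|[|p]]]] r9; nia.
  have [m1|mb] := shape i iB; last by apply: (acc1_big_block iB) => //; move: mb; rewrite bE; move: r9; clear; lia.
  have [|j jB ji] := block_other iB; first by rewrite m1 bE; move: r9; clear; lia.
  have [m1'|mb] := shape j jB; last by apply: (acc1_big_block jB) => //; move: mb; rewrite bE; move: r9; clear; lia.
  by have [_] := block_bound2 iB jB ji; rewrite m1 m1' a1; move: r9; clear; lia.
move=> r8'; have rE : r = 8 by apply/eqP; rewrite eqn_leq r8'.
have b7 : b = 7 by rewrite bE rE.
have small j : j \in B -> #|block j| = 1 \/ #|block j| = 2.
  move=> jB; have H2 := acc1_block5 rE jB; have H1 := acc1_big_block jB; move: H1 H2.
  have [] := block_bound jB; have := block_le jB; have := block_gt0 j.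
  rewrite b7 a1; move: #|block j| => m; rewrite rE; clear -c => m0 m7 h1 h2 H1 H2.
  by case: m m0 m7 h1 h2 H1 H2 => [|[|[|[|[|[|[|[|m]]]]]]]] //; clear; lia.
have one j : j \in B -> block j = [set j].
  move=> jB; have [|k kB kj] := block_other jB; first by rewrite b7; case: (small j jB) => ->.
  apply/eqP; rewrite eq_sym eqEcard sub1set block_refl cards1.
  have [] := block_bound2 jB kB kj; rewrite a1 -addnA.
  by case: (small j jB) => ->; case: (small k kB) => -> //; move: rE; clear; lia.
have /card_geqP[q [uq sq qB]] : 3 <= b by rewrite b7.
case: q uq sq qB => [|j1 [|j2 [|j3 [|//]]]] //= /and3P[]; rewrite !inE negb_or => /andP[j12 j13] j23 _ _ qB.
have [jB1 jB2 jB3] : [/\ j1 \in B, j2 \in B & j3 \in B] by split; apply: qB; rewrite !inE eqxx ?orbT.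
have := saturated_bound (saturatedU (saturated_block (c x))
  (saturatedU (saturated_block j1) (saturatedU (saturated_block j2) (saturated_block j3)))).
rewrite block_root ?acc_root // !one //.
have dA (J : {set 'I_r}) : J \subset B -> [disjoint A & J].
  by move=> JB; apply: sets_disjoint => j jA; apply: contraTN jA => /(subsetP JB); rewrite in_setC.
rewrite card_disjointU ?dA ?subUset ?sub1set ?jB1 ?jB2 //.
rewrite cardsU1 cards2 j23 in_set2 negb_or j12 j13 a1.
by move: rE; clear; lia.
Qed.

End OneAccessible.

Lemma no_extremal : False.
Proof.
have a1 : a <> 1 by move/acc_neq1.
have a4 : a = 4.
  by move: a1 a_gt0 acc_le5 acc_neq2 acc_neq3 acc_neq5; clear; lia.
by have := a_bound; have := card_AB; rewrite a4; move: r8; clear; lia.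
Qed.

End Stuck.

(** * Equitable colorings of sparse graphs *)

Definition degree (T : finType) (e : rel T) v := #|[set u | e v u]|.

Lemma sparse_degree_le5 (T : finType) (e : rel T) (X : {set T}) :
  sparse e -> irreflexive e -> X != set0 -> (forall u v, u \in X -> e u v -> v \in X) ->
  exists2 v, v \in X & degree e v <= 5.
Proof.
move=> [sp _] e_irr /set0Pn[v0 v0X] clo; apply/exists_inP; apply: contraT.
rewrite negb_exists_in => /forall_inP H.
have big v : v \in X -> 6 <= #|[set u in X | e v u]|.
  move=> vX; apply: leq_trans (_ : degree e v <= _); first by rewrite ltnNge H.
  by apply/subset_leq_card/subsetP => u; rewrite !inE => evu; rewrite (clo v).
have X6 : 6 <= #|X|.
  by apply: leq_trans (big _ v0X) _; apply/subset_leq_card/subsetP => u /setIdP[].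
have := sp X (leq_trans _ X6) => /(_ isT).
have : #|X| * 6 <= edge_count e X X by rewrite -sum_nat_const; apply: leq_sum.
by clear; lia.
Qed.

Lemma balanced_function (T : finType) r s : #|T| = r * s -> exists c : {ffun T -> 'I_r}, balanced s c.
Proof.
move=> cT; have c2 : #|T| = #|{: 'I_r * 'I_s}| by rewrite card_prod !card_ord.
pose f v := enum_val (cast_ord c2 (enum_rank v)).
pose g p := enum_val (cast_ord (esym c2) (enum_rank p)).
have fK : cancel f g by move=> v; rewrite /f /g enum_valK cast_ordK enum_rankK.
have gK : cancel g f by move=> v; rewrite /f /g enum_valK cast_ordKV enum_rankK.
exists [ffun v => (f v).1]; apply/forallP => i; apply/eqP.
transitivity #|f @^-1: setX [set i] setT|.
  by apply: eq_card => v; rewrite !inE ffunE andbT.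
by rewrite on_card_preimset ?cardsX ?cards1 ?cardsT ?card_ord ?mul1n //; exists g => v _.
Qed.

Lemma balanced_coloring (T : finType) (e : rel T) r s : 8 <= r -> #|T| = r * s ->
  symmetric e -> irreflexive e -> sparse e -> (forall v, degree e v <= r) ->
  exists c : {ffun T -> 'I_r}, is_proper e c && balanced s c.
Proof.
move=> r8 cT; have [n] := ubnP (\sum_v degree e v); elim: n e => // n IH e en e_sym e_irr e_sp e_deg.
(* [x] is chosen among the nonisolated vertices, so that deleting its edges lowers the degree
   sum. *)
pose X := [set v | 0 < degree e v].
have [X0|Xn0] := eqVneq X set0.
  have [c bc] := balanced_function cT; exists c; rewrite bc andbT; apply/is_properP => u v euv.
  have : u \in X by rewrite inE; apply/card_gt0P; exists v; rewrite inE.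
  by rewrite X0 inE.
have clo u v : u \in X -> e u v -> v \in X.
  by move=> _ euv; rewrite inE; apply/card_gt0P; exists u; rewrite inE e_sym.
have [x xX x5] := sparse_degree_le5 e_sp e_irr Xn0 clo.
have dle v : degree (isolate e x) v <= degree e v.
  by apply/subset_leq_card/subsetP => u; rewrite !inE => /andP[].
have [|||||c0 gc0] := IH (isolate e x).
- move: en; rewrite ltnS; apply: leq_trans.
  rewrite (bigD1 x) //= [leqRHS](bigD1 x) //= -addSn.
  apply: leq_add; last by apply: leq_sum => v _.
  rewrite inE in xX; apply: leq_trans xX; rewrite ltnS leqn0; apply/eqP/eq_card0 => u.
  by rewrite inE isolatex.
- exact: isolate_sym.
- exact: isolate_irr.
- by apply: sparse_sub e_sp => u v; apply: isolateW.
- by move=> v; apply: leq_trans (dle v) (e_deg v).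
apply: contrapT => nex.
(* A good coloring in which [x] has no neighbor in its own class is proper for [e]. *)
have stuck (c : {ffun T -> 'I_r}) : good s e x c -> exists2 u, e x u & c u = c x.
  move=> /andP[/is_properP pc bc]; case: (pickP (fun u => e x u && (c u == c x))) => [u /andP[xu /eqP]|none].
    by exists u.
  case: nex; exists c; rewrite bc andbT; apply/is_properP => u v euv.
  have [ux|ux] := eqVneq u x; first by have := none v; rewrite -ux euv /= eq_sym => ->.
  have [vx|vx] := eqVneq v x; first by have := none u; rewrite -vx e_sym euv /= => ->.
  by apply: pc; rewrite /isolate /= euv ux vx.
pose G (c : {ffun T -> 'I_r}) := good s e x c.
have [c gc cmax] := @arg_maxnP _ c0 G (fun c => #|acc e x c|) gc0.
have [t] := ex_arc_tree x e_sym c.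
apply: (no_extremal e_sym e_irr e_sp e_deg x5 stuck gc cmax t r8).
have := max_card (pred1 x); rewrite card1 cT; clear; lia.
Qed.

Lemma sparse_inj (T U : finType) (e : rel T) (f : U -> T) : injective f -> sparse e -> sparse (relpre f e).
Proof.
move=> inj_f [s1 s2]; have ec X Y : edge_count (relpre f e) X Y = edge_count e (f @: X) (f @: Y).
  rewrite !edge_count_sum big_imset /=; last by move=> u v _ _ /inj_f.
  by apply: eq_bigr => u _; rewrite big_imset //= => v w _ _ /inj_f.
split=> [X X3|X Y d XY3]; first by rewrite ec -(card_imset _ inj_f); apply: s1; rewrite card_imset.
rewrite ec -(card_imset X inj_f) -(card_imset Y inj_f); apply: s2; last by rewrite !card_imset.
rewrite -setI_eq0 -imsetI; last by move=> u v _ _ /inj_f.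
by move: d; rewrite -setI_eq0 => /eqP->; rewrite imset0.
Qed.

(** * Adding a disjoint small clique *)

Section Padding.
Variables (T : finType) (e : rel T) (p : nat).
Hypotheses (e_irr : irreflexive e) (p4 : p <= 4).

Definition padded : rel (T + 'I_p) := fun u v =>
  match u, v with
  | inl u, inl v => e u v
  | inr i, inr j => i != j
  | _, _ => false
  end.

Definition lpart (X : {set T + 'I_p}) := inl @^-1: X.
Definition rpart (X : {set T + 'I_p}) := inr @^-1: X.

Lemma sum_parts (X : {set T + 'I_p}) (F : T + 'I_p -> nat) :
  \sum_(u in X) F u = \sum_(u in lpart X) F (inl u) + \sum_(u in rpart X) F (inr u).
Proof. by rewrite big_sumType; congr (_ + _); apply: eq_bigl => u; rewrite !inE. Qed.

Lemma card_parts (X : {set T + 'I_p}) : #|X| = #|lpart X| + #|rpart X|.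
Proof. by rewrite -!sum1_card sum_parts. Qed.

Lemma edge_count_padded (X Y : {set T + 'I_p}) : edge_count padded X Y = edge_count e (lpart X) (lpart Y) +
  edge_count (fun i j : 'I_p => i != j) (rpart X) (rpart Y).
Proof.
rewrite !edge_count_sum sum_parts; congr (_ + _); apply: eq_bigr => u _; rewrite sum_parts /=.
  by rewrite [X in _ + X]big1 ?addn0.
by rewrite big1 ?add0n.
Qed.

Lemma edge_count_small (X : {set T}) : #|X| <= 2 -> edge_count e X X <= #|X| * #|X|.-1.
Proof.
move=> X2; rewrite -sum_nat_const; apply: leq_sum => u uX.
rewrite (cardsD1 u X) uX; apply/subset_leq_card/subsetP => v /setIdP[vX euv].
by rewrite !inE vX andbT; apply: contraTneq euv => ->; rewrite e_irr.
Qed.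

Lemma edge_count_le_prod (X Y : {set T}) (e1 : rel T) : edge_count e1 X Y <= #|X| * #|Y|.
Proof.
rewrite -sum_nat_const; apply: leq_sum => u uX.
by apply/subset_leq_card/subsetP => v /setIdP[].
Qed.

Lemma edge_count_complete (X : {set 'I_p}) : edge_count (fun i j : 'I_p => i != j) X X = #|X| * #|X|.-1.
Proof.
rewrite -sum_nat_const; apply: eq_bigr => u uX.
by rewrite (cardsD1 u X) uX; apply: eq_card => v; rewrite !inE andbC eq_sym.
Qed.

Lemma edge_count_complete2 (X Y : {set 'I_p}) : edge_count (fun i j : 'I_p => i != j) X Y <= #|X| * #|Y|.
Proof.
rewrite -sum_nat_const; apply: leq_sum => u uX.
by apply/subset_leq_card/subsetP => v /setIdP[].
Qed.

(** 4 is the limit: K_4 attains the bound [6 * 4 = 12 + 12], and K_5 violates it. *)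
Lemma sparse_padded : sparse e -> sparse padded.
Proof.
move=> [s1 s2]; split=> [X|X Y d].
  rewrite edge_count_padded edge_count_complete card_parts.
  have r4 : #|rpart X| <= 4 by apply: leq_trans p4; rewrite -[leqRHS]card_ord max_card.
  have [l3|l2] := leqP 3 #|lpart X|.
    have := s1 _ l3; move: r4; move: #|rpart X| => k; case: k => [|[|[|[|[|]]]]] //=; clear; lia.
  have := edge_count_small l2; move: l2 r4; move: #|rpart X| #|lpart X| => k l.
  by case: k => [|[|[|[|[|]]]]] //=; case: l => [|[|[|]]] //=; clear; lia.
rewrite edge_count_padded !card_parts.
have dl : [disjoint lpart X & lpart Y].
  by rewrite -setI_eq0 -preimsetI; move: d; rewrite -setI_eq0 => /eqP->; rewrite preimset0.
have dr : [disjoint rpart X & rpart Y].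
  by rewrite -setI_eq0 -preimsetI; move: d; rewrite -setI_eq0 => /eqP->; rewrite preimset0.
have r4 : #|rpart X| + #|rpart Y| <= 4.
  by apply: leq_trans p4; rewrite -card_disjointU // -[leqRHS]card_ord max_card.
have := edge_count_complete2 (rpart X) (rpart Y).
have [l3|l2] := leqP 3 (#|lpart X| + #|lpart Y|).
  have := s2 _ _ dl l3; move: r4; move: #|rpart X| #|rpart Y| => k l.
  by case: k => [|[|[|[|[|k]]]]]; case: l => [|[|[|[|[|l]]]]] //=; clear; lia.
have := edge_count_le_prod (lpart X) (lpart Y) e; move: l2 r4.
move: #|rpart X| #|rpart Y| #|lpart X| #|lpart Y| => k l k' l'.
case: k' => [|[|[|k']]]; case: l' => [|[|[|l']]] //=;
  by case: k => [|[|[|[|[|k]]]]]; case: l => [|[|[|[|[|l]]]]] //=; clear; lia.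
Qed.

End Padding.
Definition class_size (T : finType) r (c : {ffun T -> 'I_r}) i := #|[set v | c v == i]|.

Lemma sum_class_size (T : finType) r (c : {ffun T -> 'I_r}) : \sum_i class_size c i = #|T|.
Proof.
rewrite -sum1_card (partition_big c predT) //=; apply: eq_bigr => i _.
by rewrite /class_size -sum1dep_card.
Qed.

(* The six small classes cannot all contain one of at most five neighbors. *)
Lemma small_class (T : finType) r s (c : {ffun T -> 'I_r}) (D : {set 'I_r}) : #|D| <= 5 ->
  (forall i, s <= (class_size c i).+1 /\ class_size c i <= s) -> #|T| + 6 <= r * s ->
  exists2 i, i \notin D & (class_size c i).+1 = s.
Proof.
move=> D5 H cT; case: (pickP (fun i => (i \notin D) && ((class_size c i).+1 == s))) => [i /andP[iD /eqP]|none].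
  by exists i.
have : r * s <= \sum_i (class_size c i + (i \in D)).
  rewrite -[r in r * s]card_ord -sum_nat_const; apply: leq_sum => i _.
  have [h1 h2] := H i; case: (boolP (i \in D)) => iD; first by rewrite addn1.
  by have := none i; rewrite iD addn0; move: h1 h2; clear; lia.
rewrite big_split /= sum_class_size.
have -> : \sum_(i : 'I_r) (i \in D) = #|D|.
  by rewrite -sum1_card [RHS]big_mkcond; apply: eq_bigr => i _; case: (i \in D).
by move: D5 cT; clear; lia.
Qed.

Lemma equitable_sizes (T : finType) (e : rel T) r s : 8 <= r -> symmetric e -> irreflexive e -> sparse e ->
  (forall v, degree e v <= r) -> #|T| <= r * s <= #|T| + r ->
  exists c : {ffun T -> 'I_r}, is_proper e c /\
    forall i, s <= (class_size c i).+1 /\ class_size c i <= s.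
Proof.
move=> r8; have [n] := ubnP #|T|; elim: n T e s => // n IH T e s nT e_sym e_irr e_sp e_deg /andP[le1 le2].
have exact_case s' : #|T| = r * s' -> s' = s \/ s'.+1 = s -> exists c : {ffun T -> 'I_r}, is_proper e c /\
    forall i, s <= (class_size c i).+1 /\ class_size c i <= s.
  move=> cT ss; have [c /andP[pc /forallP bc]] := balanced_coloring r8 cT e_sym e_irr e_sp e_deg.
  by exists c; split=> // i; rewrite /class_size (eqP (bc i)); case: ss => <-; rewrite leqnSn.
have [p0|p0] := eqVneq #|T| (r * s); first by apply: (exact_case s) => //; left.
(* All classes get size [s - 1] here. Deleting a vertex in this case would break
   [r * s <= #|T| + r]. *)
have [pr|pr] := eqVneq (#|T| + r) (r * s).
  case: s pr {p0 le1 le2} exact_case => [|s] pr exact_case; first by move: pr r8; clear; lia.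
  by apply: (exact_case s); [move: pr; rewrite mulnS; clear; lia | right].
pose p := r * s - #|T|; have pE : #|T| + p = r * s by rewrite subnKC.
have [p4|p5] := leqP p 4.
  have cT : #|{: T + 'I_p}| = r * s by rewrite card_sum card_ord.
  have [||v|c /andP[/is_properP pc /forallP bc]] := balanced_coloring (e := padded e (p := p)) r8 cT _ _ (sparse_padded e_irr p4 e_sp).
  - by move=> [u|i] [v|j] //=; rewrite eq_sym.
  - by move=> [u|i] //=; rewrite eqxx.
  - case: v => [v|i].
      apply: leq_trans (e_deg v); rewrite /degree -(card_imset _ (@inl_inj T 'I_p)); apply/subset_leq_card/subsetP => -[u|j].
        by rewrite inE /= => evu; apply: imset_f; rewrite inE.
      by rewrite inE.
    apply: leq_trans (_ : 4 <= _); last by apply: leq_trans r8.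
    apply: leq_trans p4; apply: leq_trans (_ : #|(@inr T 'I_p) @: [set: 'I_p]| <= _).
      2: by rewrite card_imset ?cardsT ?card_ord //; apply: inr_inj.
    by apply/subset_leq_card/subsetP => -[u|j]; rewrite inE //= => _; apply: imset_f.
  exists [ffun v => c (inl v)]; split; first by apply/is_properP => u v euv; rewrite !ffunE; apply: pc.
  move=> i; have := eqP (bc i).
  have -> : #|[set v | c v == i]| = class_size [ffun v => c (inl v)] i + #|[set j : 'I_p | c (inr j) == i]|.
    rewrite card_parts; congr (_ + _); apply: eq_card => u; rewrite !inE ?ffunE //.
  (* Clique vertices have different colors, so dropping them costs a class at most one vertex. *)
  have : #|[set j : 'I_p | c (inr j) == i]| <= 1.
    apply/card_le1_eqP => j k; rewrite !inE => /eqP cj /eqP ck; apply/eqP; apply: contraT => jk.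
    by have := pc (inr k) (inr j) jk; rewrite cj ck eqxx.
  by clear; lia.
have T0 : [set: T] != set0.
  rewrite -card_gt0 cardsT lt0n; apply: contraNneq pr => cT0.
  move: le1 le2 p5 p0; rewrite /p cT0 add0n; case: (s) => [|[|s1]] //; rewrite ?muln0 ?muln1 ?eqxx // => _ le2 _ _.
  by exfalso; move: le2 r8; rewrite !mulnS; clear; lia.
have [|v _ v5] := sparse_degree_le5 e_sp e_irr T0; first by move=> u w _ _; rewrite inE.
pose U := {u | u != v}; have cU : #|{: U}|.+1 = #|T|.
  rewrite card_sig -[RHS](cardC (pred1 v)) card1 add1n; congr _.+1; exact: eq_card.
have [||||||c [/is_properP pc sz]] := IH U (relpre val e) s.
- by move: nT; rewrite -cU.
- by move=> u w; apply: e_sym.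
- by move=> u; apply: e_irr.
- exact: sparse_inj val_inj e_sp.
- move=> u; apply: leq_trans (e_deg (val u)); rewrite /degree -(card_imset _ val_inj).
  by apply/subset_leq_card/subsetP => w /imsetP[w' + ->]; rewrite !inE.
- rewrite -cU addSn in le1 le2 pr *; move: le1 le2 pr => le1 le2 pr.
  by rewrite (ltnW le1) -ltnS ltn_neqAle eq_sym pr.
pose D := c @: [set u : U | e v (val u)].
have D5 : #|D| <= 5.
  apply: leq_trans (leq_imset_card _ _) (leq_trans _ v5); rewrite -(card_imset _ val_inj).
  by apply/subset_leq_card/subsetP => w /imsetP[w' + ->]; rewrite !inE.
have [|k kD ks] := small_class D5 sz; first by rewrite -pE -cU addSnnS leq_add2l ltnS.
pose f u : 'I_r := if insub u is Some u' then c u' else k.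
have fv : f v = k by rewrite /f insubF ?eqxx.
have fU (u : U) : f (val u) = c u by rewrite /f valK.
have vU u : u != v -> exists u' : U, u = val u' by move=> uv; exists (Sub u uv); rewrite SubK.
exists [ffun u => f u]; split.
  have key w : e v w -> f v != f w.
    move=> evw; have [|w' wE] := vU w; first by apply: contraTneq evw => ->; rewrite e_irr.
    rewrite fv wE fU; apply: contraNneq kD => ->; apply: imset_f; by rewrite inE -wE.
  apply/is_properP => u w euw; rewrite !ffunE.
  have [uv|uv] := eqVneq u v; first by rewrite uv; apply: key; rewrite -uv.
  have [wv|wv] := eqVneq w v; first by rewrite wv eq_sym; apply: key; rewrite -wv e_sym.
  have [[u' uE] [w' wE]] := (vU u uv, vU w wv); rewrite uE wE !fU; apply: pc.
  by rewrite /= -uE -wE.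
move=> i; have [h1 h2] := sz i.
have -> : class_size [ffun u => f u] i = class_size c i + (i == k).
  rewrite /class_size (cardsD1 v) inE ffunE fv addnC eq_sym; congr (_ + _).
  rewrite -(card_imset [set u | c u == i] val_inj); apply: eq_card => u; rewrite !inE ffunE.
  apply/andP/imsetP => [[uv fu]|[u' + ->]]; last by rewrite inE fU (valP u').
  by have [u' uE] := vU u uv; exists u'; rewrite // inE -fU -uE.
by case: eqP => [->|_]; rewrite ?addn0 // addn1 ks; split.
Qed.

Import Order.TTheory GRing.Theory Num.Theory.
Import numFieldNormedType.Exports.

(** * Euler's bound, by linear algebra over F_2 *)

Section Faces.
Local Open Scope ring_scope.
Variables (V Ed Fc : finType) (X : {set V}) (e1 e2 : Ed -> V) (l r : Ed -> Fc).
Hypotheses (e1X : forall E, e1 E \in X) (e2X : forall E, e2 E \in X) (e12 : forall E, e1 E != e2 E).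

Definition inc u E : 'F_2 := (e1 E == u)%:R + (e2 E == u)%:R.

Definition side f E : 'F_2 := (l E == f)%:R + (r E == f)%:R.

(** All of the topology is in this and the next hypothesis: face boundaries are cycles, and every
    cycle is a sum of face boundaries, [S] being the set of faces summed. *)
Hypothesis side_even : forall f u, \sum_E side f E * inc u E = 0.
Hypothesis potential : forall z : Ed -> 'F_2, (forall u, \sum_E z E * inc u E = 0) ->
  exists S : Fc -> 'F_2, forall E, z E = S (l E) + S (r E).

Lemma F2_addrr (a : 'F_2) : a + a = 0.
Proof. by apply: addrr_pchar2; apply: pchar_Fp. Qed.

Definition bdry f := [set E | (l E == f) != (r E == f)].
(** In the application [Fc] consists of all squares of the grid, of which only class representatives
    next to an edge are genuine faces. *)
Definition faces := [set f | bdry f != set0].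

Lemma sideE f E : side f E = (E \in bdry f)%:R.
Proof. by rewrite /side inE; case: (l E == f); case: (r E == f); rewrite ?F2_addrr ?addr0 ?add0r. Qed.

Lemma sum_side E : \sum_(f in faces) side f E = 0.
Proof.
transitivity (\sum_f side f E).
  rewrite [LHS]big_mkcond /=; apply: eq_bigr => f _; case: ifP => // /negbT.
  by rewrite inE negbK sideE => /eqP->; rewrite inE.
have one (g : Ed -> Fc) : \sum_f (g E == f)%:R = 1 :> 'F_2.
  by rewrite (bigD1 (g E)) //= eqxx big1 ?addr0 // => f /negPf; rewrite eq_sym => ->.
by rewrite big_split /= !one F2_addrr.
Qed.

Let m := #|Ed|. Let n := #|X|. Let p := #|faces|.
Let D : 'M['F_2]_(m, n) := \matrix_(i, j) inc (enum_val j) (enum_val i).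
Let B : 'M['F_2]_(p, m) := \matrix_(k, i) side (enum_val k) (enum_val i).

Lemma rank_nonfull a b (M : 'M['F_2]_(a, b)) (w : 'cV['F_2]_b) : w != 0 -> M *m w = 0 -> (\rank M < b)%N.
Proof.
move=> w0 Mw; rewrite ltn_neqAle rank_leq_col andbT; apply: contraNneq w0 => rM.
have full : row_full M by rewrite /row_full rM.
have /submxP[N NE] := submx_full 1%:M full.
by rewrite -[w]mul1mx NE -mulmxA Mw mulmx0.
Qed.

Lemma rank_D : X != set0 -> (\rank D < n)%N.
Proof.
case/set0Pn => v0 v0X.
apply: (rank_nonfull (w := const_mx 1)).
  apply/eqP => /colP/(_ (enum_rank_in v0X v0)); rewrite !mxE => /eqP.
  by rewrite oner_eq0.
apply/colP => i; rewrite !mxE.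
have one (g : Ed -> V) : (forall E, g E \in X) -> \sum_(j < n) (g (enum_val i) == enum_val j)%:R = 1 :> 'F_2.
  move=> gX; transitivity (\sum_(u in X) (g (enum_val i) == u)%:R : 'F_2); first by rewrite [RHS]big_enum_val.
  rewrite (bigD1 (g (enum_val i))) //= eqxx big1 ?addr0 // => u /andP[_ /negPf].
  by rewrite eq_sym => ->.
transitivity (\sum_(j < n) (inc (enum_val j) (enum_val i))).
  by apply: eq_bigr => j _; rewrite !mxE mulr1.
by rewrite big_split /= !one // F2_addrr.
Qed.

Lemma rank_B : faces != set0 -> (\rank B < p)%N.
Proof.
case/set0Pn => f0 f0F; rewrite -mxrank_tr.
apply: (rank_nonfull (w := const_mx 1)).
  apply/eqP => /colP/(_ (enum_rank_in f0F f0)); rewrite !mxE => /eqP.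
  by rewrite oner_eq0.
apply/colP => i; rewrite !mxE -[RHS](sum_side (enum_val i)) [RHS]big_enum_val.
by apply: eq_bigr => j _; rewrite !mxE mulr1.
Qed.

Lemma ker_D_sub : (kermx D <= B)%MS.
Proof.
apply/row_subP => i; set z := row i _.
have zD : z *m D = 0 by apply/sub_kermxP; apply: row_sub.
pose zE E := z 0 (enum_rank E).
have zinc u : \sum_E zE E * inc u E = 0.
  have [uX|uX] := boolP (u \in X); last first.
    rewrite big1 // => E _; rewrite /inc !(negPf (contraNneq _ uX)) ?addr0 ?mulr0 // => <-; [exact: e2X | exact: e1X].
  transitivity ((z *m D) 0 (enum_rank_in uX u)); last by rewrite zD mxE.
  rewrite [RHS]mxE (reindex (fun j : 'I_m => enum_val j)) /=; last first.
    by exists enum_rank => j _; rewrite ?enum_valK ?enum_rankK.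
  by apply: eq_bigr => j _; rewrite /zE enum_valK [D _ _]mxE enum_rankK_in.
have [S SE] := potential zinc.
apply/submxP; exists (\row_k S (enum_val k)).
apply/rowP => j; rewrite [RHS]mxE.
transitivity (zE (enum_val j)); first by rewrite /zE enum_valK.
rewrite SE; transitivity (\sum_(f in faces) S f * side f (enum_val j)); last first.
  by rewrite [LHS]big_enum_val; apply: eq_bigr => k _; rewrite mxE [B _ _]mxE.
transitivity (\sum_f S f * side f (enum_val j)).
  have one (g : Ed -> Fc) E : \sum_f S f * (g E == f)%:R = S (g E).
    rewrite (bigD1 (g E)) //= eqxx mulr1 big1 ?addr0 // => f /negPf; rewrite eq_sym => ->.
    by rewrite mulr0.
  by under eq_bigr do rewrite /side mulrDr; rewrite big_split /= !one.
rewrite [RHS]big_mkcond /=; apply: eq_bigr => f _; case: ifP => // /negbT.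
by rewrite inE negbK sideE => /eqP->; rewrite inE mulr0.
Qed.

(** The cycle space has dimension at least [m - n + 1], since the rows of [D] sum to 0 over the
    vertices, and it lies in the span of the face boundaries, of dimension at most [p - 1], since
    these sum to 0 as well. *)
Lemma euler_bound : X != set0 ->
  (#|Ed| + 2 <= #|X| + #|faces| \/ faces = set0 /\ #|Ed| + 1 <= #|X|)%N.
Proof.
move=> X0; have := mxrankS ker_D_sub; rewrite mxrank_ker; have := rank_D X0.
have [f0|f0] := eqVneq faces set0.
  have : (\rank B <= p)%N by apply: rank_leq_row.
  have p0 : p = 0%N by rewrite /p f0 cards0.
  by move: p0; rewrite -/m -/n => p0 h1 h2 h3; right; split=> //; lia.
by have := rank_B f0; rewrite -/m -/n -/p; left; lia.
Qed.

Lemma card_bdry : (\sum_(f in faces) #|bdry f| <= 2 * #|Ed|)%N.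
Proof.
have -> : (\sum_(f in faces) #|bdry f| = \sum_(f in faces) \sum_E (E \in bdry f))%N.
  by apply: eq_bigr => f _; rewrite -sum1_card big_mkcond; apply: eq_bigr => E _; case: (E \in _).
rewrite exchange_big /= mulnC -sum_nat_const; apply: leq_sum => E _.
apply: leq_trans (_ : \sum_f ((l E == f) + (r E == f)) <= _)%N.
  rewrite big_mkcond; apply: leq_sum => f _; case: ifP => // _; rewrite inE.
  by case: (l E == f); case: (r E == f).
have one (g : Ed -> Fc) : (\sum_f (g E == f) = 1)%N.
  by rewrite (bigD1 (g E)) //= eqxx big1 ?addn0 // => f /negPf; rewrite eq_sym => ->.
by rewrite big_split /= !one.
Qed.

Lemma euler_count g : (2 <= g)%N -> (3 <= #|X|)%N -> (forall f, bdry f != set0 -> (g <= #|bdry f|)%N) ->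
  (g * (#|Ed| + 2) <= g * #|X| + 2 * #|Ed| \/ #|Ed| + 1 <= #|X|)%N.
Proof.
move=> g2 X3 H; have X0 : X != set0 by rewrite -card_gt0; apply: leq_trans X3.
case: (euler_bound X0) => [le|[_]]; [left | by right].
have : (#|faces| * g <= 2 * #|Ed|)%N.
  by rewrite -sum_nat_const; apply: leq_trans card_bdry; apply: leq_sum => f; rewrite inE => /H.
by nia.
Qed.

Hypothesis simple : forall E E', [set e1 E; e2 E] = [set e1 E'; e2 E'] -> E = E'.

Lemma even_bdry f u E : E \in bdry f -> u \in [set e1 E; e2 E] ->
  exists2 E', E' \in bdry f :\ E & u \in [set e1 E'; e2 E'].
Proof.
move=> Ef uE; apply/exists_inP; apply: contraT; rewrite negb_exists_in => /forall_inP H.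
have := side_even f u; rewrite (bigD1 E) //= big1 ?addr0 => [|E' E'E]; last first.
  rewrite sideE; case: (boolP (E' \in bdry f)) => E'f; last by rewrite mul0r.
  have := H E'; rewrite in_setD1 E'E E'f in_set2 negb_or => /(_ isT)/andP[n1 n2].
  by rewrite /inc ![_ == u]eq_sym (negPf n1) (negPf n2) addr0 mulr0.
rewrite sideE Ef mul1r /inc; have := e12 E.
by case/set2P: uE => -> ne; rewrite eqxx ?[e2 E == _]eq_sym (negPf ne) ?addr0 ?add0r => /eqP; rewrite oner_eq0.
Qed.

(** Degrees in a boundary are even, so each end of an edge lies on another boundary edge; by
    simplicity these two are distinct. *)
Lemma girth3 f : bdry f != set0 -> (3 <= #|bdry f|)%N.
Proof.
case/set0Pn => E Ef.
have [E1 /setD1P[E1E E1f] u1] := even_bdry Ef (set21 _ _).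
have [E2 /setD1P[E2E E2f] u2] := even_bdry Ef (set22 _ _).
have E12 : E1 != E2.
  apply: contraNneq E1E => E12; apply/eqP/simple/eqP; rewrite eq_sym eqEcard subUset !sub1set u1 E12 u2 /=.
  by rewrite !cards2 !e12.
have <- : #|E |: [set E1; E2]| = 3%N.
  by rewrite cardsU1 cards2 in_set2 negb_or ![E == _]eq_sym E1E E12 E2E.
by apply/subset_leq_card/subsetP => E'; rewrite in_setU1 in_set2 => /or3P[] /eqP->.
Qed.

(** Each edge has exactly one end in [X1], so the even degrees over [X1] add up to the number of
    boundary edges, which is therefore even. *)
Lemma girth4 (X1 : {set V}) f : (forall E, (e1 E \in X1) != (e2 E \in X1)) -> bdry f != set0 -> (4 <= #|bdry f|)%N.
Proof.
move=> H f0; have := girth3 f0; suff : ~~ odd #|bdry f| by case: #|bdry f| => [|[|[|[|k]]]].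
have : \sum_(u in X1) \sum_E side f E * inc u E = 0 by rewrite big1.
rewrite exchange_big /= => s0.
have : (#|bdry f|)%:R = 0 :> 'F_2.
  rewrite -s0 -sum1_card natr_sum big_mkcond /=; apply: eq_bigr => E _.
  rewrite -big_distrr /= sideE.
  have one v : \sum_(u in X1) (v == u)%:R = (v \in X1)%:R :> 'F_2.
    rewrite big_mkcond (bigD1 v) //= eqxx big1 ?addr0 => [|u /negPf uv]; first by case: ifP.
    by rewrite eq_sym uv; case: ifP.
  rewrite big_split /= !one; have := H E.
  by case: (e1 E \in X1); case: (e2 E \in X1) => // _; rewrite ?addr0 ?add0r mulr1; case: (E \in _).
move/(congr1 val); rewrite /= val_Fp_nat // modn2 => /eqP; by rewrite eqb0.
Qed.

End Faces.
(** * Graphs drawn on a grid *)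

Section Grid.
Local Open Scope ring_scope.
Variables (V Ed : finType) (N : nat) (label : nat -> nat -> option V).
Hypothesis label_bound : forall i j, label i j != None -> (0 < i <= N)%N && (0 < j <= N)%N.

Definition next_label (b : bool) i j := if b then label i j.+1 else label i.+1 j.

Variables (e1 e2 : Ed -> V) (gb : Ed -> bool) (gi gj : Ed -> nat).
Hypotheses (label1 : forall E, label (gi E) (gj E) = Some (e1 E))
  (label2 : forall E, next_label (gb E) (gi E) (gj E) = Some (e2 E)).
Hypothesis e12 : forall E, e1 E != e2 E.
Hypothesis simple : forall E E', [set e1 E; e2 E] = [set e1 E'; e2 E'] -> E = E'.

(* [z false i j] is the coefficient of the edge from cell [(i, j)] to [(i+1, j)], and [z true i j]
   that of the edge from [(i, j)] to [(i, j+1)]; [bd z i j] is the boundary at cell [(i+1, j+1)]. *)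
Definition bd (z : bool -> nat -> nat -> 'F_2) i j :=
  z false i.+1 j.+1 + z false i j.+1 + (z true i.+1 j.+1 + z true i.+1 j).

Definition inside u (z : bool -> nat -> nat -> 'F_2) :=
  forall b i j, z b i j != 0 -> label i j = Some u /\ next_label b i j = Some u.

Variable center : V -> nat * nat.
(** Connectedness of a branch set in homological form: a chain inside it joins each of its cells to
    the center. *)
Hypothesis connected : forall i j u, label i j = Some u -> exists2 z, inside u z &
  forall i' j', bd z i' j' = ((i'.+1, j'.+1) == (i, j))%:R + ((i'.+1, j'.+1) == center u)%:R.

Definition used b i j := ((label i j != None) && (label i j == next_label b i j)) ||
  [exists E, (gb E, gi E, gj E) == (b, i, j)].

Definition square := ('I_N.+2 * 'I_N.+2)%type.
Definition sq i j : square := (inord i, inord j).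
(** [sq i j] has the cells [(i, j)] and [(i+1, j+1)] as opposite corners, and [sq'] lies across the
    grid edge [(b, i, j)]. At the border index 0, where no cell is labelled, the two coincide. *)
Definition sq' (b : bool) i j := if b then sq i.-1 j else sq i j.-1.

Definition facing (s t : square) := [exists b : bool, exists i : 'I_N.+2, exists j : 'I_N.+2,
  [&& ~~ used b i j, s == sq i j & t == sq' b i j]].
Definition joined : rel square := fun s t => facing s t || facing t s.

Lemma joined_sym : connect_sym joined.
Proof. by apply: sym_connect_sym => s t; rewrite /joined orbC. Qed.

Definition face (s : square) := fingraph.root joined s.

Lemma face_unused b i j : (i < N.+2)%N -> (j < N.+2)%N -> ~~ used b i j -> face (sq i j) = face (sq' b i j).
Proof.
move=> hi hj nu; apply/eqP; rewrite /face root_connect; last exact: joined_sym.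
apply: connect1; apply/orP; left; apply/existsP; exists b; apply/existsP; exists (Ordinal hi).
by apply/existsP; exists (Ordinal hj); rewrite nu !eqxx.
Qed.

Lemma gedge_bound E : (gi E < N.+1)%N /\ (gj E < N.+1)%N.
Proof.
have : label (gi E) (gj E) != None by rewrite label1.
by case/label_bound/andP => /andP[_ h1] /andP[_ h2].
Qed.

Definition gleft E := face (sq (gi E) (gj E)).
Definition gright E := face (sq' (gb E) (gi E) (gj E)).

Lemma gedge_inj E E' : (gb E, gi E, gj E) = (gb E', gi E', gj E') -> E = E'.
Proof.
case=> Eb Ei Ej; apply: simple; have [h1 h2] := (label1 E, label2 E).
by rewrite Eb Ei Ej label1 label2 in h1 h2; case: h1 => ->; case: h2 => ->.
Qed.

Lemma shift_sum M (f h : nat -> 'F_2) : h 0%N = 0 -> h M = 0 ->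
  \sum_(i < M) f i * h i.+1 = \sum_(i < M) f i.-1 * h i.
Proof.
case: M => [|M] h0 hM; first by rewrite !big_ord0.
by rewrite big_ord_recr /= hM mulr0 addr0 [RHS]big_ord_recl /= h0 mulr0 add0r.
Qed.

Lemma grid_side_even f u : \sum_E side gleft gright f E * inc e1 e2 u E = 0.
Proof.
pose M := N.+2; pose sg i j : 'F_2 := (face (sq i j) == f)%:R.
pose w (b : bool) i j : 'F_2 := sg i j + if b then sg i.-1 j else sg i j.-1.
pose ch i j : 'F_2 := (label i j == Some u)%:R.
pose F (g : bool * ('I_M * 'I_M)) : 'F_2 := w g.1 g.2.1 g.2.2 *
  (ch g.2.1 g.2.2 + (next_label g.1 g.2.1 g.2.2 == Some u)%:R).
pose gE E : bool * ('I_M * 'I_M) := (gb E, (inord (gi E), inord (gj E))).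
have gEi E : nat_of_ord (gE E).2.1 = gi E by rewrite /= inordK // ltnW // ltnS; case: (gedge_bound E).
have gEj E : nat_of_ord (gE E).2.2 = gj E by rewrite /= inordK // ltnW // ltnS; case: (gedge_bound E).
have gE_inj : injective gE.
  by move=> E E' EE; apply: gedge_inj; rewrite -!gEi -!gEj EE; case: EE => ->.
have -> : \sum_E side gleft gright f E * inc e1 e2 u E = \sum_g F g.
  rewrite [RHS](bigID (mem (gE @: setT))) /= [X in _ + X]big1 ?addr0.
    rewrite big_imset; last by move=> E E' _ _; apply: gE_inj.
    apply: eq_big => [E|E _]; first by rewrite inE.
    rewrite /F gEi gEj /ch label1 label2 /inc /side /w /sg /gleft /gright /sq' /=.
    by congr (_ * (_ + _)); case: (gb E).
  move=> [b [i j]] ng; rewrite /F /=; have [us|nu] := boolP (used b i j); last first.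
    by rewrite /w /sg (face_unused _ _ nu) // /sq'; case: (b); rewrite F2_addrr mul0r.
  case/orP: us => [/andP[_ /eqP lE]|/existsP[E /eqP EE]]; first by rewrite /ch lE F2_addrr mulr0.
  case/imsetP: ng; exists E => //; rewrite /gE; case: EE => -> -> ->.
  by rewrite !inord_val.
have label0 i j : (i == 0)%N || (j == 0)%N || (N < i)%N || (N < j)%N -> ch i j = 0.
  rewrite /ch; case lE : (label i j) => [v|] //.
  have : label i j != None by rewrite lE.
  by move/label_bound; case: i {lE} => [|i]; case: j => [|j] //; lia.
have -> : \sum_g F g = \sum_(b : bool) \sum_(i < M) \sum_(j < M) F (b, (i, j)).
  transitivity (\sum_(b : bool) \sum_(ij : 'I_M * 'I_M) F (b, ij)).
    by rewrite pair_bigA; apply: eq_bigr => -[b ij].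
  by apply: eq_bigr => b _; rewrite pair_bigA; apply: eq_bigr => -[i j].
rewrite big_bool /= -big_split /=.
have -> : \sum_(i < M) (\sum_(j < M) F (true, (i, j)) + \sum_(j < M) F (false, (i, j))) =
  \sum_(i < M) \sum_(j < M) (w true i j + w true i j.-1 + (w false i j + w false i.-1 j)) * ch i j.
  transitivity (\sum_(i < M) \sum_(j < M) (w true i j * ch i j) + \sum_(i < M) \sum_(j < M) w true i j * ch i j.+1
    + (\sum_(i < M) \sum_(j < M) (w false i j * ch i j) + \sum_(i < M) \sum_(j < M) w false i j * ch i.+1 j)).
    rewrite -!big_split /=; apply: eq_bigr => i _; rewrite -!big_split /=; apply: eq_bigr => j _.
    by rewrite /F /= !mulrDr.
  have -> : \sum_(i < M) \sum_(j < M) w true i j * ch i j.+1 = \sum_(i < M) \sum_(j < M) w true i j.-1 * ch i j.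
    apply: eq_bigr => i _; apply: (shift_sum (fun j => w true i j)); apply: label0; rewrite ?eqxx ?orbT //.
    by rewrite (ltnW (ltnSn N.+1)) !orbT.
  have -> : \sum_(i < M) \sum_(j < M) w false i j * ch i.+1 j = \sum_(i < M) \sum_(j < M) w false i.-1 j * ch i j.
    rewrite exchange_big [RHS]exchange_big /=; apply: eq_bigr => j _.
    apply: (shift_sum (fun i => w false i j) (h := fun i => ch i j)); apply: label0; rewrite ?eqxx ?orbT //.
    by rewrite (ltnW (ltnSn N.+1)) !orbT.
  rewrite -!big_split /=; apply: eq_bigr => i _; rewrite -!big_split /=; apply: eq_bigr => j _.
  by rewrite !mulrDl.
rewrite big1 // => i _; rewrite big1 // => j _.
have [/label0->|] := boolP ((i == 0 :> nat)%N || (j == 0 :> nat)%N || (N < i)%N || (N < j)%N); first by rewrite mulr0.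
rewrite !negb_or => /andP[/andP[/andP[i0 j0] _] _].
have -> : w true i j + w true i j.-1 + (w false i j + w false i.-1 j) = 0; last by rewrite mul0r.
rewrite /w; case: (i : nat) i0 => // i' _; case: (j : nat) j0 => // j' _ /=.
move: (sg _ _) (sg _ _) (sg _ _) (sg _ _) => a1 a2 a3 a4.
by move: a1 a2 a3 a4; do 4! (case; case=> [|[|//]] ?); apply/val_inj.
Qed.

Definition unit_chain E : bool -> nat -> nat -> 'F_2 := fun b i j => ((b, i, j) == (gb E, gi E, gj E))%:R.

Definition gtgt E := if gb E then (gi E, (gj E).+1) else ((gi E).+1, gj E).

Lemma bd_unit E i j : bd (unit_chain E) i j =
  ((i.+1, j.+1) == (gi E, gj E))%:R + ((i.+1, j.+1) == gtgt E)%:R.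
Proof.
rewrite /bd /unit_chain /gtgt !xpair_eqE; case: (gb E); rewrite /= !xpair_eqE ?eqSS ?add0r ?addr0 //.
Qed.

Lemma label_gtgt E : label (gtgt E).1 (gtgt E).2 = Some (e2 E).
Proof. by rewrite -(label2 E) /gtgt /next_label; case: (gb E). Qed.

Lemma bd_sum (I : finType) (a : I -> 'F_2) (z : I -> bool -> nat -> nat -> 'F_2) i j :
  bd (fun b i j => \sum_k a k * z k b i j) i j = \sum_k a k * bd (z k) i j.
Proof. by rewrite /bd -!big_split /=; apply: eq_bigr => k _; rewrite !mulrDr. Qed.

Lemma grid_potential (z : Ed -> 'F_2) : (forall u, \sum_E z E * inc e1 e2 u E = 0) ->
  exists S : square -> 'F_2, forall E, z E = S (gleft E) + S (gright E).
Proof.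
move=> z0.
have [ph1 ph1P] : exists ph, forall E, inside (e1 E) (ph E) /\ forall i j, bd (ph E) i j =
    ((i.+1, j.+1) == (gi E, gj E))%:R + ((i.+1, j.+1) == center (e1 E))%:R.
  have [ph] := fin_all_exists (fun E => let: ex_intro2 p h1 h2 := connected (label1 E) in ex_intro _ p (conj h1 h2)).
  by exists ph.
have [ph2 ph2P] : exists ph, forall E, inside (e2 E) (ph E) /\ forall i j, bd (ph E) i j =
    ((i.+1, j.+1) == ((gtgt E).1, (gtgt E).2))%:R + ((i.+1, j.+1) == center (e2 E))%:R.
  have [ph] := fin_all_exists (fun E => let: ex_intro2 p h1 h2 := connected (label_gtgt E) in ex_intro _ p (conj h1 h2)).
  by exists ph.
pose Z b i j : 'F_2 := \sum_E z E * (unit_chain E b i j + ph1 E b i j + ph2 E b i j).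
have bdZ i j : bd Z i j = 0.
  rewrite bd_sum; transitivity (\sum_E z E * \sum_u ((i.+1, j.+1) == center u)%:R * inc e1 e2 u E).
    apply: eq_bigr => E _; congr (_ * _).
    have -> : bd (fun b i j => unit_chain E b i j + ph1 E b i j + ph2 E b i j) i j =
        bd (unit_chain E) i j + bd (ph1 E) i j + bd (ph2 E) i j.
      by rewrite /bd !addrA; ring.
    rewrite bd_unit (ph1P E).2 (ph2P E).2 -surjective_pairing.
    have one (g : V) : \sum_u ((i.+1, j.+1) == center u)%:R * (g == u)%:R = ((i.+1, j.+1) == center g)%:R :> 'F_2.
      rewrite (bigD1 g) //= eqxx mulr1 big1 ?addr0 // => u /negPf; rewrite eq_sym => ->.
      by rewrite mulr0.
    under [RHS]eq_bigr do rewrite /inc mulrDr; rewrite big_split /= !one.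
    move: (_ == (gi E, gj E)) (_ == gtgt E) (_ == center (e1 E)) (_ == center (e2 E)).
    by do 4! case; apply/val_inj.
  under eq_bigr do rewrite mulr_sumr; rewrite exchange_big big1 // => u _.
  by under eq_bigr do rewrite mulrCA; rewrite -mulr_sumr z0 mulr0.
have unit0 E b i j : unit_chain E b i j != 0 -> (b, i, j) = (gb E, gi E, gj E).
  by rewrite /unit_chain; case: ((b, i, j) =P _).
have Zused b i j : ~~ used b i j -> Z b i j = 0.
  rewrite negb_or negb_exists => /andP[nl /forallP nE]; rewrite /Z big1 // => E _.
  have nin u p : inside u p -> p b i j = 0.
    move=> ip; apply/eqP; apply: contraT => /ip[l1 l2]; by move: nl; rewrite l1 l2 eqxx.
  rewrite (nin _ _ (ph1P E).1) (nin _ _ (ph2P E).1) !addr0 /unit_chain eq_sym.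
  by rewrite (negPf (nE E)) mulr0.
have Zlabel b i j : label i j = None -> Z b i j = 0.
  move=> li; rewrite /Z big1 // => E _.
  have nin u p : inside u p -> p b i j = 0.
    by move=> ip; apply/eqP; apply: contraT => /ip[]; rewrite li.
  rewrite (nin _ _ (ph1P E).1) (nin _ _ (ph2P E).1) !addr0.
  have [->|/eqP] := eqVneq (unit_chain E b i j) 0; first by rewrite mulr0.
  by move/eqP/unit0 => -[_ ii jj]; move: li; rewrite ii jj label1.
have Z0 b i j : (i == 0)%N || (j == 0)%N -> Z b i j = 0.
  move=> ij; apply: Zlabel; case lE : (label i j) => [v|] //.
  have : label i j != None by rewrite lE.
  by move/label_bound/andP => -[/andP[i0 _] /andP[j0 _]]; move: ij i0 j0; case: (i) => //; case: (j).
(* Chains inside a branch set avoid the grid edge of [E0], whose ends have different labels. *)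
have ZE E0 : Z (gb E0) (gi E0) (gj E0) = z E0.
  have nin u p : inside u p -> p (gb E0) (gi E0) (gj E0) = 0.
    move=> ip; apply/eqP; apply: contraT => /ip[]; rewrite label1 label2 => -[<-] [] e21.
    by have := e12 E0; rewrite e21 eqxx.
  rewrite /Z (bigD1 E0) //= big1 ?addr0 => [|E EE].
    by rewrite (nin _ _ (ph1P E0).1) (nin _ _ (ph2P E0).1) !addr0 /unit_chain eqxx mulr1.
  rewrite (nin _ _ (ph1P E).1) (nin _ _ (ph2P E).1) !addr0.
  have [->|/eqP] := eqVneq (unit_chain E (gb E0) (gi E0) (gj E0)) 0; first by rewrite mulr0.
  by move/eqP/unit0/gedge_inj => E0E; rewrite E0E eqxx in EE.
(* A cycle bounds the set of squares with an odd number of its vertical edges on their left. *)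
pose S i j : 'F_2 := \sum_(k < i.+1) Z true k j.
have Si i j : S i j + S i.-1 j = Z true i j.
  case: i => [|i] /=; first by rewrite F2_addrr Z0.
  by rewrite /S big_ord_recr /= addrAC F2_addrr add0r.
have Sj i j : S i j + S i j.-1 = Z false i j.
  case: j => [|j] /=; first by rewrite F2_addrr Z0 ?orbT.
  elim: i => [|i IH]; first by rewrite /S !big_ord_recr !big_ord0 /= !Z0 // !addr0.
  have := bdZ i j; rewrite /bd -IH => bd0.
  have Sr k : S i.+1 k = S i k + Z true i.+1 k by rewrite /S big_ord_recr.
  rewrite !Sr; apply/eqP; rewrite -subr_eq0 oppr_pchar2 ?pchar_Fp // -bd0; apply/eqP; ring.
exists (fun s : square => S s.1 s.2).
have Ssq i j : (i < N.+2)%N -> (j < N.+2)%N -> S (sq i j).1 (sq i j).2 = S i j.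
  by move=> hi hj; rewrite /= !inordK.
have Ssq' b i j : (i < N.+2)%N -> (j < N.+2)%N -> S (sq' b i j).1 (sq' b i j).2 = if b then S i.-1 j else S i j.-1.
  by move=> hi hj; rewrite /sq'; case: b; rewrite Ssq //; apply: leq_ltn_trans (leq_pred _) _.
have Sjoin s t : joined s t -> S s.1 s.2 = S t.1 t.2.
  have key s' t' : facing s' t' -> S s'.1 s'.2 = S t'.1 t'.2.
    case/existsP => b /existsP[i /existsP[j /and3P[nu /eqP-> /eqP->]]].
    rewrite Ssq // Ssq' //; have := Zused _ _ _ nu.
    by case: b {nu}; [rewrite -Si|rewrite -Sj] => /eqP; rewrite addr_eq0 => /eqP ->; apply/eqP; rewrite eq_sym -addr_eq0 F2_addrr.
  by case/orP => [/key//|/key->].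
have Sface s : S (face s).1 (face s).2 = S s.1 s.2.
  have /connectP[q pq ->] : connect joined s (face s) by apply: connect_root.
  by elim: q s pq => //= t q IH s /andP[/Sjoin-> pq]; apply: IH.
move=> E; have [hi hj] := gedge_bound E; have {}hi := ltnW hi; have {}hj := ltnW hj.
rewrite /gleft /gright !Sface Ssq ?Ssq' //.
by rewrite -[LHS]ZE; case: (gb E); rewrite ?Si ?Sj.
Qed.

Lemma grid_bound g (X : {set V}) : (forall E, e1 E \in X) -> (forall E, e2 E \in X) ->
  (2 <= g)%N -> (3 <= #|X|)%N ->
  (forall f, bdry gleft gright f != set0 -> (g <= #|bdry gleft gright f|)%N) ->
  (g * (#|Ed| + 2) <= g * #|X| + 2 * #|Ed| \/ #|Ed| + 1 <= #|X|)%N.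
Proof. by move=> e1X e2X; apply: (euler_count (e1 := e1) (e2 := e2)) => //; exact: grid_potential. Qed.

Lemma grid_bound3 (X : {set V}) : (forall E, e1 E \in X) -> (forall E, e2 E \in X) ->
  (3 <= #|X|)%N -> (#|Ed| + 6 <= 3 * #|X|)%N.
Proof.
move=> e1X e2X X3; have g3 f := girth3 e12 grid_side_even simple (f := f).
by have := grid_bound (g := 3) e1X e2X isT X3 g3; move: X3; clear; lia.
Qed.

Lemma grid_bound4 (X X1 : {set V}) : (forall E, e1 E \in X) -> (forall E, e2 E \in X) ->
  (forall E, (e1 E \in X1) != (e2 E \in X1)) ->
  (3 <= #|X|)%N -> (#|Ed| + 4 <= 2 * #|X|)%N.
Proof.
move=> e1X e2X H X3.
have g4 f := girth4 e12 grid_side_even simple H (f := f).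
by have := grid_bound (g := 4) e1X e2X isT X3 g4; move: X3; clear; lia.
Qed.

End Grid.

Definition grid_model (T : finType) (e : rel T) := exists N (label : nat -> nat -> option T) (center : T -> nat * nat),
  [/\ forall i j, label i j != None -> (0 < i <= N)%N && (0 < j <= N)%N,
      forall i j u, label i j = Some u -> exists2 z, inside label u z &
        forall i' j', bd z i' j' = (((i'.+1, j'.+1) == (i, j))%:R + ((i'.+1, j'.+1) == center u)%:R)%R
    & forall u v, e u v -> exists b i j,
       (label i j = Some u /\ next_label label b i j = Some v) \/
       (label i j = Some v /\ next_label label b i j = Some u)].

(** * Sparsity of graphs with a grid model *)

Section ModelSparse.
Variables (T : finType) (e : rel T).
Hypotheses (e_sym : symmetric e) (e_irr : irreflexive e) (model : grid_model e).

(** [P] lists each edge in one orientation. The grid edge may run the other way, which affects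
    neither bound. *)
Lemma model_edges (P : pred (T * T)) (X : {set T}) :
  (forall p, P p -> [/\ p.1 \in X, p.2 \in X & e p.1 p.2]) ->
  (forall p q, P p -> P q -> [set p.1; p.2] = [set q.1; q.2] -> p = q) -> 3 <= #|X| ->
  #|[set p | P p]| + 6 <= 3 * #|X| /\
  forall X1 : {set T}, (forall p, P p -> (p.1 \in X1) != (p.2 \in X1)) -> #|[set p | P p]| + 4 <= 2 * #|X|.
Proof.
move=> HP inj X3; have [N [label [center [lb conn edge]]]] := model.
pose Ed := {p : T * T | P p}.
have cE : #|{: Ed}| = #|[set p | P p]| by rewrite card_sig; apply: eq_card => p; rewrite inE.
have /fin_all_exists[g gP] : forall E : Ed, exists h : bool * (nat * nat) * (T * T),
    [/\ label h.1.2.1 h.1.2.2 = Some h.2.1,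
        next_label label h.1.1 h.1.2.1 h.1.2.2 = Some h.2.2
      & h.2 = val E \/ h.2 = ((val E).2, (val E).1)].
  move=> -[[u v] Puv]; have [_ _ /edge[b [i [j [[l1 l2]|[l1 l2]]]]]] := HP _ Puv.
    by exists ((b, (i, j)), (u, v)); split=> //; left.
  by exists ((b, (i, j)), (v, u)); split=> //; right.
pose e1 E := (g E).2.1; pose e2 E := (g E).2.2.
have setE E : [set e1 E; e2 E] = [set (val E).1; (val E).2].
  by rewrite /e1 /e2; case: (gP E) => _ _ [] ->; rewrite //= setUC.
have simple E E' : [set e1 E; e2 E] = [set e1 E'; e2 E'] -> E = E'.
  by rewrite !setE => /inj H; apply: val_inj; apply: H; apply: valP.
have e12 E : e1 E != e2 E.
  apply/eqP => E12; have := setE E; rewrite E12 setUid => /setP s1.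
  have [_ _] := HP _ (valP E); have /eqP-> : (val E).1 == e2 E by rewrite -in_set1 s1 set21.
  have /eqP-> : (val E).2 == e2 E by rewrite -in_set1 s1 set22.
  by rewrite e_irr.
have eX E u : u \in [set e1 E; e2 E] -> u \in X.
  by rewrite setE => /set2P[]->; case: (HP _ (valP E)).
have l1 E : label (g E).1.2.1 (g E).1.2.2 = Some (e1 E) by case: (gP E).
have l2 E : next_label label (g E).1.1 (g E).1.2.1 (g E).1.2.2 = Some (e2 E) by case: (gP E).
have b3 := grid_bound3 lb l1 l2
  e12 simple conn (fun E => eX E _ (set21 _ _)) (fun E => eX E _ (set22 _ _)) X3.
have b4 (X1 : {set T}) (H : forall E, (e1 E \in X1) != (e2 E \in X1)) := grid_bound4 lb l1 l2
  e12 simple conn (fun E => eX E _ (set21 _ _)) (fun E => eX E _ (set22 _ _)) H X3.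
rewrite -cE; split=> // X1 H; apply: (b4 X1) => E; have := H _ (valP E).
by rewrite /e1 /e2; case: (gP E) => _ _ [] ->; rewrite //= eq_sym.
Qed.

Lemma model_sparse : sparse e.
Proof.
split=> [X X3|X Y d XY3].
  pose P (p : T * T) := [&& p.1 \in X, p.2 \in X, e p.1 p.2 & enum_rank p.1 < enum_rank p.2].
  have [||h _] := @model_edges P X _ _ X3.
  - by move=> p /and4P[].
  - move=> [u v] [u' v'] /and4P[/= _ _ _ r1] /and4P[/= _ _ _ r2] /setP s.
    have := s u; have := s v; rewrite !inE !eqxx orbT => /esym/orP[]/eqP vE /esym/orP[]/eqP uE; subst=> //.
    + by rewrite ltnn in r1.
    + by have := ltn_trans r1 r2; rewrite ltnn.
    + by rewrite ltnn in r1.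
  have -> : edge_count e X X = 2 * #|[set p | P p]|; last by move: h; clear; lia.
  rewrite edge_count_sum pair_big /= mul2n -addnn.
  pose Q (p : T * T) := [&& p.1 \in X, p.2 \in X, e p.1 p.2 & enum_rank p.2 < enum_rank p.1].
  have cPQ : #|[set p | P p]| = #|[set p | Q p]|.
    pose sw (p : T * T) := (p.2, p.1); have swi : injective sw by case=> [a b] [a' b'] [-> ->].
    rewrite -(card_imset _ swi); apply: eq_card => -[u v]; rewrite !inE /Q /=.
    apply/imsetP/and4P => [[[u' v']]|[uX vX euv r]].
      by rewrite inE => /and4P[/= h1 h2 h3 h4] [-> ->]; rewrite e_sym.
    by exists (v, u) => //; rewrite inE /P /= uX vX e_sym euv.
  rewrite {2}cPQ -card_disjointU.
    rewrite -sum1_card [LHS]big_mkcond [RHS]big_mkcond; apply: eq_bigr => -[u v] _.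
    rewrite in_setU !inE /P /Q /=; case: (u \in X); case: (v \in X) => //=.
    case: (boolP (e u v)) => //= euv.
    by case: ltngtP => // /ord_inj/enum_rank_inj uv; rewrite uv e_irr in euv.
  rewrite -setI_eq0 -subset0; apply/subsetP => p /setIP[]; rewrite !inE => /and4P[_ _ _ h1] /and4P[_ _ _ h2].
  by move: (ltn_trans h1 h2); rewrite ltnn.
pose P (p : T * T) := [&& p.1 \in X, p.2 \in Y & e p.1 p.2].
have cXY : #|X :|: Y| = #|X| + #|Y| by apply: card_disjointU.
have [|||_] := @model_edges P (X :|: Y).
- by move=> p /and3P[h1 h2 h3]; rewrite !in_setU h1 h2 orbT.
- move=> [u v] [u' v'] /and3P[/= uX vY _] /and3P[/= u'X v'Y _] /setP s.
  have := s u; have := s v; rewrite !inE !eqxx orbT => /esym/orP[]/eqP vE /esym/orP[]/eqP uE; subst=> //.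
  + by move: vY; rewrite (disjointFr d u'X).
  + by move: vY; rewrite (disjointFr d u'X).
  + by move: uX; rewrite (disjointFl d v'Y).
- by rewrite cXY.
move/(_ X) => h; have {}h := h _; rewrite cXY in h.
have -> : edge_count e X Y = #|[set p | P p]|.
  rewrite edge_count_sum pair_big /= -sum1_card [LHS]big_mkcond [RHS]big_mkcond; apply: eq_bigr => -[u v] _.
  by rewrite !inE /P /=; case: (u \in X); case: (v \in Y); case: (e u v).
apply: h => p /and3P[h1 h2 _]; by rewrite h1 (disjointFl d h2).
Qed.

End ModelSparse.
(** Includes equality, since consecutive samples of a curve may fall into the same cell. *)
Definition rook (p q : nat * nat) :=
  (p.1 == q.1) && [|| p.2 == q.2, p.2.+1 == q.2 | q.2.+1 == p.2] ||
  (p.2 == q.2) && ((p.1.+1 == q.1) || (q.1.+1 == p.1)).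

(** [s u v] follows the half of the edge [uv] next to [u]. Walks from one vertex may overlap freely;
    walks from different vertices share cells only if they are the two halves of one edge. *)
Definition walk_model (T : finType) (e : rel T) := exists N (a : T -> nat * nat) (s : T -> T -> seq (nat * nat)),
  [/\ forall u v, e u v -> path rook (a u) (s u v),
      forall u v c, e u v -> c \in a u :: s u v -> (0 < c.1 <= N) && (0 < c.2 <= N),
      forall u v, e u v -> has (mem (a v :: s v u)) (a u :: s u v),
      forall u v, e u v -> a v \notin a u :: s u v
    & forall u v w w' c, e u v -> e w w' -> c \in a u :: s u v -> c \in a w :: s w w' ->
        u = w \/ w = v /\ w' = u].

Lemma rook_step (T : finType) (label : nat -> nat -> option T) p q : rook p q -> p != q ->
  exists b i j, ((i, j) = p /\ next_label label b i j = label q.1 q.2 /\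
       (if b then (i, j.+1) else (i.+1, j)) = q) \/
     ((i, j) = q /\ next_label label b i j = label p.1 p.2 /\ (if b then (i, j.+1) else (i.+1, j)) = p).
Proof.
case: p q => [a b] [c d]; rewrite /rook xpair_eqE /= => /orP[/andP[/eqP<-]|/andP[/eqP<-]].
  rewrite eqxx /= => /or3P[->//|/eqP<-|/eqP<-] _; first by exists true, a, b; left.
  by exists true, a, d; right.
rewrite eqxx andbT /= => /orP[]/eqP<- _; first by exists false, a, b; left.
by exists false, c, b; right.
Qed.

(** * Branch sets cut out of walks *)

Section Walks.
Variables (T : finType) (e : rel T) (N : nat) (a : T -> nat * nat) (s : T -> T -> seq (nat * nat)).
Hypotheses (e_sym : symmetric e)
  (s_path : forall u v, e u v -> path rook (a u) (s u v))
  (s_bound : forall u v c, e u v -> c \in a u :: s u v -> (0 < c.1 <= N) && (0 < c.2 <= N))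
  (s_meet : forall u v, e u v -> has (mem (a v :: s v u)) (a u :: s u v))
  (s_avoid : forall u v, e u v -> a v \notin a u :: s u v)
  (s_sep : forall u v w w' c, e u v -> e w w' -> c \in a u :: s u v -> c \in a w :: s w w' ->
    u = w \/ w = v /\ w' = u).

Let W u v := a u :: s u v.

(* The walks from [u] and from [v] may meet several times: the one from the smaller endpoint is cut just
   before it first meets the other one. *)
Definition trunk u v := if (enum_rank u < enum_rank v)%N then take (find (mem (W v u)) (W u v)) (W u v) else W u v.

Definition branch u := [pred c | [exists v, e u v && (c \in trunk u v)]].

Definition branch_label i j := [pick u | branch u (i, j)].

Lemma mem_trunk u v c : c \in trunk u v -> c \in W u v.
Proof. by rewrite /trunk; case: ifP => // _; apply: mem_take. Qed.

Lemma branch_inj u w c : branch u c -> branch w c -> u = w.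
Proof.
case/existsP => v /andP[euv cu] /existsP[w' /andP[eww cw]].
have [//|[wv w'u]] := s_sep euv eww (mem_trunk cu) (mem_trunk cw).
subst w w'; have key u1 v1 : (enum_rank u1 < enum_rank v1)%N -> c \in trunk u1 v1 -> c \in W v1 u1 -> False.
  rewrite /trunk => -> /(nthP c)[k]; rewrite size_take => kl <-.
  have kf : (k < find (mem (W v1 u1)) (W u1 v1))%N by move: kl; case: ifP => //; lia.
  by rewrite nth_take // => ck; have := before_find c kf; rewrite /= ck.
case: (ltngtP (enum_rank u) (enum_rank v)) => [uv|uv|uv].
- by case: (key _ _ uv cu (mem_trunk cw)).
- by case: (key _ _ uv cw (mem_trunk cu)).
- exact/enum_rank_inj/ord_inj.
Qed.

Lemma branch_labelP u c : branch u c -> branch_label c.1 c.2 = Some u.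
Proof.
case: c => i j bu; rewrite /branch_label; case: pickP => [w bw|]; last by move/(_ u); rewrite /= -[[exists _, _]]/(branch u (i, j)) bu.
by congr Some; apply: branch_inj bw bu.
Qed.

(** Each step of the walk extends the chain by one grid edge; a repeated cell leaves it
    unchanged. *)
Lemma trunk_chain u q s' : path rook q s' -> (forall c, c \in q :: s' -> branch_label c.1 c.2 = Some u) ->
  (exists2 z, inside branch_label u z & forall i' j', bd z i' j' =
     (((i'.+1, j'.+1) == q)%:R + ((i'.+1, j'.+1) == a u)%:R)%R) ->
  forall c, c \in q :: s' -> exists2 z, inside branch_label u z &
        forall i' j', bd z i' j' = (((i'.+1, j'.+1) == c)%:R + ((i'.+1, j'.+1) == a u)%:R)%R.
Proof.
elim: s' q => [|q' s' IH] q /=; first by move=> _ _ Hq c; rewrite inE => /eqP->.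
move=> /andP[rqq ps] lab Hq c; rewrite inE => /predU1P[->//|].
apply: (IH q') => // [c' c's|]; first by apply: lab; rewrite inE c's orbT.
have lq : branch_label q.1 q.2 = Some u by apply: lab; rewrite inE eqxx.
have lq' : branch_label q'.1 q'.2 = Some u by apply: lab; rewrite !inE eqxx orbT.
have [<-//|nqq] := eqVneq q q'.
have [b [i [j H]]] := rook_step branch_label rqq nqq.
case: Hq => z zin zbd.
pose g (b' : bool) i' j' : 'F_2 := (((b', i', j') == (b, i, j))%:R + z b' i' j')%R.
have lij : branch_label i j = Some u /\ next_label branch_label b i j = Some u.
  by case: H => -[E [-> _]]; [rewrite -E in lq | rewrite -E in lq'].
exists g.
  move=> b' i' j'; rewrite /g; case: ((b', i', j') =P (b, i, j)) => [[-> -> ->] //|_].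
  by rewrite add0r; apply: zin.
move=> i' j'; have -> : bd g i' j' = (((i'.+1, j'.+1) == (i, j))%:R +
    ((i'.+1, j'.+1) == if b then (i, j.+1) else (i.+1, j))%:R + bd z i' j')%R.
  rewrite /bd /g !xpair_eqE; case: (b) => /=; rewrite !xpair_eqE ?eqSS /=.
    by rewrite !add0r; ring.
  by rewrite !add0r ?addr0; ring.
rewrite zbd; case: H => -[-> [_ ->]].
  move: (_ == q) (_ == q') (_ == a u); by do 3! case; apply/val_inj.
move: (_ == q) (_ == q') (_ == a u); by do 3! case; apply/val_inj.
Qed.

Lemma trunk_cons u v : e u v -> exists2 s', trunk u v = a u :: s' & path rook (a u) s'.
Proof.
move=> euv; rewrite /trunk; case: ifP => _; last by exists (s u v); rewrite ?s_path.
rewrite e_sym in euv; rewrite /= (negPf (s_avoid euv)) /=.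
by rewrite e_sym in euv; exists (take (find (mem (W v u)) (s u v)) (s u v)) => //; apply/take_path/s_path.
Qed.

Lemma branch_connected i j u : branch_label i j = Some u -> exists2 z, inside branch_label u z &
    forall i' j', bd z i' j' = (((i'.+1, j'.+1) == (i, j))%:R + ((i'.+1, j'.+1) == a u)%:R)%R.
Proof.
rewrite {1}/branch_label; case: pickP => // w /existsP[v /andP[euv cw]] [wu]; subst w.
have [s' tE ps] := trunk_cons euv; rewrite tE in cw.
apply: (trunk_chain ps) cw => [c cs|].
  by apply: branch_labelP; apply/existsP; exists v; rewrite euv tE.
exists (fun _ _ _ => 0%R) => [b i' j'|i' j']; first by rewrite eqxx.
by rewrite /bd !F2_addrr.
Qed.

(** The grid edge is the step with which the walk from [u] first enters that from [v], exactly where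
    [trunk] cuts it. There is such a step because the walk from [v] avoids [a u]. *)
Lemma walk_edge u v : e u v -> (enum_rank u < enum_rank v)%N -> exists b i j,
       (branch_label i j = Some u /\ next_label branch_label b i j = Some v) \/
       (branch_label i j = Some v /\ next_label branch_label b i j = Some u).
Proof.
move=> euv uv; have evu : e v u by rewrite e_sym.
have [s' tE ps] := trunk_cons euv.
have hm := s_meet euv; set k := find (mem (W v u)) (W u v).
have kl : (k < size (W u v))%N by rewrite -has_find.
have k0 : (0 < k)%N by rewrite /k /= (negPf (s_avoid evu)).
pose q := nth (a u) (W u v) k; pose q1 := nth (a u) (W u v) k.-1.
have qv : branch_label q.1 q.2 = Some v.
  apply: branch_labelP; apply/existsP; exists u; rewrite evu /trunk ltnNge (ltnW uv) /=.
  exact: (nth_find (a u) hm).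
have q1u : branch_label q1.1 q1.2 = Some u.
  apply: branch_labelP; apply/existsP; exists v; rewrite euv /trunk uv /=.
  have -> : q1 = nth (a u) (take k (W u v)) k.-1 by rewrite nth_take // prednK.
  by apply: mem_nth; rewrite size_take kl prednK.
have rq : rook q1 q.
  have := s_path euv => /(pathP (a u))/(_ k.-1); rewrite /q1 /q; case: (k) k0 kl => // k' _ /=.
  by rewrite ltnS => kl /(_ kl).
have nq : q1 != q.
  by apply: contraTneq uv => qq; move: q1u; rewrite qq qv => -[->]; rewrite ltnn.
have [b [i [j H]]] := rook_step branch_label rq nq; exists b, i, j.
by case: H => -[E [-> _]]; [left; rewrite -q1u -E | right; rewrite -qv -E].
Qed.

Lemma walks_grid_model : irreflexive e -> grid_model e.
Proof.
move=> e_irr; exists N, branch_label, a; split.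
- move=> i j; rewrite /branch_label; case: pickP => // u /existsP[v /andP[euv /mem_trunk]] + _.
  exact: s_bound.
- exact: branch_connected.
- move=> u v euv; case: (ltngtP (enum_rank u) (enum_rank v)) => [uv|vu|/ord_inj/enum_rank_inj uv].
  + exact: walk_edge.
  + have [b [i [j H]]] := walk_edge (etrans (e_sym v u) euv) vu.
    by exists b, i, j; case: H; [right | left].
  + by rewrite uv e_irr in euv.
Qed.

End Walks.

Lemma walk_model_sparse (T : finType) (e : rel T) : symmetric e -> irreflexive e -> walk_model e -> sparse e.
Proof.
move=> e_sym e_irr [N [a [s [h1 h2 h3 h4 h5]]]].
by apply: model_sparse => //; apply: (walks_grid_model e_sym h1 h2 h3 h4 h5).
Qed.

Local Open Scope ring_scope.

(** * From plane curves to grid walks *)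

Section Curves.
Variable R : realType.
Implicit Types (f g : R -> R) (eps s t : R).
Local Open Scope classical_set_scope.

Let I01 : set R := `[0, 1]%classic.

Lemma in01 t : 0 <= t <= 1 -> I01 t.
Proof. by move=> h; rewrite /I01 /= in_itv. Qed.

(** Composing with this retraction onto the unit interval turns continuity on the interval into
    continuity on the whole line. *)
Definition clamp (t : R) := Num.max 0 (Num.min t 1).

Lemma clamp_in t : 0 <= clamp t <= 1.
Proof. by rewrite /clamp le_max lexx ge_max ler01 ge_min lexx orbT. Qed.

Lemma clamp_id t : 0 <= t <= 1 -> clamp t = t.
Proof. by case/andP => h1 h2; rewrite /clamp min_l // max_r. Qed.

Lemma clamp_continuous : continuous clamp.
Proof.
move=> t; apply: (@continuous_max R R (cst 0) (id \min cst 1)); first exact: cvg_cst.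
by apply: continuous_min; [exact: cvg_id | exact: cvg_cst].
Qed.

Lemma within_clamp (U : topologicalType) (f : R -> U) :
  {within `[0, 1], continuous f} -> continuous (f \o clamp).
Proof.
move=> /subspace_continuousP cf t.
have ct : I01 (clamp t) by apply: in01; apply: clamp_in.
have H := cf _ ct; move=> B /H; rewrite /within /= => nb.
have nb2 : nbhs t (fun s => I01 (clamp s) -> B (f (clamp s))) := @clamp_continuous t _ nb.
by apply: (@filterS _ (nbhs t) _ _ _ _ nb2) => s; apply; apply: in01; apply: clamp_in.
Qed.

Lemma compact_lower_bound (X : topologicalType) (D : set X) (f : X -> R) : compact D -> continuous f ->
  (forall x, D x -> 0 < f x) -> exists2 eps, 0 < eps & forall x, D x -> eps <= f x.
Proof.
move=> cD cf f0; have [->|/classical_sets.set0P D0] := eqVneq D classical_sets.set0; first by exists 1.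
have [x xD xm] := compact_EVT_min D0 cD (continuous_subspaceT cf).
exists (f x); first by apply/f0/set_mem.
by move=> y yD; apply/xm/mem_set.
Qed.

Definition dist (p q : R * R) := `|p.1 - q.1| + `|p.2 - q.2|.

Lemma dist_gt0 p q : p != q -> 0 < dist p q.
Proof.
case: p q => [a b] [c d]; rewrite xpair_eqE negb_and /dist /= => /orP[h|h].
  by rewrite ltr_pwDl // normr_gt0 subr_eq0.
by rewrite ltr_pwDr // normr_gt0 subr_eq0.
Qed.

Lemma dist_continuous (h1 h2 : R -> R * R) : continuous h1 -> continuous h2 ->
  continuous (fun st : R * R => dist (h1 st.1) (h2 st.2)).
Proof.
move=> c1 c2 st; rewrite /dist.
have k1 : h1 \o fst @ st --> h1 st.1 by apply: continuous_comp; [exact: cvg_fst | exact: c1].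
have k2 : h2 \o snd @ st --> h2 st.2 by apply: continuous_comp; [exact: cvg_snd | exact: c2].
apply: cvgD; apply: cvg_norm; apply: cvgB.
- by apply: (cvg_comp _ _ k1); exact: cvg_fst.
- by apply: (cvg_comp _ _ k2); exact: cvg_fst.
- by apply: (cvg_comp _ _ k1); exact: cvg_snd.
- by apply: (cvg_comp _ _ k2); exact: cvg_snd.
Qed.

Lemma square_compact : compact (I01 `*` I01).
Proof. by apply: compact_setX; exact: segment_compact. Qed.

Lemma separation (h1 h2 : R -> R * R) : continuous h1 -> continuous h2 ->
  (forall s t, 0 <= s <= 1 -> 0 <= t <= 1 -> h1 s != h2 t) ->
  exists2 eps, 0 < eps & forall s t, 0 <= s <= 1 -> 0 <= t <= 1 -> eps <= dist (h1 s) (h2 t).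
Proof.
move=> c1 c2 ne; have [|eps e0 H] := compact_lower_bound square_compact (dist_continuous c1 c2).
  by move=> [s t] [/= hs ht]; apply: dist_gt0; apply: ne; rewrite /I01 /= in_itv /= in hs ht.
by exists eps => // s t hs ht; apply: (H (s, t)); split; apply: in01.
Qed.

(** The pairs with values at distance at least [eps] form a compact set, on which [|s - t|] has a
    positive minimum. *)
Lemma uniform_continuity (h : R -> R * R) eps : continuous h -> 0 < eps ->
  exists2 d, 0 < d & forall s t, 0 <= s <= 1 -> 0 <= t <= 1 -> `|s - t| < d -> dist (h s) (h t) < eps.
Proof.
move=> ch e0; pose D := (I01 `*` I01) `&` [set st : R * R | eps <= dist (h st.1) (h st.2)].
have cD : compact D.
  apply: compact_closedI; first exact: square_compact.
  have /continuous_closedP cl := dist_continuous ch ch.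
  exact: (cl _ (@closed_ge R eps)).
have cf : continuous (fun st : R * R => `|st.1 - st.2|).
  by move=> st; apply: cvg_norm; apply: cvgB; [exact: cvg_fst | exact: cvg_snd].
have [|d d0 H] := compact_lower_bound cD cf.
  move=> [s t] [_ /= le]; rewrite normr_gt0 subr_eq0; apply: contraTneq le => ->.
  by rewrite /dist !subrr normr0 addr0 -ltNge.
exists d => // s t hs ht; apply: contraTT; rewrite -!leNgt => le.
by apply: (H (s, t)); split; [split; apply: in01|].
Qed.

Lemma curve_bounded (h : R -> R * R) : continuous h ->
  exists2 b, 0 < b & forall t, 0 <= t <= 1 -> dist (h t) 0 <= b.
Proof.
move=> ch; have cd : continuous (fun t => dist (h t) 0).
  move=> t; rewrite /dist; apply: cvgD; apply: cvg_norm; apply: cvgB; try exact: cvg_cst.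
    by apply: (cvg_comp _ _ (ch t)); exact: cvg_fst.
  by apply: (cvg_comp _ _ (ch t)); exact: cvg_snd.
have [c _ H] := EVT_max ler01 (continuous_subspaceT cd).
exists (dist (h c) 0 + 1); first by rewrite ltr_wpDl // /dist addr_ge0.
by move=> t ht; apply: le_trans (H t _) _; rewrite ?in_itv // lerDl.
Qed.

End Curves.

(** * Rook walks through the cells of a sampled curve *)

Section Zigzag.
Local Open Scope nat_scope.
Variable C : nat -> nat * nat.

(** Consecutive sampled cells may differ in both coordinates; the corner cell in between splits this
    into two rook steps. *)
Definition zigzag n := flatten [seq [:: ((C k.+1).1, (C k).2); C k.+1] | k <- iota 0 n].

Lemma zigzagS n : zigzag n.+1 = zigzag n ++ [:: ((C n.+1).1, (C n).2); C n.+1].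
Proof.
have iE : iota 0 n.+1 = iota 0 n ++ [:: n] by rewrite -addn1 iotaD.
by rewrite /zigzag iE map_cat flatten_cat.
Qed.

Lemma zigzag_last n : last (C 0) (zigzag n) = C n.
Proof. by case: n => // n; rewrite zigzagS last_cat. Qed.

Lemma zigzag_path n : (forall k, (k < n)%N -> ((C k).1 <= (C k.+1).1.+1)%N /\ ((C k.+1).1 <= (C k).1.+1)%N /\
    ((C k).2 <= (C k.+1).2.+1)%N /\ ((C k.+1).2 <= (C k).2.+1)%N) -> path rook (C 0) (zigzag n).
Proof.
elim: n => // n IH H; rewrite zigzagS cat_path zigzag_last IH => [|k kn]; last by apply: H; rewrite ltnW.
have := H n (ltnSn n); move: (C n) (C n.+1) => [a b] [a' b'] /= H'.
by rewrite /rook /= !eqxx; move: H'; lia.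
Qed.

Lemma mem_zigzag n c : c \in C 0 :: zigzag n ->
  exists k l, [/\ (k <= n)%N, (l <= n)%N, k = l \/ k = l.+1 & c = ((C k).1, (C l).2)].
Proof.
rewrite inE => /predU1P[->|/flattenP[s /mapP[k]]]; first by exists 0%N, 0%N; split=> //; [left | case: (C 0%N)].
rewrite mem_iota add0n => /andP[_ kn] ->; rewrite !inE => /orP[]/eqP->.
  by exists k.+1, k; split=> //; [apply: ltnW | right].
by exists k.+1, k.+1; split=> //; [left | case: (C k.+1)].
Qed.

End Zigzag.

Section Cells.
Variables (R : realType) (b : R) (L : nat).
Hypothesis L0 : (0 < L)%N.

Definition coord (x : R) := Num.truncn (L%:R * (x + b)).
Definition cell (q : R * R) := (coord q.1, coord q.2).

Lemma coordP x : `|x| + 1 <= b -> ((coord x)%:R : R) <= L%:R * (x + b) < (coord x)%:R + 1.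
Proof.
move=> xb; have [h1 h2] : -x <= `|x| /\ x <= `|x| by split; rewrite ?ler_norm // -normrN ler_norm.
have := @Num.Theory.truncn_itv R (L%:R * (x + b)); rewrite -natr1; apply.
by apply: mulr_ge0 => //; lra.
Qed.

Lemma coord_gt0 x : `|x| + 1 <= b -> (0 < coord x)%N.
Proof.
move=> xb; have [h1 h2] : -x <= `|x| /\ x <= `|x| by split; rewrite ?ler_norm // -normrN ler_norm.
have l1 : 1 <= L%:R :> R by rewrite ler1n.
rewrite /coord Num.Theory.truncn_ge_nat; last by apply: mulr_ge0 => //; lra.
by nra.
Qed.

Lemma coord_le x : `|x| + 1 <= b -> (coord x <= Num.truncn (L%:R * (2 * b)))%N.
Proof.
move=> xb; have [h1 h2] : -x <= `|x| /\ x <= `|x| by split; rewrite ?ler_norm // -normrN ler_norm.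
have /andP[h3 _] := coordP xb; have x0 := normr_ge0 x; have l0 : 0 <= L%:R :> R by [].
rewrite Num.Theory.truncn_ge_nat; last by apply: mulr_ge0 => //; lra.
by apply: le_trans h3 _; apply: ler_wpM2l => //; lra.
Qed.

Lemma coord_step x y : `|x| + 1 <= b -> `|y| + 1 <= b -> L%:R * `|x - y| < 1 -> (coord x <= (coord y).+1)%N.
Proof.
move=> /coordP/andP[x1 x2] /coordP/andP[y1 y2] xy.
have l0 : 0 <= L%:R :> R by [].
have : L%:R * (x - y) < 1 by apply: le_lt_trans xy; apply: ler_wpM2l => //; apply: ler_norm.
by move=> h; rewrite -ltnS -(ltr_nat R) -!natr1; lra.
Qed.

Lemma coord_dist x y : `|x| + 1 <= b -> L%:R * `|x - y| < 1 -> `|(coord x)%:R - L%:R * (y + b)| <= 2.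
Proof.
move=> /coordP/andP[x1 x2] xy; have l0 : 0 <= L%:R :> R by [].
have : L%:R * (x - y) < 1 by apply: le_lt_trans xy; apply: ler_wpM2l => //; apply: ler_norm.
have : L%:R * (y - x) < 1.
  by apply: le_lt_trans xy; apply: ler_wpM2l => //; rewrite distrC; apply: ler_norm.
by move=> h1 h2; rewrite ler_norml; lra.
Qed.

(** One unit is for rounding and one for the step between samples, because a corner cell takes its
    coordinates from two consecutive samples. *)
Definition near_cell (c : nat * nat) (q : R * R) :=
  `|c.1%:R - L%:R * (q.1 + b)| <= 2 /\ `|c.2%:R - L%:R * (q.2 + b)| <= 2.

Lemma near_cell_dist c q q' : near_cell c q -> near_cell c q' -> L%:R * dist q q' <= 8.
Proof.
have l0 : 0 <= L%:R :> R by [].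
have key (n : nat) (y y' : R) : `|n%:R - L%:R * (y + b)| <= 2 -> `|n%:R - L%:R * (y' + b)| <= 2 -> L%:R * `|y - y'| <= 4.
  have -> : L%:R * `|y - y'| = `|L%:R * (y - y')| by rewrite normrM [`|L%:R|]ger0_norm.
  by rewrite !ler_norml => h1 h2; lra.
move=> [h1 h2] [h1' h2']; rewrite /dist mulrDr.
by have := key _ _ _ h1 h1'; have := key _ _ _ h2 h2'; lra.
Qed.

End Cells.

Lemma fin_eps (R : realType) (I : finType) (P : I -> R -> Prop) :
  (forall i eps eps', eps' <= eps -> P i eps -> P i eps') ->
  (forall i, exists2 eps, 0 < eps & P i eps) -> exists2 eps, 0 < eps & forall i, P i eps.
Proof.
move=> mono /fin_all_exists2[f f0 fP].
exists (\big[Num.min/1]_i f i); first by apply: (big_ind (fun x => 0 < x)) => // x y x0 y0; rewrite lt_min x0.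
by move=> i; apply: mono (fP i); apply: bigmin_le_cond.
Qed.

(** * Half-curves of a plane drawing and their discretization *)

Section PlaneDrawing.
Variables (R : realType) (T : finType) (e : rel T) (p : T -> R * R) (A : {set T} -> set (R * R)).
Hypotheses (e_sym : symmetric e) (e_irr : irreflexive e).
Implicit Types s t : R.
Hypothesis drawing : plane_drawing e p A.
Local Open Scope classical_set_scope.

Lemma vertex_inj : injective p. Proof. by case: drawing. Qed.

Lemma curves : exists g : T -> T -> R -> R * R, forall u v, e u v ->
  [/\ continuous (g u v), g u v 0 = p u, g u v 1 = p v,
      forall s t : R, 0 <= s <= 1 -> 0 <= t <= 1 -> g u v s = g u v t -> s = t
    & forall t : R, 0 <= t <= 1 -> A [set u; v]%SET (g u v t)].
Proof.
have /choice[g gP] : forall uv : T * T, exists h : R -> R * R, e uv.1 uv.2 ->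
  [/\ continuous h, h 0 = p uv.1, h 1 = p uv.2,
      forall s t : R, 0 <= s <= 1 -> 0 <= t <= 1 -> h s = h t -> s = t
    & forall t : R, 0 <= t <= 1 -> A [set uv.1; uv.2]%SET (h t)].
  move=> [u v] /=; case: (boolP (e u v)) => [euv|_]; last by exists (fun=> 0).
  have [_ arcs _ _] := drawing; have [h [hc hi h0 h1 hA]] := arcs u v euv.
  have l01 : (0 : R) <= (0 : R) <= 1 by apply/andP; split; lra.
  have l11 : (0 : R) <= (1 : R) <= 1 by apply/andP; split; lra.
  exists (h \o @clamp R) => _; split.
  - exact: within_clamp.
  - by rewrite /= clamp_id.
  - by rewrite /= clamp_id.
  - by move=> s t hs ht; rewrite /= !clamp_id // => E; apply: hi => //; apply/mem_set/in01.
  - move=> t ht; rewrite hA /= clamp_id //; exists t => //; exact: in01.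
by exists (fun u v => g (u, v)) => u v euv; apply: (gP (u, v)).
Qed.

Lemma meet_vertex u v w w' q : e u v -> e w w' -> [set u; v]%SET != [set w; w']%SET ->
  A [set u; v]%SET q -> A [set w; w']%SET q -> q = p u \/ q = p v.
Proof.
move=> euv eww E12 qE qF; have [_ _ _ cross] := drawing.
have edge a b : e a b -> [set a; b]%SET \in edges e.
  by move=> eab; rewrite inE; apply/existsP; exists a; apply/existsP; exists b; rewrite eab eqxx.
apply: contrapT => nq; have : (edge_interior p A [set u; v]%SET `&` A [set w; w']%SET) q.
  split=> //; split=> //= -[z]; rewrite /= => /set2P[] -> qz; apply: nq; [left|right]; exact/esym.
by rewrite cross // ?edge.
Qed.

(** Both halves of an edge come from one orientation, chosen by [enum_rank], as [g u v] and [g v u]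
    may have different midpoints. A half never reaches its far end, so a common point of halves of
    different edges is the starting vertex of both. *)
Lemma half_curves : exists h : T -> T -> R -> R * R, [/\
  forall u v, e u v -> continuous (h u v),
  forall u v, e u v -> h u v 0 = p u,
  forall u v, e u v -> h u v 1 = h v u 1,
  forall u v (t : R), e u v -> 0 <= t <= 1 -> h u v t != p v
  & forall u v w w' (s t : R), e u v -> e w w' -> u != w -> (w, w') != (v, u) -> 0 <= s <= 1 -> 0 <= t <= 1 ->
     h u v s != h w w' t].
Proof.
have [g gP] := curves.
pose h u v (t : R) := if (enum_rank u < enum_rank v)%N then g u v (t / 2) else g v u (1 - t / 2).
have rank_total u v : e u v -> (enum_rank u < enum_rank v)%N = ~~ (enum_rank v < enum_rank u)%N.
  move=> euv; case: ltngtP => // /ord_inj/enum_rank_inj uv.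
  by rewrite uv e_irr in euv.
have sym u v : e u v -> e v u by rewrite e_sym.
have hv u v (t : R) : e u v -> 0 <= t <= 1 -> h u v t != p v.
  move=> euv ht; have evu := sym _ _ euv; apply/eqP; rewrite /h; case: ifP => _.
    have [_ _ <- inj _] := gP _ _ euv; move/inj; rewrite lexx ler01; move: ht => /andP[t0 t1].
    have hh : 0 <= t / 2 <= 1 by apply/andP; split; lra.
    by move=> /(_ hh isT); lra.
  have [_ <- _ inj _] := gP _ _ evu; move/inj; rewrite lexx ler01; move: ht => /andP[t0 t1].
  have hh : 0 <= 1 - t / 2 <= 1 by apply/andP; split; lra.
  by move=> /(_ hh isT); lra.
have hA u v (t : R) : e u v -> 0 <= t <= 1 -> A [set u; v]%SET (h u v t).
  move=> euv /andP[t0 t1]; have evu := sym _ _ euv; rewrite /h; case: ifP => _.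
    by have [_ _ _ _ gA] := gP _ _ euv; apply: gA; apply/andP; split; lra.
  by have [_ _ _ _ gA] := gP _ _ evu; rewrite finset.setUC; apply: gA; apply/andP; split; lra.
exists h; split=> //.
- move=> u v euv; rewrite /h; case: (enum_rank u < enum_rank v)%N.
    have [gc _ _ _ _] := gP _ _ euv; move=> t.
    apply: (@continuous_comp _ _ _ (fun t : R => t / 2) (g u v)); last exact: gc.
    by apply: cvgM; [exact: cvg_id | exact: cvg_cst].
  have [gc _ _ _ _] := gP _ _ (sym _ _ euv); move=> t.
  apply: (@continuous_comp _ _ _ (fun t : R => 1 - t / 2) (g v u)); last exact: gc.
  by apply: cvgB; [exact: cvg_cst | apply: cvgM; [exact: cvg_id | exact: cvg_cst]].
- move=> u v euv; rewrite /h; case: ifP => _; first by rewrite mul0r; case: (gP _ _ euv).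
  by rewrite mul0r subr0; case: (gP _ _ (sym _ _ euv)).
- move=> u v euv; rewrite /h (rank_total v u (sym _ _ euv)).
  have half : 1 - 1 / 2 = 1 / 2 :> R by lra.
  by case: ifP => _ /=; rewrite half.
move=> u v w w' s t euv eww uw nvu hs ht; apply/eqP => E.
have [EE|EE] := eqVneq [set u; v]%SET [set w; w']%SET.
  move/setP: EE => EE; have := EE w; have := EE w'; rewrite !inE !eqxx orbT => /orP wE' /orP wE.
  case: wE => /eqP wE; first by rewrite wE eqxx in uw.
  case: wE' => /eqP wE'; first by rewrite wE wE' eqxx in nvu.
  by rewrite wE wE' e_irr in eww.
have q1 : h u v s = p u.
  case: (meet_vertex euv eww EE (hA _ _ _ euv hs)) => //; first by rewrite E; exact: hA.
  by move=> qv; have := hv _ _ _ euv hs; rewrite qv eqxx.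
have q2 : h w w' t = p w.
  rewrite eq_sym in EE; case: (meet_vertex eww euv EE (hA _ _ _ eww ht)) => //; first by rewrite -E; exact: hA.
  by move=> qv; have := hv _ _ _ eww ht; rewrite qv eqxx.
by move: uw; rewrite (vertex_inj (etrans (esym q1) (etrans E q2))) eqxx.
Qed.

Lemma drawing_walk_model : walk_model e.
Proof.
have [h [hc h0 h1 hv hsep]] := half_curves.
have [eps e0 epsP] : exists2 eps, 0 < eps & forall a : (T * T) * (T * T), 
    (let: ((u, v), (w, w')) := a in e u v -> e w w' -> u != w -> (w, w') != (v, u) ->
       forall s t : R, 0 <= s <= 1 -> 0 <= t <= 1 -> eps <= dist (h u v s) (h w w' t)) /\
    (let: ((u, v), _) := a in e u v -> forall s t : R, 0 <= s <= 1 -> 0 <= t <= 1 -> eps <= dist (h u v s) (p v)).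
  apply: fin_eps => [[[u v] [w w']] x y xy [H1 H2]|[[u v] [w w']]].
    split=> [e1 e2 n1 n2 s t hs ht|e1 s t hs ht]; apply: le_trans xy _; first exact: H1.
    exact: (H2 e1 s t).
  have [euv|nuv] := boolP (e u v); last by exists 1.
  have [x2 x20 H2] : exists2 x : R, 0 < x & forall s t : R, 0 <= s <= 1 -> 0 <= t <= 1 -> x <= dist (h u v s) (p v).
    apply: (separation (h2 := fun=> p v)); [exact: hc | move=> t; exact: cvg_cst | move=> s t hs _; exact: hv].
  have [/and3P[eww n1 n2]|nn] := boolP [&& e w w', u != w & (w, w') != (v, u)]; last first.
    exists x2 => //; split=> [_ eww n1 n2|_]; last exact: H2.
    by move: nn; rewrite eww n1 n2.
  have [x1 x10 H1] := separation (hc _ _ euv) (hc _ _ eww) (fun s t => hsep u v w w' s t euv eww n1 n2).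
  exists (Num.min x1 x2); first by rewrite lt_min x10.
  split=> [_ _ _ _ s t hs ht|_ s t hs ht]; rewrite ge_min; first by rewrite H1.
  by rewrite (H2 s t) ?orbT.
(* Two points near a common cell are at distance at most [8 / L < eps], so separated curves share no
   cell. *)
pose L := (Num.truncn (8 / eps)).+1; have L0 : (0 < L)%N by [].
have Leps : 8 < L%:R * eps.
  by rewrite -ltr_pdivrMr // /L; case/andP: (Num.Theory.truncn_itv (ltW (divr_gt0 (ltr0n R 8) e0))).
have l0 : 0 < L%:R :> R by rewrite ltr0n.
have far (D : R) : eps <= D -> L%:R * D <= 8 -> False.
  move=> eD LD; have : L%:R * eps <= L%:R * D by rewrite ler_pM2l.
  by move=> H; have := lt_le_trans Leps (le_trans H LD); rewrite ltxx.
have [d d0 dP] : exists2 d, 0 < d & forall a : T * T, e a.1 a.2 -> forall s t : R, 0 <= s <= 1 -> 0 <= t <= 1 ->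
    `|s - t| < d -> dist (h a.1 a.2 s) (h a.1 a.2 t) < L%:R^-1.
  apply: fin_eps => [[u v] x y yx H euv s t hs ht st|[u v]].
    by apply: H => //; apply: lt_le_trans st yx.
  have [euv|nuv] := boolP (e u v); last by exists 1.
  have li : 0 < L%:R^-1 :> R by rewrite invr_gt0.
  by have [x x0 H] := uniform_continuity (hc _ _ euv) li; exists x.
(* Samples at spacing [1 / n < d] move by less than the width of a cell. *)
pose n := (Num.truncn (1 / d)).+1.
have nd : n%:R^-1 < d.
  have nn : 0 < n%:R :> R by rewrite ltr0n.
  rewrite invf_plt ?posrE // -div1r.
  by case/andP: (Num.Theory.truncn_itv (ltW (divr_gt0 (@ltr01 R) d0))).
(* [fin_eps] handles properties that persist when the number decreases, so the common bound is
   expressed by its inverse. *)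
have [c c0 cP] : exists2 c, 0 < c & forall a : T * T, e a.1 a.2 -> 0 < c -> forall t : R, 0 <= t <= 1 ->
    dist (h a.1 a.2 t) 0 <= c^-1.
  apply: fin_eps => [[u v] x y yx H euv y0 t ht|[u v]].
    have x0 := lt_le_trans y0 yx.
    by apply: le_trans (H euv x0 t ht) _; rewrite lef_pV2.
  have [euv|nuv] := boolP (e u v); last by exists 1.
  have [x x0 H] := curve_bounded (hc _ _ euv); exists x^-1; first by rewrite invr_gt0.
  by move=> _ _ t ht; rewrite invrK; apply: H.
(* The extra 1 keeps cell coordinates positive, as labelled cells must have indices from 1. *)
pose b := c^-1 + 1.
have bP u v (t : R) : e u v -> 0 <= t <= 1 -> `|(h u v t).1| + 1 <= b /\ `|(h u v t).2| + 1 <= b.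
  move=> euv ht; have := cP (u, v) euv c0 t ht; rewrite /dist /= !subr0 => H.
  by split; rewrite lerD2r; apply: le_trans H; rewrite ?lerDl ?lerDr.
pose C u v k := cell b L (h u v (k%:R / n%:R)).
have n0 : 0 < n%:R :> R by rewrite ltr0n.
have tk k : (k <= n)%N -> 0 <= (k%:R / n%:R : R) <= (1 : R).
  by move=> kn; apply/andP; split; [exact: divr_ge0 | rewrite ler_pdivrMr // mul1r ler_nat].
have C0 u v : e u v -> C u v 0%N = cell b L (p u).
  by move=> euv; rewrite /C mul0r h0.
have step u v k l : e u v -> (k <= n)%N -> (l <= n)%N -> k = l \/ k = l.+1 \/ l = k.+1 ->
    let d1 := L%:R * `|(h u v (k%:R / n%:R)).1 - (h u v (l%:R / n%:R)).1| in
    let d2 := L%:R * `|(h u v (k%:R / n%:R)).2 - (h u v (l%:R / n%:R)).2| in d1 < 1 /\ d2 < 1.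
  move=> euv kn ln kl d1 d2.
  have near_t : `|k%:R / n%:R - l%:R / n%:R| < d :> R.
    case: kl => [->|[->|->]]; first by rewrite subrr normr0.
      by rewrite -natr1 mulrDl addrAC subrr add0r div1r ger0_norm // invr_ge0 ltW.
    by rewrite -natr1 mulrDl opprD addrA subrr add0r normrN div1r ger0_norm // invr_ge0 ltW.
  have := dP (u, v) euv _ _ (tk k kn) (tk l ln) near_t; rewrite /dist /= => H.
  have H' : L%:R * (`|(h u v (k%:R / n%:R)).1 - (h u v (l%:R / n%:R)).1| +
     `|(h u v (k%:R / n%:R)).2 - (h u v (l%:R / n%:R)).2|) < 1.
    by rewrite mulrC -ltr_pdivlMr // div1r.
  rewrite mulrDr -/d1 -/d2 in H'.
  have d10 : 0 <= d1 by rewrite mulr_ge0 // ltW.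
  have d20 : 0 <= d2 by rewrite mulr_ge0 // ltW.
  by split; lra.
have near_walk u v q : e u v -> q \in cell b L (p u) :: zigzag (C u v) n ->
    exists2 t : R, 0 <= t <= 1 & near_cell b L q (h u v t).
  move=> euv; rewrite -(C0 _ _ euv) => /mem_zigzag[k [l [kn ln kl ->]]].
  exists (k%:R / n%:R); first exact: tk.
  have [b1 b2] := bP u v _ euv (tk k kn); have [b1' b2'] := bP u v _ euv (tk l ln).
  split; apply: coord_dist => //=; first by rewrite subrr normr0 mulr0.
  have lk : l = k \/ l = k.+1 \/ k = l.+1 by case: kl => ->; [left | right; right].
  by have [] := step u v l k euv ln kn lk.
exists (Num.truncn (L%:R * (2 * b))), (fun u => cell b L (p u)), (fun u v => zigzag (C u v) n); split.
- move=> u v euv; rewrite -(C0 _ _ euv); apply: zigzag_path => k kn.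
  have [b1 b2] := bP u v _ euv (tk k (ltnW kn)); have [b1' b2'] := bP u v _ euv (tk k.+1 kn).
  have [s1 s2] := step u v k k.+1 euv (ltnW kn) kn (or_intror (or_intror erefl)).
  have [s1' s2'] := step u v k.+1 k euv kn (ltnW kn) (or_intror (or_introl erefl)).
  by do !split; apply: coord_step.
- move=> u v q euv; rewrite -(C0 _ _ euv) => /mem_zigzag[k [l [kn ln _ ->]]] /=.
  have [b1 b2] := bP u v _ euv (tk k kn); have [b1' b2'] := bP u v _ euv (tk l ln).
  by rewrite !coord_gt0 // !coord_le.
- move=> u v euv; have evu : e v u by rewrite e_sym.
  apply/hasP; exists (C u v n); first by rewrite -(C0 _ _ euv) -{1}(zigzag_last (C u v) n) mem_last.
  have -> : C u v n = C v u n by rewrite /C divff ?gt_eqF // h1.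
  by rewrite /= -(C0 _ _ evu) -{1}(zigzag_last (C v u) n) mem_last.
- move=> u v euv; apply/negP => /(near_walk u v _ euv)[t ht near1].
  have evu : e v u by rewrite e_sym.
  have hv0 : near_cell b L (cell b L (p v)) (p v).
    have l00 : 0 <= (0 : R) <= (1 : R) by rewrite lexx ler01.
    rewrite -(h0 _ _ evu); have [b1 b2] := bP v u 0 evu l00.
    by split; apply: coord_dist; rewrite // subrr normr0 mulr0.
  have [_ /(_ euv t t ht ht) H] := epsP ((u, v), (u, v)).
  exact: far H (near_cell_dist near1 hv0).
move=> u v w w' q euv eww q1 q2.
have [->|uw] := eqVneq u w; first by left.
have [[-> ->]|nvu] := eqVneq (w, w') (v, u); first by right.
have [s hs near1] := near_walk _ _ _ euv q1; have [t ht near2] := near_walk _ _ _ eww q2.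
have [/(_ euv eww uw nvu s t hs ht) H _] := epsP ((u, v), (w, w')).
by case: (far _ H (near_cell_dist near1 near2)).
Qed.

End PlaneDrawing.

Lemma planar_sparse (R : realType) (T : finType) (e : rel T) : symmetric e -> irreflexive e ->
  planar R e -> sparse e.
Proof.
move=> e_sym e_irr [p [A drawing]].
by apply: walk_model_sparse => //; apply: (drawing_walk_model e_sym e_irr drawing).
Qed.

Theorem theorem3 (R : realType) (r : nat) (T : finType) (e : rel T)
    (hr : (8 <= r)%N) (esym : symmetric e) (eirr : irreflexive e)
    (hplanar : planar R e) (hdeg : (max_degree e <= r)%N) :
  exists c : T -> 'I_r, equitable_coloring e c.
Proof.
have e_deg v : (degree e v <= r)%N by apply: leq_trans (leq_bigmax v) hdeg.
(* With this [s], [r * s] exceeds [#|T|] by at most [r]; if [r] divides [#|T|], all classes get size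
   [s - 1]. *)
have [|c [/is_properP pc sizes]] := equitable_sizes (s := (#|T| %/ r).+1) hr esym eirr
  (planar_sparse esym eirr hplanar) e_deg.
  have := divn_eq #|T| r; have := ltn_mod #|T| r.
  by move: hr; rewrite mulnS mulnC; lia.
exists c; split=> // i j.
have [hi1 hi2] := sizes i; have [hj1 hj2] := sizes j.
move: hi1 hi2 hj1 hj2; rewrite /class_size /color_class; lia.
Qed.
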